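(* Let $k$ be a field of characteristic $3$. Then the Lie superalgebra $\mathfrak{g}(S_4,S_{1,2})$ is isomorphic to the Tits-Kantor-Koecher Lie superalgebra of the Jordan superalgebra $H_3(B(1,2))$, and the Lie superalgebra $\mathfrak{g}(S_4,S_{4,2})$ is isomorphic to the Tits-Kantor-Koecher Lie superalgebra of the Jordan superalgebra $H_3(B(4,2))$.
   Context: In signs, $(-1)^{xy}$ is $-1$ if the homogeneous elements $x,y$ are both odd and $1$ otherwise. Indices $i=0,1,2$ are taken modulo $3$. A quadratic superform on a superspace $U$ is a pair $q=(q_{\bar 0},\mathrm{b})$, with $q_{\bar 0}$ a quadratic form on $U_{\bar 0}$ and $\mathrm{b}$ a supersymmetric even bilinear form on $U$ restricting to the polar form of $q_{\bar 0}$ on $U_{\bar 0}$. The superalgebras $B(1,2)$, $B(4,2)$ ($\mathrm{char}\,k=3$). Let $V$ be a two dimensional vector space with a nonzero alternating bilinear form $\langle\cdot|\cdot\rangle$. $B(1,2)$ has even part $k1$, odd part $V$, $1$ is the unity, $uv=\langle u|v\rangle1$ for $u,v\in V$, and norm $q_{\bar 0}(1)=1$, $\mathrm{b}(u,v)=\langle u|v\rangle$. $B(4,2)$ has even part $\mathrm{End}_k(V)$ and odd part $V$; the product on $\mathrm{End}_k(V)$ is composition, $v\cdot f=f(v)=\bar f\cdot v$ and $u\cdot v=\langle\cdot|u\rangle v$ (the endomorphism $w\mapsto\langle w|u\rangle v$) for $f\in\mathrm{End}_k(V)$, $u,v\in V$, where $f\mapsto\bar f$ is the symplectic involution with $\langle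 f(u)|v\rangle=\langle u|\bar f(v)\rangle$; the norm is $q_{\bar 0}(f)=\det f$, $\mathrm{b}(u,v)=\langle u|v\rangle$. Both are Hurwitz superalgebras (unital composition superalgebras). For a Hurwitz superalgebra $C$ the standard involution is $\bar x=\mathrm{b}(x,1)1-x$, and the para-Hurwitz superalgebra $\bar C$ is $C$ with the same norm and product $x\bullet y=\bar x\bar y$; it is a symmetric composition superalgebra. Put $S_{1,2}=\overline{B(1,2)}$, $S_{4,2}=\overline{B(4,2)}$, and let $S_4$ be the para-Hurwitz algebra attached to the split quaternion algebra $\mathrm{Mat}_2(k)$ (norm $\det$). Triality. For a symmetric composition superalgebra $S$ (with product $\bullet$ and norm $q=(q_{\bar 0},\mathrm{b})$), $\mathfrak{tri}(S)_{\bar i}=\{(d_0,d_1,d_2)\in\mathfrak{osp}(S,q)_{\bar i}^3: d_0(x\bullet y)=d_1(x)\bullet y+(-1)^{ix}x\bullet d_2(y)\ \forall\text{ homogeneous }x,y\in S\}$, $\mathfrak{tri}(S)=\mathfrak{tri}(S)_{\bar 0}\oplus\mathfrak{tri}(S)_{\bar 1}$ with componentwise bracket; $\mathfrak{osp}(S,q)$ is the orthosymplectic Lie superalgebra of $\mathrm{b}$. Put $\theta(d_0,d_1,d_2)=(d_2,d_0,d_1)$, $l_x(y)=x\bullet y$, $r_x(y)=(-1)^{xy}y\bullet x$, $\sigma_{x,y}(z)=(-1)^{yz}\mathrm{b}(x,z)y-(-1)^{x(y+z)}\mathrm{b}(y,z)x$ and $t_{x,y}=(\sigma_{x,y},\frac12\mathrm{b}(x,y)1-r_xl_y,\frac12\mathrm{b}(x,y)1-l_xr_y)\in\mathfrak{tri}(S)$.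 The Lie superalgebra $\mathfrak{g}(S,S')$. $\mathfrak{g}(S,S')=\mathfrak{tri}(S)\oplus\mathfrak{tri}(S')\oplus\bigl(\oplus_{i=0}^2\iota_i(S\otimes S')\bigr)$, where $\iota_i(S\otimes S')$ is a copy of $S\otimes S'$; $\mathfrak{tri}(S)\oplus\mathfrak{tri}(S')$ is a subsuperalgebra with its direct sum bracket, and for homogeneous elements: $[(d_0,d_1,d_2),\iota_i(x\otimes x')]=\iota_i(d_i(x)\otimes x')$; $[(d_0',d_1',d_2'),\iota_i(x\otimes x')]=(-1)^{d_i'x}\iota_i(x\otimes d_i'(x'))$; $[\iota_i(x\otimes x'),\iota_{i+1}(y\otimes y')]=(-1)^{x'y}\iota_{i+2}((x\bullet y)\otimes(x'\bullet y'))$; $[\iota_i(x\otimes x'),\iota_i(y\otimes y')]=(-1)^{xx'+xy'+yy'}\mathrm{b}'(x',y')\theta^i(t_{x,y})+(-1)^{yx'}\mathrm{b}(x,y)\theta'^i(t'_{x',y'})$ (primes denote the analogous objects for $S'$). Jordan side. For a Hurwitz superalgebra $C$, $H_3(C)$ is the Jordan superalgebra of hermitian $3\times3$ matrices over $C$ relative to $(a_{ij})^*=(\bar a_{ji})$, with product $x\circ y=\frac12(xy+(-1)^{xy}yx)$. For a Jordan superalgebra $H$, let $L_x$ be left multiplication by $x$, $d_{x,y}=[L_x,L_y]$ (supercommutator, a derivation of $H$) and $\mathfrak{der}\,H$ the Lie superalgebra of derivations. With $Q=\mathrm{Mat}_2(k)$, $Q^0$ its trace zero elements and $\mathrm{b}$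 the polar form of $\det$, the Tits-Kantor-Koecher Lie superalgebra of $H$ is $\mathcal{T}(Q,H)=(Q^0\otimes H)\oplus\mathfrak{der}\,H$, where $\mathfrak{der}\,H$ is a subsuperalgebra, $[d,a\otimes x]=a\otimes d(x)$, and $[a\otimes x,b\otimes y]=[a,b]\otimes xy-2\mathrm{b}(a,b)d_{x,y}$ for $a,b\in Q^0$, $x,y\in H$, $d\in\mathfrak{der}\,H$ (elements of $Q^0$ are even and $xy$ is the product in $H$). *)

(* Defs.v *)
From HB Require Import structures.
From mathcomp Require Import all_boot all_order all_algebra.
From mathcomp Require Import boolp classical_sets.
From mathcomp Require Import ring.

Set Implicit Arguments.
Unset Strict Implicit.
Unset Printing Implicit Defensive.

Import GRing.Theory.
Local Open Scope ring_scope.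

Section VspaceOf.
Variables (k : fieldType) (V : vectType k).

(* The subspace whose elements are exactly the x satisfying P; meaningful when
   P is stable under linear combinations (mem_vspace_of). *)
Definition vspace_of (P : V -> Prop) : {vspace V} :=
  xget 0%VS [set U : {vspace V} | forall x, x \in U <-> P x]%classic.

Definition lin_closed (P : V -> Prop) : Prop :=
  P 0 /\ forall a x y, P x -> P y -> P (a *: x + y).

Lemma vspace_of_exists (P : V -> Prop) : lin_closed P ->
  exists U : {vspace V}, forall x, x \in U <-> P x.
Proof.
move=> [P0 Plin].
pose A n := `[< exists2 U : {vspace V}, \dim U = n & forall x, x \in U -> P x >].
have exA : exists n, A n.
  exists 0%N; apply/asboolP; exists 0%VS; first by rewrite dimv0.
  by move=> x; rewrite memv0 => /eqP ->.
have ubA n : A n -> (n <= \dim {:V})%N.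
  by move=> /asboolP[U <- _]; apply/dimvS/subvf.
case: (ex_maxnP exA ubA) => n /asboolP[U dU sU] maxn.
exists U => x; split; first exact: sU.
move=> Px; have /maxn : A (\dim (<[x]> + U)%VS).
  apply/asboolP; exists (<[x]> + U)%VS => // y.
  by case/memv_addP => _ /vlineP[a ->] [u Uu ->]; apply: Plin => //; apply: sU.
rewrite -dU => le; suff /eqP -> : U == (<[x]> + U)%VS.
  by rewrite (subvP (addvSl _ _)) // memv_line.
by rewrite eqEdim addvSr.
Qed.

Lemma mem_vspace_of (P : V -> Prop) : lin_closed P ->
  forall x, x \in vspace_of P <-> P x.
Proof.
by move=> /vspace_of_exists[U HU]; rewrite /vspace_of; case: xgetP => [W _ //|/(_ U)].
Qed.

End VspaceOf.

Section Linearity.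
Variable k : fieldType.

Lemma linfunE (U V : vectType k) (f : U -> V) : linear f -> linfun f =1 f.
Proof.
move=> lf.
pose F : {linear U -> V} := HB.pack f (GRing.isLinear.Build k U V _ f lf).
exact: (lfunE F).
Qed.

Definition bilin (U V W : lmodType k) (f : U -> V -> W) : Prop :=
  (forall y, linear (f^~ y)) /\ (forall x, linear (f x)).

Variables (U V W : lmodType k).

Lemma lin0 (f : U -> V) : linear f -> f 0 = 0.
Proof.
by move=> lf; have := lf (-1) 0 0; rewrite scaler0 add0r scaleN1r addNr.
Qed.

Lemma linD (f : U -> V) x y : linear f -> f (x + y) = f x + f y.
Proof. by move=> lf; have := lf 1 x y; rewrite !scale1r. Qed.

Lemma linZ (f : U -> V) a x : linear f -> f (a *: x) = a *: f x.
Proof. by move=> lf; have := lf a x 0; rewrite !addr0 (lin0 lf) addr0. Qed.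

Lemma lin_sum (f : U -> V) I (r : seq I) (P : pred I) (F : I -> U) : linear f ->
  f (\sum_(i <- r | P i) F i) = \sum_(i <- r | P i) f (F i).
Proof.
move=> lf; apply: (big_morph f) => [x y|]; [exact: linD | exact: lin0].
Qed.

Lemma linear_sum_fun I (r : seq I) (P : pred I) (F : I -> U -> V) :
  (forall i, linear (F i)) -> linear (fun x => \sum_(i <- r | P i) F i x).
Proof.
move=> lF a x y; rewrite scaler_sumr -big_split; apply: eq_bigr => i _.
exact: lF.
Qed.

Lemma linear_add (f g : U -> V) :
  linear f -> linear g -> linear (fun x => f x + g x).
Proof. by move=> lf lg a x y; rewrite lf lg scalerDr addrACA. Qed.

Lemma linear_scale c (f : U -> V) : linear f -> linear (fun x => c *: f x).
Proof. by move=> lf a x y; rewrite lf scalerDr !scalerA mulrC. Qed.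

Lemma linear_sub (f g : U -> V) :
  linear f -> linear g -> linear (fun x => f x - g x).
Proof.
move=> lf lg a x y; rewrite lf lg scalerDr scalerN opprD addrACA.
by [].
Qed.

Lemma linear_comp (g : V -> W) (f : U -> V) :
  linear g -> linear f -> linear (fun x => g (f x)).
Proof. by move=> lg lf a x y; rewrite lf lg. Qed.

Lemma linear_form (f : U -> k^o) (v : V) :
  linear f -> linear (fun x => (f x : k) *: v).
Proof. by move=> lf a x y; rewrite lf scalerDl scalerA. Qed.

End Linearity.

(* Parities are booleans: false is even, true is odd, and addition of parities
   is (+). *)
Record superspace (k : fieldType) := Superspace {
  ss_car :> vectType k;
  part : bool -> {vspace ss_car};
  part_sum : (part false + part true)%VS = fullv;
  part_cap : (part false :&: part true)%VS = 0%VS }.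

Arguments part {k} s p.

Record superalgebra (k : fieldType) := Superalgebra {
  sa_space :> superspace k;
  smul : sa_space -> sa_space -> sa_space;
  smul_bilin : bilin smul;
  smul_part : forall p q x y,
    x \in part sa_space p -> y \in part sa_space q ->
    smul x y \in part sa_space (p (+) q) }.

Arguments smul {k s} x y.

Definition superalgebra_iso (k : fieldType) (A B : superalgebra k) : Prop :=
  exists f : 'Hom(A, B),
    [/\ bijective f,
        forall p x, x \in part A p -> f x \in part B p &
        forall x y, f (smul x y) = smul (f x) (f y)].

Definition sgn (k : fieldType) (p : bool) : k := (-1) ^+ p.
Arguments sgn {k} p.

Section Components.
Variables (k : fieldType) (U : superspace k).

Definition hcomp (p : bool) : 'End(U) := daddv_pi (part U p) (part U (~~ p)).

Lemma part_capN p : (part U p :&: part U (~~ p))%VS = 0%VS.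
Proof. by case: p; rewrite /= ?part_cap // capvC part_cap. Qed.

Lemma hcomp_in p x : hcomp p x \in part U p.
Proof. exact: memv_pi. Qed.

Lemma hcomp_sum x : hcomp false x + hcomp true x = x.
Proof. by rewrite /hcomp /= daddv_pi_add ?part_cap // part_sum memvf. Qed.

Lemma hcomp_id p x : x \in part U p -> hcomp p x = x.
Proof. by move=> Ux; rewrite /hcomp daddv_pi_id // part_capN. Qed.

Lemma hcomp_other p x : x \in part U p -> hcomp (~~ p) x = 0.
Proof.
move=> Ux; have := hcomp_sum x; case: p Ux => Ux; rewrite (hcomp_id Ux) /=.
  by move/eqP; rewrite -subr_eq0 addrK => /eqP.
by move/eqP; rewrite addrC -subr_eq0 addrK => /eqP.
Qed.

Lemma hcompE p q x : x \in part U p -> hcomp q x = if q == p then x else 0.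
Proof.
move=> Ux; case: eqP => [->|]; first exact: hcomp_id.
move=> qp; rewrite -(hcomp_other Ux); congr (hcomp _ x).
by case: p q qp {Ux} => [] [].
Qed.

Lemma part_disj x : x \in part U false -> x \in part U true -> x = 0.
Proof.
by move=> U0 U1; apply/eqP; rewrite -memv0 -(part_cap U) memv_cap U0.
Qed.

End Components.

Arguments hcomp {k U} p.

Section Extensions.
Variable k : fieldType.

(* Bilinear extension of an expression which is given on homogeneous elements
   and depends on their parities. *)
Definition sext2 (U V : superspace k) (Z : lmodType k)
    (F : bool -> bool -> U -> V -> Z) (x : U) (y : V) : Z :=
  \sum_(p : bool) \sum_(q : bool) F p q (hcomp p x) (hcomp q y).

Lemma sext2E (U V : superspace k) (Z : lmodType k)
    (F : bool -> bool -> U -> V -> Z) p q x y :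
    (forall p q, bilin (F p q)) -> x \in part U p -> y \in part V q ->
  sext2 F x y = F p q x y.
Proof.
move=> bF Ux Vy.
have F0l p' q' y' : F p' q' 0 y' = 0 by case: (bF p' q') => /(_ y') /lin0.
have F0r p' q' x' : F p' q' x' 0 = 0 by case: (bF p' q') => _ /(_ x') /lin0.
rewrite /sext2 (bigD1 p) //= (bigD1 q) //= (hcomp_id Ux) (hcomp_id Vy).
rewrite !big1 ?addr0 // => [p' np|q' nq].
  by rewrite big1 // => q' _; rewrite (hcompE _ Ux) (negPf np) F0l.
by rewrite (hcompE _ Vy) (negPf nq) F0r.
Qed.

Lemma sext2_bilin (U V : superspace k) (Z : lmodType k)
    (F : bool -> bool -> U -> V -> Z) :
  (forall p q, bilin (F p q)) -> bilin (sext2 F).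
Proof.
move=> bF; split=> [y|x]; apply: linear_sum_fun => p;
  apply: linear_sum_fun => q; case: (bF p q) => l r a u v; rewrite linearP.
  exact: l.
exact: r.
Qed.

Lemma sext2_part (U V W : superspace k) (F : bool -> bool -> U -> V -> W) c :
    (forall p q, bilin (F p q)) ->
    (forall p q x y, x \in part U p -> y \in part V q ->
       F p q x y \in part W (c (+) (p (+) q))) ->
  forall p q x y, x \in part U p -> y \in part V q ->
    sext2 F x y \in part W (c (+) (p (+) q)).
Proof. by move=> bF pF p q x y Ux Vy; rewrite (sext2E bF Ux Vy) pF. Qed.

(* The tensor product of vector spaces, as coordinate matrices with respect to
   the bases vbasis {:U} and vbasis {:V}. *)
Definition stdb (U : vectType k) (i : 'I_(\dim {:U})) : U := (vbasis {:U})`_i.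

Definition tens_vect (U V : vectType k) : vectType k :=
  'M[k]_(\dim {:U}, \dim {:V}).

Definition tens (U V : vectType k) (x : U) (y : V) : tens_vect U V :=
  \matrix_(i, j) (coord (vbasis {:U}) i x * coord (vbasis {:V}) j y).

Definition tlift (U V : vectType k) (Z : lmodType k) (F : U -> V -> Z)
    (M : tens_vect U V) : Z :=
  \sum_i \sum_j (M : 'M[k]_(\dim {:U}, \dim {:V})) i j *: F (stdb i) (stdb j).

Lemma stdb_sum (U : vectType k) (x : U) :
  x = \sum_i coord (vbasis {:U}) i x *: stdb i.
Proof. exact/coord_vbasis/memvf. Qed.

Lemma tens_bilin (U V : vectType k) : bilin (@tens U V).
Proof.
split=> [y|x] a u v; apply/matrixP => i j; rewrite !mxE linearP /=.
  by rewrite mulrDl mulrA.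
by rewrite mulrDr mulrCA.
Qed.

Lemma tlift_linear (U V : vectType k) (Z : lmodType k) (F : U -> V -> Z) :
  linear (tlift F).
Proof.
apply: linear_sum_fun => i; apply: linear_sum_fun => j a M N.
by rewrite !mxE scalerDl scalerA.
Qed.

Lemma tlift_tens (U V : vectType k) (Z : lmodType k) (F : U -> V -> Z) x y :
  bilin F -> tlift F (tens x y) = F x y.
Proof.
move=> [Fl Fr]; rewrite {2}[x]stdb_sum (lin_sum _ _ _ (Fl y)).
apply: eq_bigr => i _; rewrite (linZ _ _ (Fl y)).
rewrite {2}[y]stdb_sum (lin_sum _ _ _ (Fr _)) scaler_sumr.
apply: eq_bigr => j _; rewrite (linZ _ _ (Fr _)) scalerA; congr (_ *: _).
by rewrite mxE.
Qed.

Lemma tens_decomp (U V : vectType k) (M : tens_vect U V) :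
  M = \sum_i \sum_j
        (M : 'M[k]_(\dim {:U}, \dim {:V})) i j *: tens (stdb i) (stdb j).
Proof.
rewrite {1}[M]matrix_sum_delta; apply: eq_bigr => i _; apply: eq_bigr => j _.
congr (_ *: _); apply/matrixP => a b; rewrite !mxE /stdb.
rewrite !coord_free ?(basis_free (vbasisP _)) // -natrM mulnb.
by rewrite (eq_sym i) (eq_sym j).
Qed.

(* The extension to U (x) V of an expression given on x (x) y with x and y
   homogeneous, and the extension to a pair of tensors of an expression given
   on x (x) x' and y (x) y' with all four elements homogeneous. *)
Definition tens_ext (U V : superspace k) (Z : lmodType k)
    (F : bool -> bool -> U -> V -> Z) (M : tens_vect U V) : Z :=
  tlift (sext2 F) M.

Definition tens_ext2 (U V U' V' : superspace k) (Z : lmodType k)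
    (F : bool -> bool -> bool -> bool -> U -> V -> U' -> V' -> Z)
    (M : tens_vect U V) (N : tens_vect U' V') : Z :=
  tens_ext (fun p p' x x' =>
    tens_ext (fun q q' y y' => F p p' q q' x x' y y') N) M.

Lemma tens_ext_linear (U V : superspace k) (Z : lmodType k)
    (F : bool -> bool -> U -> V -> Z) : linear (tens_ext F).
Proof. exact: tlift_linear. Qed.

Lemma tens_extE (U V : superspace k) (Z : lmodType k)
    (F : bool -> bool -> U -> V -> Z) p q x y :
    (forall p q, bilin (F p q)) -> x \in part U p -> y \in part V q ->
  tens_ext F (tens x y) = F p q x y.
Proof.
move=> bF Ux Vy; rewrite /tens_ext tlift_tens ?(sext2E bF Ux Vy) //.
exact: sext2_bilin.
Qed.

Lemma tens_ext2_bilin (U V U' V' : superspace k) (Z : lmodType k)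
    (F : bool -> bool -> bool -> bool -> U -> V -> U' -> V' -> Z) :
  bilin (tens_ext2 F).
Proof.
split=> [N|M]; first exact: tens_ext_linear.
apply: linear_sum_fun => i; apply: linear_sum_fun => j; apply: linear_scale.
apply: linear_sum_fun => p; apply: linear_sum_fun => q; exact: tens_ext_linear.
Qed.

Definition quadrilin (U V U' V' Z : lmodType k) (F : U -> V -> U' -> V' -> Z) :=
  (forall y y', bilin (fun x x' => F x x' y y')) /\
  (forall x x', bilin (F x x')).

Lemma tens_ext_bilin_param (U V : superspace k) (X Y Z : lmodType k)
    (F : bool -> bool -> X -> Y -> U -> V -> Z) (M : tens_vect U V) :
    (forall p q x y, bilin (fun u v => F p q u v x y)) ->
  bilin (fun u v => tens_ext (fun p q => F p q u v) M).
Proof.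
move=> bF; split=> u; apply: linear_sum_fun => i; apply: linear_sum_fun => j;
  apply: linear_scale; apply: linear_sum_fun => p; apply: linear_sum_fun => q;
  by case: (bF p q (hcomp p (stdb i)) (hcomp q (stdb j))).
Qed.

Lemma tens_ext2E (U V U' V' : superspace k) (Z : lmodType k)
    (F : bool -> bool -> bool -> bool -> U -> V -> U' -> V' -> Z)
    p p' q q' x x' y y' :
    (forall p p' q q', quadrilin (F p p' q q')) ->
    x \in part U p -> x' \in part V p' -> y \in part U' q -> y' \in part V' q' ->
  tens_ext2 F (tens x x') (tens y y') = F p p' q q' x x' y y'.
Proof.
move=> bF Ux Vx' Uy Vy'; rewrite /tens_ext2 (tens_extE (p := p) (q := p')) //.
  by rewrite (tens_extE (p := q) (q := q')) // => r r'; case: (bF p p' r r').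
move=> r r'; apply: (tens_ext_bilin_param
  (F := fun s s' u u' v v' => F r r' s s' u u' v v')) => s s' v v'.
by case: (bF r r' s s').
Qed.

End Extensions.

Section Constructions.
Variable k : fieldType.

Lemma vs_sum_full (V : vectType k) (A B : {vspace V}) :
  (forall x, exists2 a, a \in A & exists2 b, b \in B & x = a + b) ->
  (A + B)%VS = fullv.
Proof.
move=> H; apply/eqP; rewrite eqEsubv subvf; apply/subvP => x _.
by have [a Aa [b Bb ->]] := H x; apply: memv_add.
Qed.

Lemma vs_cap0 (V : vectType k) (A B : {vspace V}) :
  (forall x, x \in A -> x \in B -> x = 0) -> (A :&: B)%VS = 0%VS.
Proof.
move=> H; apply/eqP; rewrite -subv0; apply/subvP => x.
by rewrite memv_cap memv0 => /andP[/H h /h ->].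
Qed.

Lemma even_sum (V : vectType k) :
  ((if false then 0%VS else fullv) + (if true then 0%VS else fullv : {vspace V}))%VS
  = fullv.
Proof. by rewrite addv0. Qed.

Lemma even_cap (V : vectType k) :
  ((if false then 0%VS else fullv) :&: (if true then 0%VS else fullv : {vspace V}))%VS
  = 0%VS.
Proof. by rewrite capv0. Qed.

Definition even_ss (V : vectType k) : superspace k :=
  @Superspace k V (fun p => if p then 0%VS else fullv) (even_sum V) (even_cap V).

Section PairSS.
Variables V0 V1 : vectType k.

Definition pair_part (p : bool) : {vspace (V0 * V1)%type} :=
  vspace_of (fun x => if p then x.1 = 0 else x.2 = 0).

Lemma mem_pair_part p x :
  x \in pair_part p <-> (if p then x.1 = 0 else x.2 = 0).
Proof.
apply: mem_vspace_of; split=> [|a y z]; first by case: p.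
by case: p => /= -> ->; rewrite scaler0 addr0.
Qed.

Lemma pair_part_sum : (pair_part false + pair_part true)%VS = fullv.
Proof.
apply: vs_sum_full => -[a b]; exists (a, 0); first exact/mem_pair_part.
exists (0, b); first exact/mem_pair_part.
by congr (_, _); rewrite /= ?addr0 ?add0r.
Qed.

Lemma pair_part_cap : (pair_part false :&: pair_part true)%VS = 0%VS.
Proof. by apply: vs_cap0 => -[a b] /mem_pair_part/= -> /mem_pair_part/= ->. Qed.

Definition pair_ss := Superspace pair_part_sum pair_part_cap.

End PairSS.

Section DirectSum.
Variables U V : superspace k.

Definition dsum_part (p : bool) : {vspace (U * V)%type} :=
  vspace_of (fun x => x.1 \in part U p /\ x.2 \in part V p).

Lemma mem_dsum_part p x :
  x \in dsum_part p <-> x.1 \in part U p /\ x.2 \in part V p.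
Proof.
apply: mem_vspace_of; split=> [|a y z [y1 y2] [z1 z2]] /=.
  by rewrite !mem0v.
by split; rewrite rpredD ?rpredZ.
Qed.

Lemma dsum_part_sum : (dsum_part false + dsum_part true)%VS = fullv.
Proof.
apply: vs_sum_full => -[a b].
exists (hcomp false a, hcomp false b).
  by apply/mem_dsum_part; rewrite !hcomp_in.
exists (hcomp true a, hcomp true b).
  by apply/mem_dsum_part; rewrite !hcomp_in.
by congr (_, _); rewrite /= hcomp_sum.
Qed.

Lemma dsum_part_cap : (dsum_part false :&: dsum_part true)%VS = 0%VS.
Proof.
apply: vs_cap0 => -[a b] /mem_dsum_part/=[a0 b0] /mem_dsum_part/=[a1 b1].
by rewrite (part_disj a0 a1) (part_disj b0 b1).
Qed.

Definition dsum_ss := Superspace dsum_part_sum dsum_part_cap.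

End DirectSum.

Section FinFun.
Variables (I : finType) (U : superspace k).

Definition ffun_part (p : bool) : {vspace {ffun I -> U}} :=
  vspace_of (fun f : {ffun I -> U} => forall i, f i \in part U p).

Lemma mem_ffun_part p (f : {ffun I -> U}) :
  f \in ffun_part p <-> forall i, f i \in part U p.
Proof.
apply: mem_vspace_of; split=> [i|a y z Hy Hz i]; rewrite !ffunE ?mem0v //.
by rewrite rpredD ?rpredZ.
Qed.

Lemma ffun_part_sum : (ffun_part false + ffun_part true)%VS = fullv.
Proof.
apply: vs_sum_full => f.
exists [ffun i => hcomp false (f i)].
  by apply/mem_ffun_part => i; rewrite ffunE hcomp_in.
exists [ffun i => hcomp true (f i)].
  by apply/mem_ffun_part => i; rewrite ffunE hcomp_in.
by apply/ffunP => i; rewrite !ffunE hcomp_sum.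
Qed.

Lemma ffun_part_cap : (ffun_part false :&: ffun_part true)%VS = 0%VS.
Proof.
apply: vs_cap0 => f /mem_ffun_part f0 /mem_ffun_part f1.
by apply/ffunP => i; rewrite ffunE; apply: (part_disj (f0 i) (f1 i)).
Qed.

Definition ffun_ss := Superspace ffun_part_sum ffun_part_cap.

End FinFun.

Section Tensor.
Variables U V : superspace k.

Definition tens_part (r : bool) : {vspace tens_vect U V} :=
  (\sum_(p : bool) <<[seq tens x y | x <- vbasis (part U p),
                                     y <- vbasis (part V (p (+) r))]>>)%VS.

Lemma tens_in p q x y : x \in part U p -> y \in part V q ->
  tens x y \in tens_part (p (+) q).
Proof.
have [tl tr] := @tens_bilin k U V.
move=> Ux Vy; rewrite (coord_vbasis Ux) (lin_sum _ _ _ (tl y)).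
apply: memv_suml => i _; rewrite (linZ _ _ (tl y)) rpredZ //.
rewrite (coord_vbasis Vy) (lin_sum _ _ _ (tr _)).
apply: memv_suml => j _; rewrite (linZ _ _ (tr _)) rpredZ //.
rewrite /tens_part (bigD1 p) //= addbA addbb addFb.
apply: (subvP (addvSl _ _)); apply: memv_span; apply: allpairs_f;
  by rewrite mem_nth // size_tuple.
Qed.

Lemma tens_part_ind r (P : tens_vect U V -> Prop) : lin_closed P ->
    (forall p q x y, p (+) q = r -> x \in part U p -> y \in part V q ->
       P (tens x y)) ->
  forall M, M \in tens_part r -> P M.
Proof.
move=> cP Ht M; suff : (tens_part r <= vspace_of P)%VS.
  by move/subvP => s /s /(mem_vspace_of cP).
apply/subv_sumP => p _; apply/span_subvP => z /allpairsP[[x y] /= [xi yi ->]].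
apply/(mem_vspace_of cP)/(Ht p (p (+) r)); first by rewrite addbA addbb addFb.
  exact: vbasis_mem xi.
exact: vbasis_mem yi.
Qed.

Lemma tens_part_sum : (tens_part false + tens_part true)%VS = fullv.
Proof.
apply/eqP; rewrite eqEsubv subvf; apply/subvP => M _.
have [tl tr] := @tens_bilin k U V.
rewrite [M]tens_decomp; apply: memv_suml => i _; apply: memv_suml => j _.
rewrite rpredZ // -[stdb i]hcomp_sum -[stdb j]hcomp_sum.
rewrite (linD _ _ (tl _)) !(linD _ _ (tr _)).
have H p q x y : x \in part U p -> y \in part V q ->
    tens x y \in (tens_part false + tens_part true)%VS.
  move=> Ux Vy; have := tens_in Ux Vy; case: (p (+) q) => h.
    exact: (subvP (addvSr _ _)).
  exact: (subvP (addvSl _ _)).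
rewrite !rpredD //; apply: H; exact: hcomp_in.
Qed.

Lemma tens_part_cap : (tens_part false :&: tens_part true)%VS = 0%VS.
Proof.
have [tl tr] := @tens_bilin k U V.
pose F (r p q : bool) (x : U) (y : V) : tens_vect U V :=
  if p (+) q == r then tens x y else 0.
have bF r p q : bilin (F r p q).
  rewrite /F; case: eqP => _; first exact: tens_bilin.
  by split=> ? a b c; rewrite scaler0 addr0.
have H r s M : M \in tens_part s -> tens_ext (F r) M = if s == r then M else 0.
  move: M; apply: tens_part_ind.
    split; first by rewrite (lin0 (tens_ext_linear _)) if_same.
    move=> a x y Hx Hy; rewrite tens_ext_linear Hx Hy.
    by case: ifP => // _; rewrite scaler0 addr0.
  by move=> p q x y <- Ux Vy; rewrite (tens_extE (bF r) Ux Vy).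
apply: vs_cap0 => M M0 M1; have := H false _ _ M0; rewrite (H false _ _ M1) /=.
by [].
Qed.

Definition tens_ss := Superspace tens_part_sum tens_part_cap.

End Tensor.

Section Endomorphisms.
Variable U : superspace k.

Definition end_part (p : bool) : {vspace 'End(U)} :=
  vspace_of (fun f : 'End(U) =>
    forall q x, x \in part U q -> f x \in part U (p (+) q)).

Lemma mem_end_part p (f : 'End(U)) : f \in end_part p <->
  forall q x, x \in part U q -> f x \in part U (p (+) q).
Proof.
apply: mem_vspace_of; split=> [q x _|a y z Hy Hz q x Ux].
  by rewrite zero_lfunE mem0v.
by rewrite add_lfunE scale_lfunE rpredD ?rpredZ ?Hy ?Hz.
Qed.

Lemma end_part_sum : (end_part false + end_part true)%VS = fullv.
Proof.
apply: vs_sum_full => f.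
pose g p : 'End(U) := (\sum_(q : bool) (hcomp (p (+) q) \o f \o hcomp q)%VF)%R.
have gin p : g p \in end_part p.
  apply/mem_end_part => q x Ux; rewrite sum_lfunE; apply: memv_suml => r _.
  rewrite !comp_lfunE (hcompE _ Ux); case: eqP => [->|_].
    exact: hcomp_in.
  by rewrite !linear0 mem0v.
exists (g false) => //; exists (g true) => //.
apply/lfunP => x; rewrite add_lfunE !sum_lfunE !big_bool /= !comp_lfunE.
have -> : f x = hcomp false (f (hcomp false x)) + hcomp true (f (hcomp false x))
    + (hcomp false (f (hcomp true x)) + hcomp true (f (hcomp true x))).
  by rewrite !hcomp_sum -linearD hcomp_sum.
by rewrite [RHS]addrACA [RHS]addrC; congr (_ + _); apply: addrC.
Qed.

Lemma end_part_cap : (end_part false :&: end_part true)%VS = 0%VS.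
Proof.
apply: vs_cap0 => f /(mem_end_part _ _) f0 /(mem_end_part _ _) f1.
have H p x : x \in part U p -> f x = 0.
  by case: p => Ux; apply: part_disj; [exact: f1 Ux|exact: f0 Ux|exact: f0 Ux|exact: f1 Ux].
apply/lfunP => x; rewrite zero_lfunE -[x]hcomp_sum linearD /=.
by rewrite (H false) ?(H true) ?hcomp_in ?addr0.
Qed.

Definition end_ss := Superspace end_part_sum end_part_cap.

Definition scomm : 'End(U) -> 'End(U) -> 'End(U) :=
  @sext2 k end_ss end_ss _ (fun p q f g => (f \o g)%VF - sgn (p && q) *: (g \o f)%VF).

End Endomorphisms.

Section SubSS.
Variables (V : vectType k) (W : bool -> {vspace V}).
Hypothesis capW : (W false :&: W true)%VS = 0%VS.

Definition sub_car := subvs_of (W false + W true)%VS.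

Definition sub_part (p : bool) : {vspace sub_car} :=
  vspace_of (fun x => vsval x \in W p).

Lemma mem_sub_part p (x : sub_car) : x \in sub_part p <-> vsval x \in W p.
Proof.
apply: mem_vspace_of; split=> [|a y z Hy Hz]; first by rewrite linear0 mem0v.
by rewrite linearP rpredD ?rpredZ.
Qed.

Lemma sub_W p x : x \in W p -> x \in (W false + W true)%VS.
Proof. by case: p; apply: subvP; [exact: addvSr | exact: addvSl]. Qed.

Lemma sub_part_sum : (sub_part false + sub_part true)%VS = fullv.
Proof.
apply: vs_sum_full => x; have /memv_addP[a Wa [b Wb E]] := subvsP x.
exists (vsproj _ a).
  by apply/mem_sub_part; rewrite vsprojK // (sub_W Wa).
exists (vsproj _ b).
  by apply/mem_sub_part; rewrite vsprojK // (sub_W Wb).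
by apply: subvs_inj; rewrite linearD /= !vsprojK // ?(sub_W Wa) ?(sub_W Wb).
Qed.

Lemma sub_part_cap : (sub_part false :&: sub_part true)%VS = 0%VS.
Proof.
apply: vs_cap0 => x /mem_sub_part x0 /mem_sub_part x1; apply: subvs_inj.
by apply/eqP; rewrite linear0 -memv0 -capW memv_cap x0.
Qed.

Definition sub_ss := Superspace sub_part_sum sub_part_cap.

(* An element of W p, seen as an element of the superspace sub_ss.  To make the
   map total, x is first projected onto W p.  The projection is the identity on
   W p (sub_in_val), and the arguments below do lie in W p: tri(S) and der H are
   closed under the supercommutator; t_(x,y) is in tri(S) when S is a symmetric
   composition superalgebra; and, for C a Hurwitz superalgebra, H_3(C) is closed
   under its product and, for the Hurwitz superalgebras considered here, [L_x, L_y]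
   is a derivation of it. *)
Definition sub_in (p : bool) (x : V) : sub_ss :=
  vsproj (W false + W true)%VS (projv (W p) x).

Lemma sub_in_val p x : x \in W p -> vsval (sub_in p x) = x.
Proof. by move=> Wx; rewrite /sub_in projv_id // vsprojK // (sub_W Wx). Qed.

Lemma sub_in_linear p : linear (sub_in p).
Proof. by move=> a x y; rewrite /sub_in !linearP. Qed.

Lemma sub_in_part p x : sub_in p x \in part sub_ss p.
Proof.
by apply/mem_sub_part; rewrite vsprojK ?(sub_W (memv_proj _ _)) ?memv_proj.
Qed.

End SubSS.

End Constructions.

Arguments sub_in {k V W} capW p x.
Arguments mem_end_part {k U} p f.

Definition sub_val (k : fieldType) (V : vectType k) (W : bool -> {vspace V})
  (capW : (W false :&: W true)%VS = 0%VS) (x : sub_ss capW) : V :=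
  vsval (x : sub_car W).

Section BilinLemmas.
Variable k : fieldType.

Lemma bilin_add (U V Z : lmodType k) (f g : U -> V -> Z) :
  bilin f -> bilin g -> bilin (fun x y => f x y + g x y).
Proof. by move=> [? ?] [? ?]; split=> ?; apply: linear_add. Qed.

Lemma bilin_sub (U V Z : lmodType k) (f g : U -> V -> Z) :
  bilin f -> bilin g -> bilin (fun x y => f x y - g x y).
Proof. by move=> [? ?] [? ?]; split=> ?; apply: linear_sub. Qed.

Lemma bilin_scale c (U V Z : lmodType k) (f : U -> V -> Z) :
  bilin f -> bilin (fun x y => c *: f x y).
Proof. by move=> [? ?]; split=> ?; apply: linear_scale. Qed.

Lemma bilin_flip (U V Z : lmodType k) (f : U -> V -> Z) :
  bilin f -> bilin (fun x y => f y x).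
Proof. by move=> [? ?]; split. Qed.

Lemma bilin_sum (U V Z : lmodType k) I (r : seq I) (P : pred I)
    (f : I -> U -> V -> Z) :
  (forall i, bilin (f i)) -> bilin (fun x y => \sum_(i <- r | P i) f i x y).
Proof.
by move=> bf; split=> ?; apply: linear_sum_fun => i; case: (bf i).
Qed.

Lemma bilin_comp (U V Z Z' : lmodType k) (g : Z -> Z') (f : U -> V -> Z) :
  linear g -> bilin f -> bilin (fun x y => g (f x y)).
Proof. by move=> lg [fl fr]; split=> ? a u v /=; rewrite (fl, fr) lg. Qed.

Lemma bilin_arg (U V U' V' Z : lmodType k) (g : U' -> U) (h : V' -> V)
    (f : U -> V -> Z) :
  linear g -> linear h -> bilin f -> bilin (fun x y => f (g x) (h y)).
Proof.
by move=> lg lh [fl fr]; split=> ? a u v /=; rewrite ?lg ?lh (fl, fr).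
Qed.

Lemma bilin_pair (U V Z Z' : lmodType k) (f : U -> V -> Z) (g : U -> V -> Z') :
  bilin f -> bilin g -> bilin (fun x y => (f x y, g x y)).
Proof. by move=> [fl fr] [gl gr]; split=> ? a u v /=; rewrite (fl, fr) (gl, gr). Qed.

Lemma bilin_ffun (I : finType) (U V Z : lmodType k) (f : I -> U -> V -> Z) :
  (forall i, bilin (f i)) -> bilin (fun x y => [ffun i => f i x y]).
Proof.
move=> bf; split=> ? a u v; apply/ffunP => i; rewrite !ffunE;
  by case: (bf i) => fl fr; rewrite (fl, fr).
Qed.

Lemma mulr_bilin : bilin (fun x y : k^o => x * y : k^o).
Proof. by split=> y a u v; rewrite /GRing.scale /=; ring. Qed.

Lemma scale_bilin (U : lmodType k) : bilin (fun (x : k^o) (u : U) => (x : k) *: u).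
Proof.
split=> y a u v; first by rewrite scalerDl scalerA.
by rewrite scalerDr !scalerA mulrC.
Qed.

Lemma linear_fst (U V : lmodType k) : linear (fst : U * V -> U).
Proof. by []. Qed.

Lemma linear_snd (U V : lmodType k) : linear (snd : U * V -> V).
Proof. by []. Qed.

Lemma linear_app (I : finType) (U : lmodType k) i :
  linear (fun f : {ffun I -> U} => f i).
Proof. by move=> a f g; rewrite !ffunE. Qed.

Lemma linear_id (U : lmodType k) : linear (fun x : U => x).
Proof. by []. Qed.

Lemma lfun_comp_bilin (U V W : vectType k) :
  bilin (fun (f : 'Hom(V, W)) (g : 'Hom(U, V)) => (f \o g)%VF).
Proof.
split=> x a f g; apply/lfunP => u.
  by rewrite !(comp_lfunE, add_lfunE, scale_lfunE).
by rewrite !(comp_lfunE, add_lfunE, scale_lfunE) linearP.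
Qed.

Lemma lfun_app_bilin (U V : vectType k) :
  bilin (fun (f : 'Hom(U, V)) x => f x).
Proof.
split=> x a f g; last exact: linearP.
by rewrite !(add_lfunE, scale_lfunE).
Qed.

Lemma sub_val_linear (V : vectType k) (W : bool -> {vspace V})
  (capW : (W false :&: W true)%VS = 0%VS) : linear (@sub_val k V W capW).
Proof. by move=> a x y; exact: linearP. Qed.

Lemma sub_valE (V : vectType k) (W : bool -> {vspace V})
    (capW : (W false :&: W true)%VS = 0%VS) p x :
  x \in W p -> sub_val (sub_in capW p x) = x.
Proof. exact: sub_in_val. Qed.

Lemma sub_val_in (V : vectType k) (W : bool -> {vspace V})
    (capW : (W false :&: W true)%VS = 0%VS) p (x : sub_ss capW) :
  x \in part (sub_ss capW) p -> sub_val x \in W p.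
Proof. by move/mem_sub_part. Qed.

Section EndSS.
Variable U : superspace k.

Lemma scomm_bilin : bilin (@scomm k U).
Proof.
apply: (@sext2_bilin k (end_ss U) (end_ss U)) => p q; apply: bilin_sub; first exact: lfun_comp_bilin.
exact/bilin_scale/bilin_flip/lfun_comp_bilin.
Qed.

Lemma scommE p q (f g : 'End(U)) : f \in end_part U p -> g \in end_part U q ->
  scomm f g = (f \o g)%VF - sgn (p && q) *: (g \o f)%VF.
Proof.
move=> Uf Ug; rewrite /scomm (@sext2E _ (end_ss U) (end_ss U) _ _ p q) //.
move=> p' q'; apply: bilin_sub; first exact: lfun_comp_bilin.
exact/bilin_scale/bilin_flip/lfun_comp_bilin.
Qed.

End EndSS.

Lemma tens_ext_part (U V Z : superspace k) c
    (F : bool -> bool -> U -> V -> Z) r M :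
    (forall p q, bilin (F p q)) ->
    (forall p q x y, x \in part U p -> y \in part V q ->
       F p q x y \in part Z (c (+) (p (+) q))) ->
  M \in tens_part U V r -> tens_ext F M \in part Z (c (+) r).
Proof.
move=> bF pF; move: M; apply: tens_part_ind.
  split=> [|a M N HM HN]; first by rewrite (lin0 (tens_ext_linear _)) mem0v.
  by rewrite tens_ext_linear rpredD ?rpredZ.
by move=> p q x y <- Ux Vy; rewrite (tens_extE bF Ux Vy) pF.
Qed.

Lemma tens_ext2_part (U V U' V' Z : superspace k)
    (F : bool -> bool -> bool -> bool -> U -> V -> U' -> V' -> Z) r s M N :
    (forall p p' q q', quadrilin (F p p' q q')) ->
    (forall p p' q q' x x' y y', x \in part U p -> x' \in part V p' ->
       y \in part U' q -> y' \in part V' q' ->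
       F p p' q q' x x' y y' \in part Z ((p (+) p') (+) (q (+) q'))) ->
  M \in tens_part U V r -> N \in tens_part U' V' s ->
  tens_ext2 F M N \in part Z (r (+) s).
Proof.
move=> bF pF HM HN; have [bl br] := tens_ext2_bilin F.
move: M HM; apply: tens_part_ind.
  split=> [|a M M' HM HM']; first by rewrite (lin0 (bl N)) mem0v.
  by rewrite bl rpredD ?rpredZ.
move=> p p' x x' <- Ux Vx'; move: N HN; apply: tens_part_ind.
  split=> [|a M M' HM HM']; first by rewrite (lin0 (br _)) mem0v.
  by rewrite br rpredD ?rpredZ.
by move=> q q' y y' <- Uy Vy'; rewrite (tens_ext2E bF Ux Vx' Uy Vy') pF.
Qed.

End BilinLemmas.

(* Only the restriction of sf_q to the even part is relevant. *)
Record superform (k : fieldType) (U : superspace k) := Superform {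
  sf_q : U -> k;
  sf_b : U -> U -> k^o;
  sf_bilin : bilin sf_b;
  sf_even : forall p q x y, p != q -> x \in part U p -> y \in part U q ->
    sf_b x y = 0;
  sf_sym : forall p q x y, x \in part U p -> y \in part U q ->
    sf_b x y = sgn (p && q) *: sf_b y x;
  sf_qZ : forall a x, x \in part U false -> sf_q (a *: x) = a ^+ 2 * sf_q x;
  sf_polar : forall x y, x \in part U false -> y \in part U false ->
    sf_b x y = sf_q (x + y) - sf_q x - sf_q y }.

Record normed_superalgebra (k : fieldType) := NormedSuperalgebra {
  ns_alg :> superalgebra k;
  ns_form : superform ns_alg }.

Definition bform (k : fieldType) (A : normed_superalgebra k) (x y : A) : k :=
  sf_b (ns_form A) x y.

Record unital_normed_superalgebra (k : fieldType) := UnitalNormedSuperalgebra {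
  un_alg :> normed_superalgebra k;
  un_one : un_alg;
  un_one_even : un_one \in part un_alg false;
  un_mul1x : forall x : un_alg, smul un_one x = x;
  un_mulx1 : forall x : un_alg, smul x un_one = x }.

Section Para.
Variables (k : fieldType) (C : unital_normed_superalgebra k).

(* The standard involution of a Hurwitz superalgebra. *)
Definition sbar (x : C) : C := bform x (un_one C) *: un_one C - x.

Lemma sbar_linear : linear sbar.
Proof.
apply: linear_sub; last exact: linear_id.
have [l _] := sf_bilin (ns_form C).
exact: (@linear_form _ _ _ (fun x => sf_b (ns_form C) x (un_one C))).
Qed.

Lemma sbar_part p x : x \in part C p -> sbar x \in part C p.
Proof.
move=> Cx; rewrite /sbar rpredB //; case: p Cx => Cx; last by rewrite rpredZ ?un_one_even.
by rewrite /bform (sf_even (p := true) (q := false) _ _ Cx (un_one_even C)) // scale0r mem0v.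
Qed.

Definition para_mul (x y : C) : C := smul (sbar x) (sbar y).

Lemma para_bilin : bilin para_mul.
Proof. by apply: bilin_arg; [exact: sbar_linear.. | exact: smul_bilin]. Qed.

Lemma para_part p q x y : x \in part C p -> y \in part C q ->
  para_mul x y \in part C (p (+) q).
Proof. by move=> Cx Cy; apply: smul_part; apply: sbar_part. Qed.

(* The para-Hurwitz superalgebra attached to C. *)
Definition para : normed_superalgebra k :=
  @NormedSuperalgebra k (Superalgebra para_bilin para_part) (ns_form C).

End Para.

Section PolarDet.
Variable k : fieldType.

Definition polar_det n (M N : 'M[k]_n) : k^o := \det (M + N) - \det M - \det N.

Lemma polar_detC n (M N : 'M[k]_n) : polar_det M N = polar_det N M.
Proof. by rewrite /polar_det [N + M]addrC -!addrA; congr (_ + _); apply: addrC. Qed.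

Lemma det2E (M : 'M[k]_2) : \det M = M 0 0 * M 1 1 - M 0 1 * M 1 0.
Proof.
rewrite (expand_det_row _ ord0) !big_ord_recl big_ord0 addr0 /cofactor !det_mx11.
rewrite !mxE /= expr0 expr1 mul1r mulN1r mulrN.
by congr (_ * _ - _ * _); congr (M _ _); apply/val_inj.
Qed.

Lemma polar_det_bilin n : n = 2%N -> bilin (@polar_det n).
Proof.
move=> ->.
have H (M N : 'M[k]_2) : polar_det M N =
  M 0 0 * N 1 1 + M 1 1 * N 0 0 - M 0 1 * N 1 0 - M 1 0 * N 0 1.
  by rewrite /polar_det !det2E !mxE; ring.
by split=> N a x y; rewrite !H !mxE /GRing.scale /=; ring.
Qed.

End PolarDet.

Section Mat2.
Variable k : fieldType.

Lemma even_mem (V : vectType k) (x : V) : x \in part (even_ss V) false.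
Proof. exact: memvf. Qed.

Lemma even_memP (V : vectType k) p (x : V) :
  x \in part (even_ss V) p -> p = false \/ x = 0.
Proof. by case: p; [rewrite memv0 => /eqP; right | left]. Qed.

Definition mat2_mul (a b : even_ss 'M[k]_2) : even_ss 'M[k]_2 :=
  (a : 'M[k]_2) *m (b : 'M[k]_2).

Lemma mat2_bilin : bilin mat2_mul.
Proof.
split=> y a u v; rewrite /mat2_mul.
  by rewrite mulmxDl scalemxAl.
by rewrite mulmxDr scalemxAr.
Qed.

Lemma mat2_part p q x y :
  x \in part (even_ss 'M[k]_2) p -> y \in part (even_ss 'M[k]_2) q ->
  mat2_mul x y \in part (even_ss 'M[k]_2) (p (+) q).
Proof.
move=> /even_memP[->|->] /even_memP[->|->];
  rewrite /mat2_mul ?mul0mx ?mulmx0 ?mem0v //.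
exact: even_mem.
Qed.

Definition mat2_alg := Superalgebra mat2_bilin mat2_part.

Definition mat2_b (x y : mat2_alg) : k^o := polar_det (x : 'M_2) (y : 'M_2).

Lemma mat2_b_bilin : bilin mat2_b.
Proof. exact: (polar_det_bilin k (erefl 2%N)). Qed.

Lemma mat2_b_even p q x y : p != q ->
  x \in part mat2_alg p -> y \in part mat2_alg q -> mat2_b x y = 0.
Proof.
have [l r] := mat2_b_bilin.
move=> pq /even_memP[p0|->] /even_memP[q0|->]; rewrite ?(lin0 (l _)) ?(lin0 (r _)) //.
by rewrite p0 q0 in pq.
Qed.

Lemma mat2_b_sym p q x y :
  x \in part mat2_alg p -> y \in part mat2_alg q ->
  mat2_b x y = sgn (p && q) *: mat2_b y x.
Proof.
have [l r] := mat2_b_bilin.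
move=> /even_memP[->|->] hy; last by rewrite (lin0 (l _)) (lin0 (r _)) scaler0.
by rewrite /= scale1r; exact: polar_detC.
Qed.

Lemma mat2_qZ a (x : mat2_alg) : x \in part mat2_alg false ->
  \det (a *: (x : 'M[k]_2)) = a ^+ 2 * \det (x : 'M[k]_2).
Proof. by rewrite detZ. Qed.

Definition mat2_form : superform mat2_alg :=
  @Superform k mat2_alg (fun x => \det (x : 'M[k]_2)) mat2_b
    mat2_b_bilin mat2_b_even mat2_b_sym mat2_qZ (fun _ _ _ _ => erefl).

(* Mat_2(k) with its determinant. *)
Definition Mat2 : unital_normed_superalgebra k :=
  @UnitalNormedSuperalgebra k (NormedSuperalgebra mat2_form) (1%:M : 'M[k]_2)
    (even_mem _) (@mul1mx k 2 2) (@mulmx1 k 2 2).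

End Mat2.

Record sympl_plane (k : fieldType) := SymplPlane {
  sp_car :> vectType k;
  sp_form : sp_car -> sp_car -> k^o;
  sp_dim : \dim {:sp_car} = 2%N;
  sp_bilin : bilin sp_form;
  sp_alt : forall v, sp_form v v = 0;
  sp_neq0 : exists u v, sp_form u v != 0 }.

Section SymplPlane.
Variables (k : fieldType) (V : sympl_plane k).

Local Notation "<| u , v |>" := (@sp_form k V u v) (format "<| u ,  v |>").
Local Notation b0 := ((vbasis {:V})`_0).
Local Notation b1 := ((vbasis {:V})`_1).

Lemma sp_skew u v : <|u, v|> = - <|v, u|>.
Proof.
have [l r] := sp_bilin V.
have := sp_alt (u + v); rewrite (linD _ _ (l _)) !(linD _ _ (r _)) !sp_alt.
by rewrite add0r addr0 => /eqP; rewrite addr_eq0 => /eqP.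
Qed.

Lemma sp_basis v : exists a b : k, v = a *: b0 + b *: b1.
Proof.
have /coord_vbasis -> := memvf v.
pose F := fun i : nat => if insub i is Some j then coord (vbasis {:V}) j v else 0.
exists (F 0%N), (F 1%N).
transitivity (\sum_(i < \dim {:V}) F i *: (vbasis {:V})`_i).
  by apply: eq_bigr => i _; rewrite /F valK.
rewrite -(big_mkord xpredT (fun i => F i *: (vbasis {:V})`_i)).
have E n (G : nat -> V) : n = 2%N -> \sum_(0 <= i < n) G i = G 0%N + G 1%N.
  by move=> ->; rewrite 2?big_nat_recr //= big_geq // add0r.
exact: E (sp_dim V).
Qed.

Lemma sp_basis_neq0 : <|b0, b1|> != 0.
Proof.
have [l r] := sp_bilin V.
have [u [v]] := sp_neq0 V; apply: contraNneq => E.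
have [a [b ->]] := sp_basis u; have [c [d ->]] := sp_basis v.
rewrite (linD _ _ (l _)) !(linD _ _ (r _)) !(linZ _ _ (l _)) !(linZ _ _ (r _)).
by rewrite !sp_alt [<|b1, b0|>]sp_skew E oppr0 !scaler0 !addr0.
Qed.

(* The adjoint of f, written out in the basis b0, b1; it is characterized by
   sympl_barP and sp_nondeg. *)
Definition sympl_bar (f : 'End(V)) : 'End(V) :=
  linfun (fun v => - (<|f b1, v|> / <|b0, b1|>) *: b0
                   + (<|f b0, v|> / <|b0, b1|>) *: b1).

Lemma sympl_barE (f : 'End(V)) v :
  sympl_bar f v = - (<|f b1, v|> / <|b0, b1|>) *: b0
                  + (<|f b0, v|> / <|b0, b1|>) *: b1.
Proof.
have [l r] := sp_bilin V.
rewrite linfunE // => a x y; rewrite !r !mulrDl !opprD !scalerDl.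
rewrite scalerDr -!scalerA !addrA; congr (_ + _); rewrite -!addrA; congr (_ + _).
  by rewrite !scalerA /GRing.scale /= -!mulrA mulrN.
by rewrite addrC; congr (_ + _); rewrite !scalerA /GRing.scale /= -!mulrA.
Qed.

Lemma sympl_barP (f : 'End(V)) u v : <|f u, v|> = <|u, sympl_bar f v|>.
Proof.
have [l r] := sp_bilin V; have n0 := sp_basis_neq0.
have [a [b ->]] := sp_basis u; rewrite sympl_barE linearD !linearZ /=.
rewrite !(linD _ _ (l _)) !(linD _ _ (r _)) !(linZ _ _ (l _)) !(linZ _ _ (r _)).
rewrite !sp_alt [<|b1, b0|>]sp_skew /GRing.scale /=; field.
exact: n0.
Qed.

Lemma sp_nondeg x y : (forall u, <|u, x|> = <|u, y|>) -> x = y.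
Proof.
have [l r] := sp_bilin V; have n0 := sp_basis_neq0.
have [a [b ->]] := sp_basis x; have [c [d ->]] := sp_basis y => H.
have := H b0; have := H b1.
rewrite !(linD _ _ (r _)) !(linZ _ _ (r _)) !sp_alt [<|b1, b0|>]sp_skew.
rewrite /GRing.scale /= !mulr0 !addr0 !add0r => e1 e2.
have -> : b = d by exact: (mulIf n0).
by have -> : a = c by apply: (mulIf n0); apply: oppr_inj; rewrite -!mulrN.
Qed.

Lemma sympl_bar1 : sympl_bar \1%VF = \1%VF.
Proof.
by apply/lfunP => v; apply: sp_nondeg => u; rewrite -sympl_barP !id_lfunE.
Qed.

Lemma sympl_bar_linear : linear sympl_bar.
Proof.
have [l r] := sp_bilin V.
move=> a f g; apply/lfunP => v; apply: sp_nondeg => u.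
rewrite -sympl_barP !(add_lfunE, scale_lfunE) l r -!sympl_barP.
by [].
Qed.

(* The product w |-> <w | u> v of two odd elements of B(4,2). *)
Definition rank1 (u v : V) : 'End(V) := linfun (fun w => <|w, u|> *: v).

Lemma rank1E u v w : rank1 u v w = <|w, u|> *: v.
Proof. by have [l r] := sp_bilin V; rewrite linfunE //; apply: linear_form. Qed.

Lemma rank1_bilin : bilin rank1.
Proof.
have [l r] := sp_bilin V.
split=> x a u v; apply/lfunP => w; rewrite !(rank1E, add_lfunE, scale_lfunE).
  by rewrite r scalerDl scalerA.
by rewrite scalerDr !scalerA mulrC.
Qed.

Definition end_mx (f : 'End(V)) : 'M[k]_(\dim {:V}) :=
  \matrix_(i, j) coord (vbasis {:V}) j (f (vbasis {:V})`_i).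

Lemma end_mx_linear : linear end_mx.
Proof.
move=> a f g; apply/matrixP => i j.
by rewrite !mxE add_lfunE scale_lfunE linearP.
Qed.

Definition end_det (f : 'End(V)) : k := \det (end_mx f).

Definition B12_mul (x y : pair_ss k^o V) : pair_ss k^o V :=
  (x.1 * y.1 + <|x.2, y.2|>, x.1 *: y.2 + y.1 *: x.2).

Lemma B12_bilin : bilin B12_mul.
Proof.
apply: bilin_pair; apply: bilin_add.
- exact: (bilin_arg (@linear_fst k k^o V) (@linear_fst k k^o V) (mulr_bilin k)).
- exact: (bilin_arg (@linear_snd k k^o V) (@linear_snd k k^o V) (sp_bilin V)).
- exact: (bilin_arg (@linear_fst k k^o V) (@linear_snd k k^o V) (scale_bilin V)).
apply: bilin_flip.
exact: (bilin_arg (@linear_fst k k^o V) (@linear_snd k k^o V) (scale_bilin V)).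
Qed.

Lemma B12_part p q x y :
  x \in part (pair_ss k^o V) p -> y \in part (pair_ss k^o V) q ->
  B12_mul x y \in part (pair_ss k^o V) (p (+) q).
Proof.
have [l r] := sp_bilin V.
move=> /mem_pair_part hx /mem_pair_part hy; apply/mem_pair_part.
case: p q hx hy => [] [] /= -> ->; rewrite ?(lin0 (l _)) ?(lin0 (r _)) //;
  by rewrite ?mul0r ?mulr0 ?scale0r ?scaler0 ?addr0.
Qed.

Definition B12_alg := Superalgebra B12_bilin B12_part.

Definition B12_b (x y : B12_alg) : k^o := 2 * (x.1 * y.1) + <|x.2, y.2|>.

Lemma B12_b_bilin : bilin B12_b.
Proof.
apply: bilin_add.
  apply: (bilin_scale (Z := k^o) (2 : k)).
  exact: (bilin_arg (@linear_fst k k^o V) (@linear_fst k k^o V) (mulr_bilin k)).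
exact: (bilin_arg (@linear_snd k k^o V) (@linear_snd k k^o V) (sp_bilin V)).
Qed.

Lemma B12_b_even p q x y : p != q ->
  x \in part (pair_ss k^o V) p -> y \in part (pair_ss k^o V) q -> B12_b x y = 0.
Proof.
have [l r] := sp_bilin V.
move=> pq /mem_pair_part hx /mem_pair_part hy; rewrite /B12_b.
by case: p q pq hx hy => [] [] // _ -> ->;
  rewrite ?(lin0 (l _)) ?(lin0 (r _)) ?mul0r ?mulr0 ?addr0.
Qed.

Lemma B12_b_sym p q x y :
  x \in part (pair_ss k^o V) p -> y \in part (pair_ss k^o V) q ->
  B12_b x y = sgn (p && q) *: B12_b y x.
Proof.
have [l r] := sp_bilin V.
move=> /mem_pair_part hx /mem_pair_part hy; rewrite /B12_b.
by case: p q hx hy => [] [] -> ->; rewrite /sgn /GRing.scale /=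
  ?(lin0 (l _)) ?(lin0 (r _)) ?mul0r ?mulr0 ?add0r ?addr0 ?mulN1r ?mul1r
  ?mulr0 -?sp_skew // [_ * x.1]mulrC.
Qed.

Lemma B12_qZ (a : k) (x : pair_ss k^o V) : x \in part (pair_ss k^o V) false ->
  (a *: x).1 ^+ 2 = a ^+ 2 * x.1 ^+ 2.
Proof. by rewrite /= exprMn. Qed.

Lemma B12_evenP (x : B12_alg) : x \in part B12_alg false -> x.2 = 0.
Proof. by move=> h; exact: (iffLR (@mem_pair_part k k^o V false x) h). Qed.

Lemma B12_polar (x y : pair_ss k^o V) :
  x \in part (pair_ss k^o V) false -> y \in part (pair_ss k^o V) false ->
  B12_b x y = (x + y).1 ^+ 2 - x.1 ^+ 2 - y.1 ^+ 2.
Proof.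
move=> /B12_evenP hx /B12_evenP hy; rewrite /B12_b hx hy /= sp_alt; ring.
Qed.

Definition B12_form : superform B12_alg :=
  @Superform k B12_alg (fun x => x.1 ^+ 2) B12_b
    B12_b_bilin B12_b_even B12_b_sym B12_qZ B12_polar.

Definition B12_one : B12_alg := (1, 0).

Lemma B12_one_even : B12_one \in part (pair_ss k^o V) false.
Proof. exact/mem_pair_part. Qed.

Lemma B12_mul1 (x : B12_alg) : smul B12_one x = x.
Proof.
have [l r] := sp_bilin V.
by case: x => a u; congr (_, _); rewrite /= ?(lin0 (l _)) ?mul1r ?scale1r
  ?scaler0 ?addr0.
Qed.

Lemma B12_1mul (x : B12_alg) : smul x B12_one = x.
Proof.
have [l r] := sp_bilin V.
by case: x => a u; congr (_, _); rewrite /= ?(lin0 (r _)) ?mulr1 ?scale1r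
  ?scaler0 ?addr0 ?add0r.
Qed.

(* B(1,2), with k1 identified with k *)
Definition B12 : unital_normed_superalgebra k :=
  @UnitalNormedSuperalgebra k (NormedSuperalgebra B12_form) B12_one
    B12_one_even B12_mul1 B12_1mul.

(* In B(4,2) one has v . f = f v and f . v = \bar f v. *)
Definition B42_mul (x y : pair_ss 'End(V) V) : pair_ss 'End(V) V :=
  ((x.1 \o y.1)%VF + rank1 x.2 y.2, sympl_bar x.1 y.2 + y.1 x.2).

Lemma B42_bilin : bilin B42_mul.
Proof.
pose f1 := @linear_fst k 'End(V) V; pose f2 := @linear_snd k 'End(V) V.
apply: bilin_pair; apply: bilin_add.
- exact: (bilin_arg f1 f1 (@lfun_comp_bilin k V V V)).
- exact: (bilin_arg f2 f2 rank1_bilin).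
- exact: (bilin_arg (linear_comp sympl_bar_linear f1) f2 (@lfun_app_bilin k V V)).
apply: bilin_flip; exact: (bilin_arg f1 f2 (@lfun_app_bilin k V V)).
Qed.

Lemma B42_part p q x y :
  x \in part (pair_ss 'End(V) V) p -> y \in part (pair_ss 'End(V) V) q ->
  B42_mul x y \in part (pair_ss 'End(V) V) (p (+) q).
Proof.
have [l r] := rank1_bilin.
move=> /mem_pair_part hx /mem_pair_part hy; apply/mem_pair_part.
case: p q hx hy => [] [] /= -> ->; rewrite ?(lin0 (l _)) ?(lin0 (r _)) //;
  by rewrite ?(lin0 sympl_bar_linear) ?comp_lfun0l ?comp_lfun0r ?zero_lfunE
    ?linear0 ?addr0.
Qed.

Definition B42_alg := Superalgebra B42_bilin B42_part.

Definition B42_b (x y : B42_alg) : k^o :=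
  polar_det (end_mx x.1) (end_mx y.1) + <|x.2, y.2|>.

Lemma B42_b_bilin : bilin B42_b.
Proof.
pose f1 := @linear_fst k 'End(V) V; pose f2 := @linear_snd k 'End(V) V.
apply: bilin_add.
  exact: (bilin_arg (linear_comp end_mx_linear f1) (linear_comp end_mx_linear f1)
    (polar_det_bilin k (sp_dim V))).
exact: (bilin_arg f2 f2 (sp_bilin V)).
Qed.

Lemma polar_end0l f : polar_det (end_mx 0) (end_mx f) = 0.
Proof.
have [l r] := polar_det_bilin k (sp_dim V).
by rewrite (lin0 end_mx_linear) (lin0 (l _)).
Qed.

Lemma polar_end0r f : polar_det (end_mx f) (end_mx 0) = 0.
Proof. by rewrite polar_detC polar_end0l. Qed.

Lemma B42_b_even p q x y : p != q ->
  x \in part (pair_ss 'End(V) V) p -> y \in part (pair_ss 'End(V) V) q -> B42_b x y = 0.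
Proof.
have [l r] := sp_bilin V.
move=> pq /mem_pair_part hx /mem_pair_part hy; rewrite /B42_b.
by case: p q pq hx hy => [] [] // _ -> ->;
  rewrite ?(lin0 (l _)) ?(lin0 (r _)) ?polar_end0l ?polar_end0r ?addr0.
Qed.

Lemma B42_b_sym p q x y :
  x \in part (pair_ss 'End(V) V) p -> y \in part (pair_ss 'End(V) V) q ->
  B42_b x y = sgn (p && q) *: B42_b y x.
Proof.
have [l r] := sp_bilin V.
move=> /mem_pair_part hx /mem_pair_part hy; rewrite /B42_b.
by case: p q hx hy => [] [] -> ->; rewrite /sgn /GRing.scale /=
  ?(lin0 (l _)) ?(lin0 (r _)) ?polar_end0l ?polar_end0r ?add0r ?addr0
  ?mulN1r ?mul1r ?mulr0 -?sp_skew // polar_detC.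
Qed.

Lemma B42_qZ (a : k) (x : pair_ss 'End(V) V) : x \in part (pair_ss 'End(V) V) false ->
  end_det (a *: x).1 = a ^+ 2 * end_det x.1.
Proof.
by rewrite /end_det (linZ _ _ end_mx_linear) detZ => _; congr (a ^+ _ * _); apply: sp_dim.
Qed.

Lemma B42_evenP (x : B42_alg) : x \in part B42_alg false -> x.2 = 0.
Proof. by move=> h; exact: (iffLR (@mem_pair_part k 'End(V) V false x) h). Qed.

Lemma B42_polar (x y : pair_ss 'End(V) V) :
  x \in part (pair_ss 'End(V) V) false -> y \in part (pair_ss 'End(V) V) false ->
  B42_b x y = end_det (x + y).1 - end_det x.1 - end_det y.1.
Proof.
move=> /B42_evenP hx /B42_evenP hy; rewrite /B42_b hx hy /= sp_alt addr0.
by rewrite /end_det (linD _ _ end_mx_linear).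
Qed.

Definition B42_form : superform B42_alg :=
  @Superform k B42_alg (fun x => end_det x.1) B42_b
    B42_b_bilin B42_b_even B42_b_sym B42_qZ B42_polar.

Definition B42_one : B42_alg := (\1%VF, 0).

Lemma B42_one_even : B42_one \in part (pair_ss 'End(V) V) false.
Proof. exact/mem_pair_part. Qed.

Lemma B42_mul1 (x : B42_alg) : smul B42_one x = x.
Proof.
have [l r] := rank1_bilin.
by case: x => a u; congr (_, _); rewrite /= ?(lin0 (l _)) ?comp_lfun1l
  ?sympl_bar1 ?id_lfunE ?linear0 ?addr0.
Qed.

Lemma B42_1mul (x : B42_alg) : smul x B42_one = x.
Proof.
have [l r] := rank1_bilin.
by case: x => a u; congr (_, _); rewrite /= ?(lin0 (r _)) ?comp_lfun1r
  ?id_lfunE ?linear0 ?addr0 ?add0r.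
Qed.

Definition B42 : unital_normed_superalgebra k :=
  @UnitalNormedSuperalgebra k (NormedSuperalgebra B42_form) B42_one
    B42_one_even B42_mul1 B42_1mul.

End SymplPlane.

Lemma ord3_a (i j : 'I_3) : (j + 2 == i) = (j + 1 == i + 2).
Proof. by case: i => [[|[|[|i]]] hi] //; case: j => [[|[|[|j]]] hj]. Qed.

Lemma ord3_b (i j : 'I_3) : (j + 1 == i) = (j == i + 2).
Proof. by case: i => [[|[|[|i]]] hi] //; case: j => [[|[|[|j]]] hj]. Qed.

Lemma ord3_c (i j : 'I_3) : (j + 2 == i + 1) = (j == i + 2).
Proof. by case: i => [[|[|[|i]]] hi] //; case: j => [[|[|[|j]]] hj]. Qed.

Lemma ord3_d (i : 'I_3) : (i + 2 == i + 1) = false.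
Proof. by case: i => [[|[|[|i]]] hi]. Qed.

Lemma tens_ext2_0l (k : fieldType) (U V U' V' : superspace k) (Z : lmodType k)
    (F : bool -> bool -> bool -> bool -> U -> V -> U' -> V' -> Z) N :
  tens_ext2 F 0 N = 0.
Proof. by have [l _] := tens_ext2_bilin F; exact: lin0 (l N). Qed.

Lemma tens_ext2_0r (k : fieldType) (U V U' V' : superspace k) (Z : lmodType k)
    (F : bool -> bool -> bool -> bool -> U -> V -> U' -> V' -> Z) M :
  tens_ext2 F M 0 = 0.
Proof. by have [_ r] := tens_ext2_bilin F; exact: lin0 (r M). Qed.

Section LeftMul.
Variables (k : fieldType) (A : superalgebra k).

Definition lmul (x : A) : 'End(A) := linfun (smul x).

Lemma lmulE x z : lmul x z = smul x z.
Proof. by have [_ m] := smul_bilin A; rewrite linfunE. Qed.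

Lemma lmul_linear : linear lmul.
Proof.
have [l m] := smul_bilin A.
by move=> a x y; apply/lfunP => z; rewrite !(lmulE, add_lfunE, scale_lfunE) l.
Qed.

End LeftMul.

Section Triality.
Variables (k : fieldType) (S : normed_superalgebra k).
Implicit Types (p q r : bool) (x y z : S).

Definition osp_part p : {vspace 'End(S)} :=
  vspace_of (fun d : 'End(S) => d \in part (end_ss S) p /\
    forall q r x y, x \in part S q -> y \in part S r ->
      bform (d x) y + sgn (p && q) * bform x (d y) = 0).

Lemma mem_osp p (d : 'End(S)) : d \in osp_part p <->
  d \in part (end_ss S) p /\
  forall q r x y, x \in part S q -> y \in part S r ->
    bform (d x) y + sgn (p && q) * bform x (d y) = 0.
Proof.
have [l m] := sf_bilin (ns_form S).
apply: mem_vspace_of; split.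
  split=> [|q r x y _ _]; first exact: mem0v.
  by rewrite !zero_lfunE /bform (lin0 (l y)) (lin0 (m x)) mulr0 addr0.
move=> a {}d e [pd Hd] [pe He]; split; first by rewrite rpredD ?rpredZ.
move=> q r x y Sx Sy; rewrite !add_lfunE !scale_lfunE /bform l m.
have := Hd q r x y Sx Sy; have := He q r x y Sx Sy; rewrite /bform.
rewrite /GRing.scale /= => /eqP; rewrite addr_eq0 => /eqP ->.
move=> /eqP; rewrite addr_eq0 => /eqP ->; ring.
Qed.

(* The indices 0, 1, 2 form the additive group 'I_3 = Z/3. *)
Definition triple : vectType k := {ffun 'I_3 -> 'End(S)}.

Definition tri_part p : {vspace triple} :=
  vspace_of (fun d : {ffun 'I_3 -> 'End(S)} =>
    (forall i, d i \in osp_part p) /\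
    forall q r x y, x \in part S q -> y \in part S r ->
      d 0 (smul x y) = smul (d 1 x) y + sgn (p && q) *: smul x (d 2 y)).

Lemma mem_tri p (d : {ffun 'I_3 -> 'End(S)}) : d \in tri_part p <->
  (forall i, d i \in osp_part p) /\
  forall q r x y, x \in part S q -> y \in part S r ->
    d 0 (smul x y) = smul (d 1 x) y + sgn (p && q) *: smul x (d 2 y).
Proof.
have [l m] := smul_bilin S.
apply: mem_vspace_of; split.
  split=> [i|q r x y _ _]; rewrite !ffunE ?mem0v // !zero_lfunE.
  by rewrite (lin0 (l y)) (lin0 (m x)) scaler0 addr0.
move=> a {}d e [pd Hd] [pe He]; split.
  by move=> i; rewrite !ffunE rpredD ?rpredZ.
move=> q r x y Sx Sy; rewrite !ffunE !add_lfunE !scale_lfunE l m.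
rewrite (Hd q r) // (He q r) // !scalerDr !scalerA mulrC addrACA.
by [].
Qed.

Lemma tri_cap : (tri_part false :&: tri_part true)%VS = 0%VS.
Proof.
apply: vs_cap0 => d /mem_tri[H0 _] /mem_tri[H1 _]; apply/ffunP => i.
rewrite ffunE; apply: (@part_disj k (end_ss S)).
  by case/mem_osp: (H0 i).
by case/mem_osp: (H1 i).
Qed.

Definition tri_ss : superspace k := sub_ss tri_cap.

Definition tri_val (d : tri_ss) : {ffun 'I_3 -> 'End(S)} := sub_val d.

Definition tri_in p (d : {ffun 'I_3 -> 'End(S)}) : tri_ss := sub_in tri_cap p d.

Definition tri_br : tri_ss -> tri_ss -> tri_ss :=
  sext2 (fun p q d e =>
    tri_in (p (+) q) [ffun i => scomm (tri_val d i) (tri_val e i)]).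

Lemma tri_val_linear : linear tri_val.
Proof. exact: sub_val_linear. Qed.

Lemma tri_in_linear p : linear (tri_in p).
Proof. exact: sub_in_linear. Qed.

Lemma tri_br_aux p q : bilin (fun d e : tri_ss =>
  tri_in (p (+) q) [ffun i => scomm (tri_val d i) (tri_val e i)]).
Proof.
apply: bilin_comp; first exact: tri_in_linear.
apply: bilin_ffun => i.
exact: (bilin_arg (linear_comp (@linear_app _ _ _ i) tri_val_linear)
                  (linear_comp (@linear_app _ _ _ i) tri_val_linear)
                  (@scomm_bilin k S)).
Qed.

Lemma tri_br_bilin : bilin tri_br.
Proof. by apply: sext2_bilin => p q; apply: tri_br_aux. Qed.

Lemma tri_br_part p q d e : d \in part tri_ss p -> e \in part tri_ss q ->
  tri_br d e \in part tri_ss (p (+) q).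
Proof. by move=> hd he; rewrite /tri_br (sext2E tri_br_aux hd he); apply: sub_in_part. Qed.

Definition tri : superalgebra k := Superalgebra tri_br_bilin tri_br_part.

Definition theta (d : {ffun 'I_3 -> 'End(S)}) : {ffun 'I_3 -> 'End(S)} :=
  [ffun i => d (i - 1)].

(* In rmul, sigma and t_triple, p and q stand for the parities of x and y. *)
Definition rmul p x : 'End(S) :=
  linfun (fun z => \sum_(r : bool) sgn (p && r) *: smul (hcomp r z) x).

Definition sigma p q x y : 'End(S) :=
  linfun (fun z => \sum_(r : bool)
    ((sgn (q && r) * bform x (hcomp r z)) *: y
     - (sgn (p && (q (+) r)) * bform y (hcomp r z)) *: x)).

Definition t_triple p q x y : {ffun 'I_3 -> 'End(S)} :=
  [ffun i : 'I_3 =>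
     if i == 0 then sigma p q x y
     else if i == 1 then
       (2^-1 * bform x y) *: \1%VF - (rmul p x \o lmul y)%VF
     else (2^-1 * bform x y) *: \1%VF - (lmul x \o rmul q y)%VF].

Lemma rmul_lin_aux p x :
  linear (fun z => \sum_(r : bool) sgn (p && r) *: smul (hcomp r z) x).
Proof.
have [l _] := smul_bilin S.
apply: linear_sum_fun => r; apply: linear_scale.
by apply: linear_comp (l x) _; exact: linearP.
Qed.

Lemma rmulE p r x z : z \in part S r ->
  rmul p x z = sgn (p && r) *: smul z x.
Proof.
have [l _] := smul_bilin S.
move=> Sz; rewrite linfunE; last exact: rmul_lin_aux.
by rewrite big_bool !(hcompE _ Sz); case: r {Sz} => /=;
  rewrite (lin0 (l x)) scaler0 ?addr0 ?add0r.
Qed.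

Lemma sigma_lin_aux p q x y : linear (fun z => \sum_(r : bool)
    ((sgn (q && r) * bform x (hcomp r z)) *: y
     - (sgn (p && (q (+) r)) * bform y (hcomp r z)) *: x)).
Proof.
have [_ m] := sf_bilin (ns_form S).
have H (c : k) u r : linear (fun z => c * bform u (hcomp r z) : k^o).
  by move=> a z w; rewrite linearP /bform m /GRing.scale /=; ring.
apply: linear_sum_fun => r; apply: linear_sub; apply: linear_form; exact: H.
Qed.

Lemma sigmaE p q r x y z : z \in part S r ->
  sigma p q x y z = (sgn (q && r) * bform x z) *: y
                    - (sgn (p && (q (+) r)) * bform y z) *: x.
Proof.
have [_ m] := sf_bilin (ns_form S).
move=> Sz; rewrite linfunE; last exact: sigma_lin_aux.
have b0 (u : S) : bform u 0 = 0 by rewrite /bform (lin0 (m u)).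
by rewrite big_bool !(hcompE _ Sz); case: r {Sz} => /=;
  rewrite !b0 !mulr0 !scale0r subr0 ?addr0 ?add0r.
Qed.

Lemma rmul_linear p : linear (rmul p).
Proof.
have [l m] := smul_bilin S.
move=> a x y; apply/lfunP => z.
rewrite !(add_lfunE, scale_lfunE) !linfunE; try exact: rmul_lin_aux.
by rewrite !big_bool !m !scalerDr !scalerA ![_ * a]mulrC addrACA.
Qed.

Lemma sigma_bilin p q : bilin (sigma p q).
Proof.
have [l m] := sf_bilin (ns_form S).
split=> u a x y; apply/lfunP => z;
  rewrite !(add_lfunE, scale_lfunE) !linfunE; try exact: sigma_lin_aux.
  rewrite scaler_sumr -big_split; apply: eq_bigr => r _ /=.
  rewrite /bform l scalerDr !scalerBr !scalerA addrACA -opprD; congr (_ - _).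
    by rewrite -scalerDl; congr (_ *: _); rewrite /GRing.scale /=; ring.
  by rewrite [a * _]mulrC.
rewrite scaler_sumr -big_split; apply: eq_bigr => r _ /=.
rewrite /bform l scalerDr !scalerBr !scalerA addrACA -opprD; congr (_ - _).
  by rewrite [a * _]mulrC.
by rewrite -scalerDl; congr (_ *: _); rewrite /GRing.scale /=; ring.
Qed.

Lemma t_bilin p q : bilin (t_triple p q).
Proof.
have bb : bilin (fun x y => (2^-1 * bform x y) *: \1%VF : 'End(S)).
  have [l m] := sf_bilin (ns_form S).
  split=> u a x y.
    rewrite /bform l scalerA -scalerDl; congr (_ *: _).
    by rewrite /GRing.scale /=; ring.
  rewrite /bform m scalerA -scalerDl; congr (_ *: _).
  by rewrite /GRing.scale /=; ring.
apply: bilin_ffun => i; case: (i == 0); first exact: sigma_bilin.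
case: (i == 1); apply: bilin_sub => //.
  exact: (bilin_arg (rmul_linear p) (@lmul_linear k S) (@lfun_comp_bilin k S S S)).
exact: (bilin_arg (@lmul_linear k S) (rmul_linear q) (@lfun_comp_bilin k S S S)).
Qed.

Lemma theta_linear i : linear (fun d => iter i theta d).
Proof.
elim: i => [|i IH] //= a d e.
by rewrite IH; apply/ffunP => j; rewrite !ffunE.
Qed.

End Triality.

Section SuperSkew.
Variables (k : fieldType) (U V : superspace k).

(* From the values f x y, the superanticommutative product
   [x, y] = f x y - (-1)^(xy) f y x. *)
Definition sskew (f : U -> U -> V) (x y : U) : V :=
  f x y - sext2 (fun p q x y => sgn (p && q) *: f y x) x y.

Lemma sskew_bilin f : bilin f -> bilin (sskew f).
Proof.
move=> bf; apply: bilin_sub => //; apply: sext2_bilin => p q.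
exact/bilin_scale/bilin_flip.
Qed.

Lemma sskewE f p q x y : bilin f -> x \in part U p -> y \in part U q ->
  sskew f x y = f x y - sgn (p && q) *: f y x.
Proof.
move=> bf Ux Uy; rewrite /sskew (@sext2E _ _ _ _ _ p q) // => p' q'.
exact/bilin_scale/bilin_flip.
Qed.

Lemma sskew_part f : bilin f ->
    (forall p q x y, x \in part U p -> y \in part U q -> f x y \in part V (p (+) q)) ->
  forall p q x y, x \in part U p -> y \in part U q ->
    sskew f x y \in part V (p (+) q).
Proof.
move=> bf pf p q x y Ux Uy; rewrite (sskewE bf Ux Uy) rpredB //; first exact: pf.
by rewrite rpredZ // addbC; apply: pf.
Qed.

End SuperSkew.

Section GSS.
Variables (k : fieldType) (S S' : normed_superalgebra k).

Local Notation T := (tens_ss S S').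
Local Notation T3 := (ffun_ss 'I_3 T).

(* tri(S) (+) tri(S') (+) the direct sum of the iota_i(S (x) S'); an element is
   written ((d, d'), m), where m i is the component in iota_i(S (x) S'). *)
Definition g_ss : superspace k := dsum_ss (dsum_ss (tri_ss S) (tri_ss S')) T3.

Implicit Types X Y : (tri_ss S * tri_ss S') * {ffun 'I_3 -> tens_vect S S'}.

(* [d, iota_i(x (x) x')] *)
Definition g_act (d : tri_ss S) (m : {ffun 'I_3 -> tens_vect S S'}) : T3 :=
  [ffun i => @tens_ext k S S' T (fun _ _ x x' => tens (tri_val d i x) x') (m i)].

(* [d', iota_i(x (x) x')] *)
Definition g_act' (d' : tri_ss S') (m : {ffun 'I_3 -> tens_vect S S'}) : T3 :=
  [ffun i => \sum_(r : bool) @tens_ext k S S' T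
    (fun p _ x x' => sgn (r && p) *: tens x (tri_val (hcomp r d') i x')) (m i)].

(* [iota_j(x (x) x'), iota_(j+1)(y (x) y')], which is in iota_i for i = j + 2 *)
Definition g_mul (m n : {ffun 'I_3 -> tens_vect S S'}) : T3 :=
  [ffun i => @tens_ext2 k S S' S S' T
    (fun p p' q q' x x' y y' => sgn (p' && q) *: tens (smul x y) (smul x' y'))
    (m (i + 1)) (n (i + 2))].

(* The component in tri(S) of [iota_i(x (x) x'), iota_i(y (x) y')] *)
Definition g_tri (m n : {ffun 'I_3 -> tens_vect S S'}) : tri_ss S :=
  \sum_(i < 3) @tens_ext2 k S S' S S' (tri_ss S)
    (fun p p' q q' x x' y y' =>
       (sgn ((p && p') (+) (p && q') (+) (q && q')) * bform x' y') *:
       tri_in (p (+) q) (iter i (@theta k S) (t_triple p q x y)))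
    (m i) (n i).

(* The component in tri(S') of [iota_i(x (x) x'), iota_i(y (x) y')] *)
Definition g_tri' (m n : {ffun 'I_3 -> tens_vect S S'}) : tri_ss S' :=
  \sum_(i < 3) @tens_ext2 k S S' S S' (tri_ss S')
    (fun p p' q q' x x' y y' =>
       (sgn (q && p') * bform x y) *:
       tri_in (p' (+) q') (iter i (@theta k S') (t_triple p' q' x' y')))
    (m i) (n i).

Definition g_br (X Y : g_ss) : g_ss :=
  ((tri_br X.1.1 Y.1.1 + g_tri X.2 Y.2, tri_br X.1.2 Y.1.2 + g_tri' X.2 Y.2),
   @sskew k g_ss T3 (fun X Y => g_act X.1.1 Y.2 + g_act' X.1.2 Y.2 + g_mul X.2 Y.2)
     X Y).

Lemma g_act_aux (d : tri_ss S) (i : 'I_3) :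
  bilin (fun (x : S) (x' : S') => tens (tri_val d i x) x').
Proof.
apply: (bilin_arg _ _ (@tens_bilin k S S')); [exact: linearP | exact: linear_id].
Qed.

Lemma g_act_bilin : bilin g_act.
Proof.
apply: bilin_ffun => i.
have [tl tr] := @tens_bilin k S S'.
split=> [m|d].
  apply: linear_sum_fun => a; apply: linear_sum_fun => b; apply: linear_scale.
  apply: linear_sum_fun => p; apply: linear_sum_fun => q.
  apply: (linear_comp (tl _)) => c d e.
  by rewrite tri_val_linear !ffunE add_lfunE scale_lfunE.
apply: linear_comp; [exact: tens_ext_linear | exact: linear_app].
Qed.

Lemma g_act'_bilin : bilin g_act'.
Proof.
apply: bilin_ffun => i; apply: bilin_sum => r.
have [tl tr] := @tens_bilin k S S'.
split=> [m|d].
  apply: linear_sum_fun => a; apply: linear_sum_fun => b; apply: linear_scale.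
  apply: linear_sum_fun => p; apply: linear_sum_fun => q; apply: linear_scale.
  apply: (linear_comp (tr _)) => c d e.
  by rewrite linearP tri_val_linear !ffunE add_lfunE scale_lfunE.
apply: linear_comp; [exact: tens_ext_linear | exact: linear_app].
Qed.

Lemma g_mul_bilin : bilin g_mul.
Proof.
apply: bilin_ffun => i.
apply: (bilin_arg _ _ (tens_ext2_bilin _)); exact: linear_app.
Qed.

Lemma g_tri_bilin : bilin g_tri.
Proof.
apply: bilin_sum => i.
apply: (bilin_arg _ _ (tens_ext2_bilin _)); exact: linear_app.
Qed.

Lemma g_tri'_bilin : bilin g_tri'.
Proof.
apply: bilin_sum => i.
apply: (bilin_arg _ _ (tens_ext2_bilin _)); exact: linear_app.
Qed.

Lemma g_br_bilin : bilin g_br.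
Proof.
pose f1 := @linear_fst k (tri_ss S * tri_ss S')%type T3.
pose f2 := @linear_snd k (tri_ss S * tri_ss S')%type T3.
pose f11 := linear_comp (@linear_fst k (tri_ss S) (tri_ss S')) f1.
pose f12 := linear_comp (@linear_snd k (tri_ss S) (tri_ss S')) f1.
apply: bilin_pair; last first.
  apply: sskew_bilin; apply: bilin_add; last exact: (bilin_arg f2 f2 g_mul_bilin).
  apply: bilin_add; first exact: (bilin_arg f11 f2 g_act_bilin).
  exact: (bilin_arg f12 f2 g_act'_bilin).
apply: bilin_pair; apply: bilin_add.
- exact: (bilin_arg f11 f11 (tri_br_bilin S)).
- exact: (bilin_arg f2 f2 g_tri_bilin).
- exact: (bilin_arg f12 f12 (tri_br_bilin S')).
exact: (bilin_arg f2 f2 g_tri'_bilin).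
Qed.

Lemma tri_val_part p (d : tri_ss S) i :
  d \in part (tri_ss S) p -> tri_val d i \in end_part S p.
Proof. by move/sub_val_in => /mem_tri[/(_ i) /mem_osp[]]. Qed.

Lemma g_act_part p q d m : d \in part (tri_ss S) p -> m \in part T3 q ->
  g_act d m \in part T3 (p (+) q).
Proof.
move=> hd /mem_ffun_part hm; apply/mem_ffun_part => i; rewrite ffunE.
apply: (@tens_ext_part k S S' T p) => //.
  by move=> _ _; exact: g_act_aux.
move=> s s' x x' Sx Sx'; rewrite addbA; apply: tens_in => //.
by move/mem_end_part: (tri_val_part i hd); apply.
Qed.

Lemma g_mul_quad c : quadrilin (fun (x : S) (x' : S') (y : S) (y' : S') =>
  c *: tens (smul x y) (smul x' y')).
Proof.
have [l m] := smul_bilin S; have [l' m'] := smul_bilin S'.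
split=> z z'; apply: bilin_scale.
  exact: (bilin_arg (l z) (l' z') (@tens_bilin k S S')).
exact: (bilin_arg (m z) (m' z') (@tens_bilin k S S')).
Qed.

Lemma g_mul_part p q m n : m \in part T3 p -> n \in part T3 q ->
  g_mul m n \in part T3 (p (+) q).
Proof.
move=> /mem_ffun_part hm /mem_ffun_part hn; apply/mem_ffun_part => i.
rewrite ffunE; apply: tens_ext2_part (hm _) (hn _).
  by move=> *; apply: g_mul_quad.
move=> r r' s s' x x' y y' hx hx' hy hy'; rewrite rpredZ // addbACA.
by apply: tens_in; apply: smul_part.
Qed.

Lemma bilin_prodZ (U V Z : lmodType k) (c : k) (g : V -> k^o) (h : U -> Z) :
  linear g -> linear h -> bilin (fun u v => (c * g v) *: h u).
Proof.
move=> lg lh; split=> z a u v.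
  by rewrite lh scalerDr !scalerA [_ * a]mulrC.
by rewrite lg mulrDr scalerDl scalerA /GRing.scale /= mulrCA.
Qed.

Lemma g_tri_quad c p q i : quadrilin (fun (x : S) (x' : S') (y : S) (y' : S') =>
  (c * bform x' y') *: tri_in (p (+) q) (iter i (@theta k S) (t_triple p q x y))).
Proof.
have [l m] := sf_bilin (ns_form S'); have [tl tr] := @t_bilin k S p q.
have lt := linear_comp (@tri_in_linear k S (p (+) q)) (@theta_linear k S i).
split=> z z'.
  exact: (bilin_prodZ c (l z') (linear_comp lt (tl z))).
exact: (bilin_prodZ c (m z') (linear_comp lt (tr z))).
Qed.

Lemma g_tri_part p q m n : m \in part T3 p -> n \in part T3 q ->
  g_tri m n \in part (tri_ss S) (p (+) q).
Proof.
move=> /mem_ffun_part hm /mem_ffun_part hn; apply: rpred_sum => i _.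
apply: tens_ext2_part (hm _) (hn _); first by move=> *; apply: g_tri_quad.
move=> r r' s s' x x' y y' hx hx' hy hy'; rewrite (addbACA r r' s s').
case: (eqVneq r' s') => [->|ne]; first by rewrite (addbb s') addbF rpredZ ?sub_in_part.
by rewrite /bform (sf_even _ ne hx' hy') mulr0 scale0r mem0v.
Qed.

End GSS.

Section G.
Variables (k : fieldType) (S S' : normed_superalgebra k).

Local Notation T := (tens_ss S S').
Local Notation T3 := (ffun_ss 'I_3 T).

Lemma g_act'_part p q d m : d \in part (tri_ss S') p -> m \in part T3 q ->
  @g_act' k S S' d m \in part T3 (p (+) q).
Proof.
move=> hd /mem_ffun_part hm; apply/mem_ffun_part => i; rewrite ffunE.
apply: rpred_sum => r _.
have he : hcomp r d \in part (tri_ss S') p.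
  by rewrite (hcompE _ hd); case: ifP => // _; rewrite mem0v.
have [tl tr] := @tens_bilin k S S'.
apply: (@tens_ext_part k S S' T p) => //.
  move=> s s'; apply: bilin_scale.
  by apply: (bilin_arg _ _ (@tens_bilin k S S')); [exact: linear_id | exact: linearP].
move=> s s' x x' Sx Sx'; rewrite rpredZ // addbCA; apply: tens_in => //.
by move/mem_end_part: (tri_val_part i he); apply.
Qed.

Lemma g_tri'_quad c p q i : quadrilin (fun (x : S) (x' : S') (y : S) (y' : S') =>
  (c * bform x y) *: tri_in (p (+) q) (iter i (@theta k S') (t_triple p q x' y'))).
Proof.
have [l m] := sf_bilin (ns_form S); have [tl tr] := @t_bilin k S' p q.
have lt := linear_comp (@tri_in_linear k S' (p (+) q)) (@theta_linear k S' i).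
split=> z z'; apply: bilin_flip.
  exact: (bilin_prodZ c (l z) (linear_comp lt (tl z'))).
exact: (bilin_prodZ c (m z) (linear_comp lt (tr z'))).
Qed.

Lemma g_tri'_part p q m n : m \in part T3 p -> n \in part T3 q ->
  @g_tri' k S S' m n \in part (tri_ss S') (p (+) q).
Proof.
move=> /mem_ffun_part hm /mem_ffun_part hn; apply: rpred_sum => i _.
apply: tens_ext2_part (hm _) (hn _); first by move=> *; apply: g_tri'_quad.
move=> r r' s s' x x' y y' hx hx' hy hy'; rewrite (addbACA r r' s s').
case: (eqVneq r s) => [->|ne]; first by rewrite (addbb s) addFb rpredZ ?sub_in_part.
by rewrite /bform (sf_even _ ne hx hy) mulr0 scale0r mem0v.
Qed.

Lemma g_ssP p X : X \in part (g_ss S S') p ->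
  [/\ X.1.1 \in part (tri_ss S) p, X.1.2 \in part (tri_ss S') p &
      X.2 \in part T3 p].
Proof. by move/mem_dsum_part => [/mem_dsum_part[? ?] ?]. Qed.

Lemma g_br_part p q X Y :
  X \in part (g_ss S S') p -> Y \in part (g_ss S S') q ->
  g_br X Y \in part (g_ss S S') (p (+) q).
Proof.
move=> hX hY; have [X1 X2 X3] := g_ssP hX; have [Y1 Y2 Y3] := g_ssP hY.
apply/mem_dsum_part; split.
  apply/mem_dsum_part; split; apply: rpredD.
  - exact: tri_br_part.
  - exact: g_tri_part.
  - exact: tri_br_part.
  exact: g_tri'_part.
apply: sskew_part hX hY.
  pose f1 := @linear_fst k (tri_ss S * tri_ss S')%type T3.
  pose f2 := @linear_snd k (tri_ss S * tri_ss S')%type T3.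
  pose f11 := linear_comp (@linear_fst k (tri_ss S) (tri_ss S')) f1.
  pose f12 := linear_comp (@linear_snd k (tri_ss S) (tri_ss S')) f1.
  apply: bilin_add; last exact: (bilin_arg f2 f2 (@g_mul_bilin k S S')).
  apply: bilin_add; first exact: (bilin_arg f11 f2 (@g_act_bilin k S S')).
  exact: (bilin_arg f12 f2 (@g_act'_bilin k S S')).
move=> r s Z W /g_ssP[Z1 Z2 Z3] /g_ssP[W1 W2 W3].
by apply: rpredD; [apply: rpredD; [exact: g_act_part|exact: g_act'_part]
                | exact: g_mul_part].
Qed.

Definition g_superalgebra : superalgebra k :=
  Superalgebra (@g_br_bilin k S S') g_br_part.

Definition g_of_tri (d : tri S) : g_superalgebra := ((d, 0), 0).
Definition g_of_tri' (d' : tri S') : g_superalgebra := ((0, d'), 0).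
Definition iota (i : 'I_3) (m : tens_ss S S') : g_superalgebra :=
  ((0, 0), [ffun j => if j == i then m else 0]).

Let act0l m : @g_act k S S' 0 m = 0.
Proof. by have [l _] := @g_act_bilin k S S'; exact: lin0 (l m). Qed.
Let act0r d : @g_act k S S' d 0 = 0.
Proof. by have [_ l] := @g_act_bilin k S S'; exact: lin0 (l d). Qed.
Let act'0l m : @g_act' k S S' 0 m = 0.
Proof. by have [l _] := @g_act'_bilin k S S'; exact: lin0 (l m). Qed.
Let act'0r d : @g_act' k S S' d 0 = 0.
Proof. by have [_ l] := @g_act'_bilin k S S'; exact: lin0 (l d). Qed.
Let mul0l m : @g_mul k S S' 0 m = 0.
Proof. by have [l _] := @g_mul_bilin k S S'; exact: lin0 (l m). Qed.
Let mul0r d : @g_mul k S S' d 0 = 0.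
Proof. by have [_ l] := @g_mul_bilin k S S'; exact: lin0 (l d). Qed.
Let gtri0l m : @g_tri k S S' 0 m = 0.
Proof. by have [l _] := @g_tri_bilin k S S'; exact: lin0 (l m). Qed.
Let gtri0r d : @g_tri k S S' d 0 = 0.
Proof. by have [_ l] := @g_tri_bilin k S S'; exact: lin0 (l d). Qed.
Let gtri'0l m : @g_tri' k S S' 0 m = 0.
Proof. by have [l _] := @g_tri'_bilin k S S'; exact: lin0 (l m). Qed.
Let gtri'0r d : @g_tri' k S S' d 0 = 0.
Proof. by have [_ l] := @g_tri'_bilin k S S'; exact: lin0 (l d). Qed.
Let tbr0l (A : normed_superalgebra k) (d : tri A) : tri_br 0 d = 0.
Proof. by have [l _] := @tri_br_bilin k A; exact: lin0 (l d). Qed.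
Let tbr0r (A : normed_superalgebra k) (d : tri A) : tri_br d 0 = 0.
Proof. by have [_ l] := @tri_br_bilin k A; exact: lin0 (l d). Qed.
Let g0E :=
  (act0l, act0r, act'0l, act'0r, mul0l, mul0r, gtri0l, gtri0r, gtri'0l, gtri'0r,
   tbr0l, tbr0r, oppr0, addr0, add0r, subr0, scaler0).

Let fbr (X Y : g_ss S S') : T3 :=
  g_act X.1.1 Y.2 + g_act' X.1.2 Y.2 + g_mul X.2 Y.2.

Let fbr_bilin : bilin fbr.
Proof.
pose f1 := @linear_fst k (tri_ss S * tri_ss S')%type T3.
pose f2 := @linear_snd k (tri_ss S * tri_ss S')%type T3.
pose f11 := linear_comp (@linear_fst k (tri_ss S) (tri_ss S')) f1.
pose f12 := linear_comp (@linear_snd k (tri_ss S) (tri_ss S')) f1.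
apply: bilin_add; last exact: (bilin_arg f2 f2 (@g_mul_bilin k S S')).
apply: bilin_add; first exact: (bilin_arg f11 f2 (@g_act_bilin k S S')).
exact: (bilin_arg f12 f2 (@g_act'_bilin k S S')).
Qed.

Let g_brE p q X Y : X \in part (g_ss S S') p -> Y \in part (g_ss S S') q ->
  g_br X Y = ((tri_br X.1.1 Y.1.1 + g_tri X.2 Y.2,
               tri_br X.1.2 Y.1.2 + g_tri' X.2 Y.2),
              fbr X Y - sgn (p && q) *: fbr Y X).
Proof. by move=> hX hY; rewrite /g_br (sskewE fbr_bilin hX hY). Qed.

Lemma g_of_tri_part p d : d \in part (tri S) p ->
  g_of_tri d \in part g_superalgebra p.
Proof.
move=> hd; apply/mem_dsum_part; split; last exact: mem0v.
by apply/mem_dsum_part; split; rewrite ?mem0v.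
Qed.

Lemma g_of_tri'_part p d : d \in part (tri S') p ->
  g_of_tri' d \in part g_superalgebra p.
Proof.
move=> hd; apply/mem_dsum_part; split; last exact: mem0v.
by apply/mem_dsum_part; split; rewrite ?mem0v.
Qed.

Lemma iota_part i p m : m \in part (tens_ss S S') p ->
  iota i m \in part g_superalgebra p.
Proof.
move=> hm; apply/mem_dsum_part; split; first exact: mem0v.
by apply/mem_ffun_part => j; rewrite ffunE; case: (j == i); rewrite ?mem0v.
Qed.

Lemma g_tri_tri p q d e : d \in part (tri S) p -> e \in part (tri S) q ->
  smul (g_of_tri d) (g_of_tri e) = g_of_tri (smul d e).
Proof.
move=> hd he; rewrite /smul /= (g_brE (g_of_tri_part hd) (g_of_tri_part he)).
by rewrite /fbr /= !g0E.
Qed.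

Lemma g_tri'_tri' p q d e : d \in part (tri S') p -> e \in part (tri S') q ->
  smul (g_of_tri' d) (g_of_tri' e) = g_of_tri' (smul d e).
Proof.
move=> hd he; rewrite /smul /= (g_brE (g_of_tri'_part hd) (g_of_tri'_part he)).
by rewrite /fbr /= !g0E.
Qed.

Lemma g_tri_tri' p q d e : d \in part (tri S) p -> e \in part (tri S') q ->
  smul (g_of_tri d) (g_of_tri' e) = 0.
Proof.
move=> hd he; rewrite /smul /= (g_brE (g_of_tri_part hd) (g_of_tri'_part he)).
by rewrite /fbr /= !g0E.
Qed.

Lemma g_tri_iota r p p' d i x x' :
  d \in part (tri S) r -> x \in part S p -> x' \in part S' p' ->
  smul (g_of_tri d) (iota i (tens x x')) = iota i (tens (tri_val d i x) x').
Proof.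
move=> hd hx hx'; rewrite /smul /=.
rewrite (g_brE (g_of_tri_part hd) (iota_part _ (tens_in hx hx'))).
rewrite /fbr /= !g0E; congr (_, _); apply/ffunP => j; rewrite !ffunE.
case: eqP => [->|_]; last by rewrite (lin0 (tens_ext_linear _)).
by rewrite (tens_extE (p := p) (q := p')) // => *; apply: g_act_aux.
Qed.

Lemma g_tri'_iota r p p' d i x x' :
  d \in part (tri S') r -> x \in part S p -> x' \in part S' p' ->
  smul (g_of_tri' d) (iota i (tens x x'))
  = iota i (sgn (r && p) *: tens x (tri_val d i x')).
Proof.
move=> hd hx hx'; rewrite /smul /=.
rewrite (g_brE (g_of_tri'_part hd) (iota_part _ (tens_in hx hx'))).
rewrite /fbr /= !g0E; congr (_, _); apply/ffunP => j; rewrite !ffunE.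
case: eqP => [->|_]; last first.
  by rewrite big1 // => s _; rewrite (lin0 (tens_ext_linear _)).
have [tl tr] := @tens_bilin k S S'.
have E s : @tens_ext k S S' T (fun p0 _ x0 x'0 =>
    sgn (s && p0) *: tens x0 (tri_val (hcomp s d) i x'0)) (tens x x')
    = sgn (s && p) *: tens x (tri_val (hcomp s d) i x').
  rewrite (tens_extE (p := p) (q := p')) // => s1 s2; apply: bilin_scale.
  by apply: (bilin_arg _ _ (@tens_bilin k S S')); [exact: linear_id | exact: linearP].
rewrite (bigD1 r) //= big1 ?addr0 => [|s sr]; rewrite E (hcompE _ hd).
  by rewrite eqxx.
rewrite (negPf sr) (lin0 (@tri_val_linear k S')) ffunE zero_lfunE.
by rewrite (lin0 (tr _)) scaler0.
Qed.

Lemma g_iota_succ i p p' q q' x x' y y' :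
  x \in part S p -> x' \in part S' p' -> y \in part S q -> y' \in part S' q' ->
  smul (iota i (tens x x')) (iota (i + 1) (tens y y'))
  = iota (i + 2) (sgn (p' && q) *: tens (smul x y) (smul x' y')).
Proof.
move=> hx hx' hy hy'; rewrite {1}/smul /=.
rewrite (g_brE (iota_part _ (tens_in hx hx')) (iota_part _ (tens_in hy hy'))).
have ne (j : 'I_3) : (j == j + 1) = false by case: j => [[|[|[|]]]].
have E m n : @g_tri k S S' (iota i m).2 (iota (i + 1) n).2 = 0.
  rewrite /g_tri big1 // => j _; rewrite !ffunE; case: (eqVneq j i) => [->|_].
    by rewrite ne tens_ext2_0r.
  by rewrite tens_ext2_0l.
have E' m n : @g_tri' k S S' (iota i m).2 (iota (i + 1) n).2 = 0.
  rewrite /g_tri' big1 // => j _; rewrite !ffunE; case: (eqVneq j i) => [->|_].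
    by rewrite ne tens_ext2_0r.
  by rewrite tens_ext2_0l.
rewrite E E' /fbr /= !g0E; congr (_, _).
have -> : g_mul [ffun j => if j == i + 1 then tens y y' else 0]
                [ffun j => if j == i then tens x x' else 0] = 0 :> T3.
  apply/ffunP => j; rewrite !ffunE.
  have -> : (j + 2 == i) = (j + 1 == i + 2).
    exact: ord3_a.
  case: (eqVneq (j + 1) (i + 2)) => [->|_]; last by rewrite tens_ext2_0r.
  suff -> : (i + 2 == i + 1) = false by rewrite tens_ext2_0l.
  exact: ord3_d.
rewrite scaler0 subr0; apply/ffunP => j; rewrite !ffunE.
have -> : (j + 1 == i) = (j == i + 2) by exact: ord3_b.
have -> : (j + 2 == i + 1) = (j == i + 2) by exact: ord3_c.
case: ifP => _; last by rewrite tens_ext2_0r.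
rewrite (tens_ext2E (p := p) (p' := p') (q := q) (q' := q')) // => *.
exact: g_mul_quad.
Qed.

Lemma g_iota_iota i p p' q q' x x' y y' :
  x \in part S p -> x' \in part S' p' -> y \in part S q -> y' \in part S' q' ->
  smul (iota i (tens x x')) (iota i (tens y y'))
  = g_of_tri ((sgn ((p && p') (+) (p && q') (+) (q && q')) * bform x' y') *:
              tri_in (p (+) q) (iter i (@theta k S) (t_triple p q x y)))
    + g_of_tri' ((sgn (q && p') * bform x y) *:
              tri_in (p' (+) q') (iter i (@theta k S') (t_triple p' q' x' y'))).
Proof.
move=> hx hx' hy hy'; rewrite {1}/smul /=.
rewrite (g_brE (iota_part _ (tens_in hx hx')) (iota_part _ (tens_in hy hy'))).
have M0 m n : g_mul [ffun j => if j == i then m else 0]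
                [ffun j => if j == i then n else 0] = 0 :> T3.
  apply/ffunP => j; rewrite !ffunE.
  case: (eqVneq (j + 1) i) => [<-|_]; last by rewrite tens_ext2_0l.
  suff -> : (j + 2 == j + 1) = false by rewrite tens_ext2_0r.
  exact: ord3_d.
rewrite /fbr /= !M0 !g0E; congr (_, _, _); last by rewrite addr0.
  rewrite addr0 /g_tri (bigD1 i) //= big1 ?addr0 => [|j ji]; rewrite !ffunE.
    rewrite eqxx (tens_ext2E (p := p) (p' := p') (q := q) (q' := q')) // => *.
    exact: g_tri_quad.
  by rewrite (negPf ji) tens_ext2_0r.
rewrite add0r /g_tri' (bigD1 i) //= big1 ?addr0 => [|j ji]; rewrite !ffunE.
  rewrite eqxx (tens_ext2E (p := p) (p' := p') (q := q) (q' := q')) // => *.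
  exact: g_tri'_quad.
by rewrite (negPf ji) tens_ext2_0r.
Qed.

End G.

Section H3.
Variables (k : fieldType) (C : unital_normed_superalgebra k).

Local Notation mat3 := {ffun 'I_3 * 'I_3 -> C}.

Definition mat3_mul (a b : mat3) : mat3 :=
  [ffun ij => \sum_(l < 3) smul (a (ij.1, l)) (b (l, ij.2))].

Definition herm_part p : {vspace mat3} :=
  vspace_of (fun a : mat3 => a \in ffun_part _ C p /\
    forall i j, a (i, j) = sbar (a (j, i))).

Lemma mem_herm p (a : mat3) : a \in herm_part p <->
  a \in ffun_part _ C p /\ forall i j, a (i, j) = sbar (a (j, i)).
Proof.
apply: mem_vspace_of; split.
  by split=> [|i j]; rewrite ?mem0v // !ffunE (lin0 (@sbar_linear k C)).
move=> c {}a b [pa Ha] [pb Hb]; split; first by rewrite rpredD ?rpredZ.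
by move=> i j; rewrite !ffunE sbar_linear -Ha -Hb.
Qed.

Lemma herm_cap : (herm_part false :&: herm_part true)%VS = 0%VS.
Proof.
apply: vs_cap0 => a /mem_herm[a0 _] /mem_herm[a1 _].
exact: (@part_disj k (ffun_ss _ C)).
Qed.

Definition H3_ss : superspace k := sub_ss herm_cap.

Definition H3_val (x : H3_ss) : mat3 := sub_val x.

Definition H3_mul : H3_ss -> H3_ss -> H3_ss :=
  sext2 (fun p q x y => sub_in herm_cap (p (+) q)
    (2^-1 *: (mat3_mul (H3_val x) (H3_val y)
              + sgn (p && q) *: mat3_mul (H3_val y) (H3_val x)))).

Lemma mat3_mul_bilin : bilin mat3_mul.
Proof.
apply: bilin_ffun => ij; apply: bilin_sum => l.
by apply: (bilin_arg _ _ (smul_bilin C)); exact: linear_app.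
Qed.

Lemma H3_aux p q : bilin (fun x y : H3_ss => sub_in herm_cap (p (+) q)
    (2^-1 *: (mat3_mul (H3_val x) (H3_val y)
              + sgn (p && q) *: mat3_mul (H3_val y) (H3_val x)))).
Proof.
have b : bilin (fun x y : H3_ss => mat3_mul (H3_val x) (H3_val y)).
  by apply: (bilin_arg _ _ mat3_mul_bilin); exact: sub_val_linear.
apply: bilin_comp; first exact: sub_in_linear.
by apply: bilin_scale; apply: bilin_add => //; apply/bilin_scale/bilin_flip.
Qed.

Lemma H3_bilin : bilin H3_mul.
Proof. by apply: sext2_bilin => p q; apply: H3_aux. Qed.

Lemma H3_part p q x y : x \in part H3_ss p -> y \in part H3_ss q ->
  H3_mul x y \in part H3_ss (p (+) q).
Proof.
by move=> hx hy; rewrite /H3_mul (sext2E H3_aux hx hy); apply: sub_in_part.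
Qed.

Definition H3 : superalgebra k := Superalgebra H3_bilin H3_part.

End H3.

Section Derivations.
Variables (k : fieldType) (H : superalgebra k).

Definition der_part p : {vspace 'End(H)} :=
  vspace_of (fun d : 'End(H) => d \in part (end_ss H) p /\
    forall q r x y, x \in part H q -> y \in part H r ->
      d (smul x y) = smul (d x) y + sgn (p && q) *: smul x (d y)).

Lemma mem_der p (d : 'End(H)) : d \in der_part p <->
  d \in part (end_ss H) p /\
  forall q r x y, x \in part H q -> y \in part H r ->
    d (smul x y) = smul (d x) y + sgn (p && q) *: smul x (d y).
Proof.
have [l m] := smul_bilin H.
apply: mem_vspace_of; split.
  split=> [|q r x y _ _]; first exact: mem0v.
  by rewrite !zero_lfunE (lin0 (l y)) (lin0 (m x)) scaler0 addr0.
move=> a {}d e [pd Hd] [pe He]; split; first by rewrite rpredD ?rpredZ.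
move=> q r x y Sx Sy; rewrite !add_lfunE !scale_lfunE l m.
rewrite (Hd q r) // (He q r) // !scalerDr !scalerA mulrC addrACA.
by [].
Qed.

Lemma der_cap : (der_part false :&: der_part true)%VS = 0%VS.
Proof.
apply: vs_cap0 => d /mem_der[H0 _] /mem_der[H1 _].
exact: (@part_disj k (end_ss H)).
Qed.

Definition der_ss : superspace k := sub_ss der_cap.

Definition der_val (d : der_ss) : 'End(H) := sub_val d.

Definition der_in p (d : 'End(H)) : der_ss := sub_in der_cap p d.

Definition der_br : der_ss -> der_ss -> der_ss :=
  sext2 (fun p q d e => der_in (p (+) q) (scomm (der_val d) (der_val e))).

Lemma der_br_aux p q : bilin (fun d e : der_ss =>
  der_in (p (+) q) (scomm (der_val d) (der_val e))).
Proof.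
apply: bilin_comp; first exact: sub_in_linear.
by apply: (bilin_arg _ _ (@scomm_bilin k H)); exact: sub_val_linear.
Qed.

Lemma der_br_bilin : bilin der_br.
Proof. by apply: sext2_bilin => p q; apply: der_br_aux. Qed.

Lemma der_br_part p q d e : d \in part der_ss p -> e \in part der_ss q ->
  der_br d e \in part der_ss (p (+) q).
Proof.
by move=> hd he; rewrite /der_br (sext2E der_br_aux hd he); apply: sub_in_part.
Qed.

Definition der : superalgebra k := Superalgebra der_br_bilin der_br_part.

(* d_(x,y) = [L_x, L_y], for x and y of parities p and q *)
Definition inner_der p q (x y : H) : der_ss :=
  der_in (p (+) q) (scomm (lmul x) (lmul y)).

Lemma inner_der_bilin p q : bilin (inner_der p q).
Proof.
apply: bilin_comp; first exact: sub_in_linear.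
by apply: (bilin_arg _ _ (@scomm_bilin k H)); exact: lmul_linear.
Qed.

End Derivations.

Section TKK.
Variables (k : fieldType) (H : superalgebra k).

(* Q^0 and its commutator, where Q = Mat_2(k) *)
Definition sl2 : {vspace 'M[k]_2} := vspace_of (fun a : 'M[k]_2 => \tr a = 0).

Lemma mem_sl2 a : a \in sl2 <-> \tr a = 0.
Proof.
apply: mem_vspace_of; split; first by rewrite mxtrace0.
by move=> c x y hx hy; rewrite mxtraceD mxtraceZ hx hy mulr0 addr0.
Qed.

Definition Q0 : vectType k := subvs_of sl2.

Definition Q0_val (a : Q0) : 'M[k]_2 := vsval a.

Definition Q0_br (a b : Q0) : Q0 :=
  vsproj sl2 (Q0_val a *m Q0_val b - Q0_val b *m Q0_val a).

Lemma Q0_brE a b :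
  Q0_val (Q0_br a b) = Q0_val a *m Q0_val b - Q0_val b *m Q0_val a.
Proof.
rewrite /Q0_br /Q0_val vsprojK //; apply/mem_sl2.
by rewrite linearB /= mxtrace_mulC subrr.
Qed.

Lemma Q0_val_linear : linear Q0_val.
Proof. by move=> a x y; exact: linearP. Qed.

Lemma Q0_br_bilin : bilin Q0_br.
Proof.
have b : bilin (fun a b : Q0 => Q0_val a *m Q0_val b).
  apply: (bilin_arg Q0_val_linear Q0_val_linear); exact: mat2_bilin.
apply: bilin_comp; last by apply: bilin_sub => //; apply: bilin_flip.
by move=> a x y; exact: linearP.
Qed.

Local Notation QH := (tens_ss (even_ss Q0) H).

Definition TKK_ss : superspace k := dsum_ss QH (der_ss H).

(* [d, a (x) x] *)
Definition TKK_act (d : der_ss H) (m : tens_vect Q0 H) : QH :=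
  @tens_ext k (even_ss Q0) H QH (fun _ _ a x => tens a (der_val d x)) m.

(* The two components of [a (x) x, b (x) y] *)
Definition TKK_mul (m n : tens_vect Q0 H) : QH :=
  @tens_ext2 k (even_ss Q0) H (even_ss Q0) H QH
    (fun _ _ _ _ a x b y => tens (Q0_br a b) (smul x y)) m n.

Definition TKK_der (m n : tens_vect Q0 H) : der_ss H :=
  @tens_ext2 k (even_ss Q0) H (even_ss Q0) H (der_ss H)
    (fun _ p _ q a x b y =>
       (- 2 * polar_det (Q0_val a) (Q0_val b)) *: inner_der p q x y) m n.

Definition TKK_br (X Y : TKK_ss) : TKK_ss :=
  (TKK_mul X.1 Y.1 + @sskew k TKK_ss QH (fun X Y => TKK_act X.2 Y.1) X Y,
   der_br X.2 Y.2 + TKK_der X.1 Y.1).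

Lemma TKK_act_bilin : bilin TKK_act.
Proof.
have [tl tr] := @tens_bilin k Q0 H.
split=> [m|d]; last exact: (@tens_ext_linear k (even_ss Q0) H QH).
apply: linear_sum_fun => a; apply: linear_sum_fun => b; apply: linear_scale.
apply: linear_sum_fun => p; apply: linear_sum_fun => q.
apply: (linear_comp (tr _)) => c d e.
by rewrite /der_val sub_val_linear add_lfunE scale_lfunE.
Qed.

Lemma TKK_act_part p q d m : d \in part (der_ss H) p -> m \in part QH q ->
  TKK_act d m \in part QH (p (+) q).
Proof.
move=> hd; apply: (@tens_ext_part k (even_ss Q0) H QH p).
  move=> _ _; apply: (bilin_arg _ _ (@tens_bilin k Q0 H)).
    exact: linear_id.
  exact: linearP.
move=> s s' a x ha hx; rewrite addbCA; apply: (@tens_in k (even_ss Q0) H) => //.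
by move/sub_val_in: hd => /mem_der[/mem_end_part + _]; apply.
Qed.

Lemma TKK_skew_bilin : bilin (fun X Y : TKK_ss => TKK_act X.2 Y.1).
Proof.
exact: (bilin_arg (@linear_snd k QH (der_ss H)) (@linear_fst k QH (der_ss H))
  TKK_act_bilin).
Qed.

Lemma TKK_bilin : bilin TKK_br.
Proof.
pose f1 := @linear_fst k QH (der_ss H); pose f2 := @linear_snd k QH (der_ss H).
apply: bilin_pair; apply: bilin_add.
- exact: (bilin_arg f1 f1 (@tens_ext2_bilin k (even_ss Q0) H (even_ss Q0) H QH _)).
- exact/sskew_bilin/TKK_skew_bilin.
- exact: (bilin_arg f2 f2 (der_br_bilin H)).
exact: (bilin_arg f1 f1
  (@tens_ext2_bilin k (even_ss Q0) H (even_ss Q0) H (der_ss H) _)).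
Qed.

Lemma TKK_mul_part p q m n : m \in part QH p -> n \in part QH q ->
  TKK_mul m n \in part QH (p (+) q).
Proof.
have [l r] := smul_bilin H; have [bl br] := Q0_br_bilin.
move=> hm hn; apply: tens_ext2_part hm hn.
  move=> *; split=> z z'.
    exact: (bilin_arg (bl z) (l z') (@tens_bilin k Q0 H)).
  exact: (bilin_arg (br z) (r z') (@tens_bilin k Q0 H)).
move=> s s' t t' a x b y ha hx hb hy; rewrite addbACA.
apply: (@tens_in k (even_ss Q0) H); last exact: smul_part.
move: ha hb => /even_memP[->|->] /even_memP[->|->];
  rewrite ?(lin0 (bl _)) ?(lin0 (br _)) ?mem0v //.
exact: even_mem.
Qed.

Lemma TKK_der_part p q m n : m \in part QH p -> n \in part QH q ->
  TKK_der m n \in part (der_ss H) (p (+) q).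
Proof.
have [bl br] := polar_det_bilin k (erefl 2%N).
move=> hm hn; apply: tens_ext2_part hm hn.
  move=> s s' t t'; have [il ir] := @inner_der_bilin k H s' t'.
  split=> z z'; apply: bilin_flip; apply: bilin_prodZ => //.
    exact: (linear_comp (bl (Q0_val z)) Q0_val_linear).
  exact: (linear_comp (br (Q0_val z)) Q0_val_linear).
move=> s s' t t' a x b y ha hx hb hy; rewrite addbACA.
move: ha hb => /even_memP[->|->] /even_memP[->|->];
  rewrite ?(lin0 Q0_val_linear) ?(lin0 (bl _)) ?(lin0 (br _)) ?mulr0 ?scale0r ?mem0v //.
by rewrite addFb rpredZ // sub_in_part.
Qed.

Lemma TKK_part p q X Y : X \in part TKK_ss p -> Y \in part TKK_ss q ->
  TKK_br X Y \in part TKK_ss (p (+) q).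
Proof.
move=> hX hY; have /mem_dsum_part[X1 X2] := hX; have /mem_dsum_part[Y1 Y2] := hY.
apply/mem_dsum_part; split; apply: rpredD.
- exact: TKK_mul_part.
- apply: sskew_part hX hY; first exact: TKK_skew_bilin.
  move=> r s Z W /mem_dsum_part[Z1 Z2] /mem_dsum_part[W1 W2].
  exact: TKK_act_part.
- exact: der_br_part.
exact: TKK_der_part.
Qed.

(* T(Q, H) with Q = Mat_2(k). *)
Definition TKK : superalgebra k := Superalgebra TKK_bilin TKK_part.

Definition TKK_of_der (d : der H) : TKK := (0, d).
Definition TKK_of_tens (m : QH) : TKK := (m, 0).

Let act0l m : TKK_act 0 m = 0.
Proof. by have [l _] := TKK_act_bilin; exact: lin0 (l m). Qed.
Let act0r d : TKK_act d 0 = 0.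
Proof. by have [_ l] := TKK_act_bilin; exact: lin0 (l d). Qed.
Let mul0l m : TKK_mul 0 m = 0. Proof. exact: tens_ext2_0l. Qed.
Let mul0r m : TKK_mul m 0 = 0. Proof. exact: tens_ext2_0r. Qed.
Let der0l m : TKK_der 0 m = 0. Proof. exact: tens_ext2_0l. Qed.
Let der0r m : TKK_der m 0 = 0. Proof. exact: tens_ext2_0r. Qed.
Let dbr0l (d : der_ss H) : der_br 0 d = 0.
Proof. by have [l _] := der_br_bilin H; exact: lin0 (l d). Qed.
Let dbr0r (d : der_ss H) : der_br d 0 = 0.
Proof. by have [_ l] := der_br_bilin H; exact: lin0 (l d). Qed.
Let t0E := (act0l, act0r, mul0l, mul0r, der0l, der0r, dbr0l, dbr0r, oppr0,
  addr0, add0r, subr0, scaler0).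

Let TKK_brE p q X Y : X \in part TKK_ss p -> Y \in part TKK_ss q ->
  TKK_br X Y = (TKK_mul X.1 Y.1
                  + (TKK_act X.2 Y.1 - sgn (p && q) *: TKK_act Y.2 X.1),
                der_br X.2 Y.2 + TKK_der X.1 Y.1).
Proof. by move=> hX hY; rewrite /TKK_br (sskewE TKK_skew_bilin hX hY). Qed.

Lemma TKK_of_der_part p d : d \in part (der H) p -> TKK_of_der d \in part TKK p.
Proof. by move=> hd; apply/mem_dsum_part; rewrite mem0v. Qed.

Lemma TKK_of_tens_part p m : m \in part QH p -> TKK_of_tens m \in part TKK p.
Proof. by move=> hm; apply/mem_dsum_part; rewrite mem0v. Qed.

Lemma TKK_der_der p q d e : d \in part (der H) p -> e \in part (der H) q ->
  smul (TKK_of_der d) (TKK_of_der e) = TKK_of_der (smul d e).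
Proof.
move=> hd he; rewrite /smul /=.
rewrite (TKK_brE (TKK_of_der_part hd) (TKK_of_der_part he)) /= !t0E.
by [].
Qed.

Let tens_even q (a : Q0) x : x \in part H q -> tens a x \in part QH q.
Proof.
by move=> hx; exact: (@tens_in k (even_ss Q0) H false q a x (even_mem a) hx).
Qed.

Lemma TKK_der_tens p q d a x : d \in part (der H) p -> x \in part H q ->
  smul (TKK_of_der d) (TKK_of_tens (tens a x))
  = TKK_of_tens (tens a (der_val d x)).
Proof.
move=> hd hx; rewrite /smul /=.
rewrite (TKK_brE (TKK_of_der_part hd) (TKK_of_tens_part (tens_even a hx))).
rewrite /= !t0E; congr (_, _).
apply: (@tens_extE k (even_ss Q0) H QH _ false q a x) => //; last exact: even_mem.
move=> _ _; apply: (bilin_arg _ _ (@tens_bilin k Q0 H)).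
  exact: linear_id.
exact: linearP.
Qed.

Lemma TKK_tens_tens p q a x b y : x \in part H p -> y \in part H q ->
  smul (TKK_of_tens (tens a x)) (TKK_of_tens (tens b y))
  = TKK_of_tens (tens (Q0_br a b) (smul x y))
    + TKK_of_der ((- 2 * polar_det (Q0_val a) (Q0_val b)) *: inner_der p q x y).
Proof.
move=> hx hy; rewrite {1}/smul /=.
rewrite (TKK_brE (TKK_of_tens_part (tens_even a hx)) (TKK_of_tens_part (tens_even b hy))).
rewrite /= !t0E; congr (_, _); rewrite ?addr0 ?add0r.
  apply: (@tens_ext2E k (even_ss Q0) H (even_ss Q0) H QH _ false p false q) => //;
    try exact: even_mem.
  have [l r] := smul_bilin H; have [bl br] := Q0_br_bilin.
  move=> *; split=> z z'.
    exact: (bilin_arg (bl z) (l z') (@tens_bilin k Q0 H)).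
  exact: (bilin_arg (br z) (r z') (@tens_bilin k Q0 H)).
apply: (@tens_ext2E k (even_ss Q0) H (even_ss Q0) H (der_ss H) _ false p false q) => //;
  try exact: even_mem.
have [bl br] := polar_det_bilin k (erefl 2%N).
move=> s s' t t'; have [il ir] := @inner_der_bilin k H s' t'.
split=> z z'; apply: bilin_flip; apply: bilin_prodZ => //.
  exact: (linear_comp (bl (Q0_val z)) Q0_val_linear).
exact: (linear_comp (br (Q0_val z)) Q0_val_linear).
Qed.

End TKK.

(* Main.v *)
From HB Require Import structures.
Require Import Defs.
From mathcomp Require Import all_boot all_order all_algebra.
From mathcomp Require Import ring.
Set Implicit Arguments.
Unset Strict Implicit.
Unset Printing Implicit Defensive.
Import GRing.Theory.
Local Open Scope ring_scope.

(** The isomorphism holds for every Hurwitz superalgebra C over a field of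
    characteristic not 2 whose para-Hurwitz superalgebra (C, •) is a symmetric
    composition superalgebra; it matches two decompositions indexed by 0, 1, 2.

    On the Jordan side, H_3(C) has the idempotents E_0, E_1, E_2 and the
    off-diagonal Peirce spaces I_0(C), I_1(C), I_2(C). With a suitable scaling,
    I_i(x) I_(i+1)(y) = I_(i+2)(x • y) and
    I_i(x) I_i(y) = 2 b(x,y) (E_(i+1) + E_(i+2)), so the Peirce multiplication is
    the para-Hurwitz product. A derivation of H_3(C) that kills the idempotents
    acts on the three spaces by a triality triple, and every triality triple t
    yields such a derivation D_t. With D_i(x) = 2 [L_(I_i(x)), L_(E_(i+1))] one
    gets der H_3(C) = D_tri(C) + D_0(C) + D_1(C) + D_2(C) (lemma der_split), hence

      T(Q, H_3(C)) = sum_i Q^0 (x) E_i + D_tri(C)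
                     + sum_i (Q^0 (x) I_i(C) + D_i(C)).

    On the other side, a triality triple of the split quaternions Q has the form
    d_i(x) = a_i x - x a_(i+2) with a_0, a_1, a_2 traceless (lemma tri_Qtriple).
    Thus tri(Q) is a sum of three copies of Q^0, and since Q = Q^0 + k1,

      g(Q, C) = sum_i Q^0 + tri(C) + sum_i (Q^0 (x) C + k1 (x) C).

    The isomorphism (f_fun) identifies the summands in this order, with a factor
    1/2 on Q^0 (x) C. That it preserves brackets is checked on pairs of
    generators (the lemmas mor_XY). This uses the commutators of the derivations
    D_t, D_i(x) and of the multiplications L_(E_i), L_(I_i(x)); the triples
    t_{x,y} appear there because [D_i(x), D_i(y)] is twice the derivation of
    theta^i(t_{x,y}), and for Q they are computed in terms of the a_i.

    Characteristic 3 is what makes the para-Hurwitz superalgebras of B(1,2) and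
    B(4,2) symmetric compositions (lemmas B12_symmetric and B42_symmetric). *)

(** * Equations between linear combinations *)

Section ModuleTactic.
Variables (k : fieldType) (V : lmodType k).

Inductive mexpr := MVar of nat | MZero | MAdd of mexpr & mexpr
  | MOpp of mexpr | MScale of k & mexpr.

Fixpoint meval (env : seq V) e : V :=
  match e with
  | MVar n => env`_n
  | MZero => 0
  | MAdd a b => meval env a + meval env b
  | MOpp a => - meval env a
  | MScale c a => c *: meval env a
  end.

(** Variables are compared by eqn, which reduces on numerals, so that the
    coefficients of a concrete expression compute to field expressions. *)
Fixpoint mcoef e (i : nat) : k :=
  match e with
  | MVar n => if eqn i n then 1 else 0
  | MZero => 0
  | MAdd a b => mcoef a i + mcoef b i
  | MOpp a => - mcoef a i
  | MScale c a => c * mcoef a i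
  end.

Lemma meval_coef env e :
  meval env e = \sum_(i < size env) mcoef e i *: env`_i.
Proof.
elim: e => [n||a Ha b Hb|a Ha|c a Ha] /=; rewrite ?Ha ?Hb.
- have [lt|le] := ltnP n (size env); last first.
    rewrite nth_default // big1 // => i _.
    by rewrite -[eqn i n]/(i == n :> nat) (ltn_eqF (leq_trans (ltn_ord i) le)) scale0r.
  rewrite (bigD1 (Ordinal lt)) //= eqnE eqxx scale1r big1 ?addr0 // => i ni.
  by move: ni; rewrite -val_eqE /= => ni; rewrite (negPf ni) scale0r.
- by rewrite big1 // => i _; rewrite scale0r.
- by rewrite -big_split; apply: eq_bigr => i _; rewrite scalerDl.
- by rewrite -sumrN; apply: eq_bigr => i _; rewrite scaleNr.
by rewrite scaler_sumr; apply: eq_bigr => i _; rewrite scalerA.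
Qed.

Fixpoint mcoef_eq e1 e2 (n : nat) : Prop :=
  if n is m.+1 then mcoef e1 m = mcoef e2 m /\ mcoef_eq e1 e2 m else True.

(** Nothing is claimed about linear independence of the environment: agreement
    of the coefficients is sufficient, and it is decided by ring or field. *)
Lemma meval_eq env e1 e2 :
  mcoef_eq e1 e2 (size env) -> meval env e1 = meval env e2.
Proof.
rewrite !meval_coef => H; apply: eq_bigr => i _; congr (_ *: _).
elim: (size env) i H => [[//]|n IH] [i /=]; rewrite ltnS => le [e H].
by move: le; rewrite leq_eqVlt => /predU1P[-> //|lt]; apply: (IH (Ordinal lt)).
Qed.

End ModuleTactic.

(** Two terms denote the same vector if they agree up to the path by which the
   algebraic structures in them are inferred; structures are the only subterms
   that are compared up to conversion. *)
Ltac mod_same e y :=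
  first
    [ constr_eq_strict e y
    | lazymatch type of e with
      | nzSemiRingType => unify e y
      | nzRingType => unify e y
      | semiVectType _ => unify e y
      | vectType _ => unify e y
      | baseAddMagmaType => unify e y
      | baseAddUMagmaType => unify e y
      | Algebra.BaseZmodule.type => unify e y
      | pzSemiRingType => unify e y
      | lSemiModType _ => unify e y
      | _ => lazymatch e with
             | ?f ?a => lazymatch y with ?g ?b => mod_same f g; mod_same a b end
             end
      end ].

(** In this tactic and the next one, the inner match only tests for success of
    mod_same, whose failure makes the outer match go on to its second branch. *)
Ltac mod_atoms env e :=
  lazymatch e with
  | @GRing.add _ ?a ?b => let env := mod_atoms env a in mod_atoms env b
  | @GRing.opp _ ?a => mod_atoms env a
  | @GRing.scale _ _ _ ?a => mod_atoms env a
  | @GRing.zero _ => env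
  | _ =>
    let rec mem l := lazymatch l with
      | nil => constr:(e :: env)
      | ?y :: ?l' => match constr:(Set) with
          | _ => let _ := match constr:(Set) with _ => mod_same e y end in env
          | _ => mem l' end
      end in mem env
  end.

Ltac mod_index e env :=
  lazymatch env with
  | ?y :: ?l => match constr:(Set) with
      | _ => let _ := match constr:(Set) with _ => mod_same e y end in constr:(0%N)
      | _ => let n := mod_index e l in constr:(S n) end
  end.

Ltac mod_reify k env e :=
  lazymatch e with
  | @GRing.add _ ?a ?b =>
    let a := mod_reify k env a in let b := mod_reify k env b in
    constr:(@MAdd k a b)
  | @GRing.opp _ ?a => let a := mod_reify k env a in constr:(@MOpp k a)
  | @GRing.scale _ _ ?c ?a =>
    let a := mod_reify k env a in constr:(@MScale k c a)
  | @GRing.zero _ => constr:(@MZero k)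
  | _ => let n := mod_index e env in constr:(@MVar k n)
  end.

(** An equation between linear combinations over k is reduced to the equations
   between the coefficients of each vector that occurs in it. *)
Ltac module_eq k V :=
  lazymatch goal with
  | |- ?a = ?b =>
    let env := mod_atoms (@nil V) a in
    let env := mod_atoms env b in
    let ea := mod_reify k env a in let eb := mod_reify k env b in
    refine (@meval_eq k V env ea eb _); rewrite /=; repeat split
  end.

(** * Symmetric composition superalgebras *)

Arguments smul : simpl never.
Section LfunLinearity.
Variables (k : fieldType) (U V : vectType k) (f : 'Hom(U, V)).
Lemma lfD u v : f (u + v) = f u + f v. Proof. exact: linearD. Qed.
Lemma lfZ a u : f (a *: u) = a *: f u. Proof. exact: linearZ. Qed.
Lemma lfN u : f (- u) = - f u. Proof. exact: linearN. Qed.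
Lemma lfB u v : f (u - v) = f u - f v. Proof. exact: linearB. Qed.
Lemma lf0 : f 0 = 0. Proof. exact: linear0. Qed.
End LfunLinearity.

Lemma sgn_sq (k : fieldType) p : sgn p * sgn p = 1 :> k.
Proof. by case: p; rewrite /sgn /= ?expr1 ?mulrNN ?expr0 mulr1. Qed.

(** The identities (x • y) • x = q(x) y = x • (y • x) enter through their
    linearizations in x; reversing x, y, z costs the sign (-1)^(xy+xz+yz). *)
Record symmetric_composition (k : fieldType) (S : normed_superalgebra k) : Prop :=
  SymmetricComposition {
  sc_assoc : forall x y z : S, bform (smul x y) z = bform x (smul y z);
  sc_left : forall p q r (x y z : S),
    x \in part S p -> y \in part S q -> z \in part S r ->
    smul (smul x y) z
      + sgn ((p && q) (+) (p && r) (+) (q && r)) *: smul (smul z y) x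
    = (sgn (q && r) * bform x z) *: y;
  sc_right : forall p q r (x y z : S),
    x \in part S p -> y \in part S q -> z \in part S r ->
    smul x (smul y z)
      + sgn ((p && q) (+) (p && r) (+) (q && r)) *: smul z (smul y x)
    = (sgn (p && q) * bform x z) *: y;
  sc_nondeg : forall x : S, (forall y, bform x y = 0) -> x = 0 }.

Section Bform.
Variables (k : fieldType) (S : normed_superalgebra k).

Lemma bformC p q (x y : S) : x \in part S p -> y \in part S q ->
  bform x y = sgn (p && q) * bform y x.
Proof. exact: sf_sym. Qed.

Lemma bform_neq p q (x y : S) : p != q -> x \in part S p -> y \in part S q ->
  bform x y = 0.
Proof. exact: sf_even. Qed.

Lemma bformDl (x y z : S) : bform (x + y) z = bform x z + bform y z.
Proof. by have [l _] := sf_bilin (ns_form S); exact: (linD _ _ (l z)). Qed.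
Lemma bformDr (x y z : S) : bform z (x + y) = bform z x + bform z y.
Proof. by have [_ l] := sf_bilin (ns_form S); exact: (linD _ _ (l z)). Qed.
Lemma bformZl a (x z : S) : bform (a *: x) z = a * bform x z.
Proof. by have [l _] := sf_bilin (ns_form S); exact: (linZ _ _ (l z)). Qed.
Lemma bformZr a (x z : S) : bform z (a *: x) = a * bform z x.
Proof. by have [_ l] := sf_bilin (ns_form S); exact: (linZ _ _ (l z)). Qed.
Lemma bform0l (z : S) : bform 0 z = 0.
Proof. by have [l _] := sf_bilin (ns_form S); exact: (lin0 (l z)). Qed.
Lemma bformNl (x z : S) : bform (- x) z = - bform x z.
Proof. by rewrite -scaleN1r bformZl mulN1r. Qed.
Lemma bformNr (x z : S) : bform z (- x) = - bform z x.
Proof. by rewrite -scaleN1r bformZr mulN1r. Qed.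
End Bform.

Section Smul.
Variables (k : fieldType) (A : superalgebra k).
Implicit Types x y z : A.
Lemma smulDl x y z : smul (x + y) z = smul x z + smul y z.
Proof. by have [l _] := smul_bilin A; exact: (linD _ _ (l z)). Qed.
Lemma smulDr x y z : smul z (x + y) = smul z x + smul z y.
Proof. by have [_ l] := smul_bilin A; exact: (linD _ _ (l z)). Qed.
Lemma smulZl a x z : smul (a *: x) z = a *: smul x z.
Proof. by have [l _] := smul_bilin A; exact: (linZ _ _ (l z)). Qed.
Lemma smulZr a x z : smul z (a *: x) = a *: smul z x.
Proof. by have [_ l] := smul_bilin A; exact: (linZ _ _ (l z)). Qed.
Lemma smul0l z : smul 0 z = 0.
Proof. by have [l _] := smul_bilin A; exact: (lin0 (l z)). Qed.
Lemma smul0r z : smul z 0 = 0.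
Proof. by have [_ l] := smul_bilin A; exact: (lin0 (l z)). Qed.
Lemma smulNl x z : smul (- x) z = - smul x z.
Proof. by rewrite -scaleN1r smulZl scaleN1r. Qed.
Lemma smulNr x z : smul z (- x) = - smul z x.
Proof. by rewrite -scaleN1r smulZr scaleN1r. Qed.
Lemma smul_sumr z I (r : seq I) (P : pred I) F :
  smul z (\sum_(i <- r | P i) F i) = \sum_(i <- r | P i) smul z (F i).
Proof. by have [_ l] := smul_bilin A; exact: (lin_sum _ _ _ (l z)). Qed.
End Smul.

Section Unital.
Variables (k : fieldType) (C : unital_normed_superalgebra k).
Hypothesis scC : symmetric_composition (para C).
Hypothesis b11 : bform (un_one C) (un_one C) = 2.

Local Notation "x ** y" := (@para_mul k C x y) (at level 40).
Local Notation "1c" := (un_one C).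
Implicit Types x y z : C.

Lemma pm_assoc x y z : bform (x ** y) z = bform x (y ** z).
Proof. exact: (sc_assoc scC). Qed.

Lemma pm_left p q r x y z :
  x \in part C p -> y \in part C q -> z \in part C r ->
  (x ** y) ** z + sgn ((p && q) (+) (p && r) (+) (q && r)) *: ((z ** y) ** x)
  = (sgn (q && r) * bform x z) *: y.
Proof. exact: (sc_left scC). Qed.

Lemma pm_right p q r x y z :
  x \in part C p -> y \in part C q -> z \in part C r ->
  x ** (y ** z) + sgn ((p && q) (+) (p && r) (+) (q && r)) *: (z ** (y ** x))
  = (sgn (p && q) * bform x z) *: y.
Proof. exact: (sc_right scC). Qed.

Lemma pm_part p q x y : x \in part C p -> y \in part C q ->
  x ** y \in part C (p (+) q).
Proof. exact: para_part. Qed.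

Lemma sbarD x y : sbar (x + y) = sbar x + sbar y.
Proof. exact: (linD _ _ (@sbar_linear k C)). Qed.
Lemma sbarZ a x : sbar (a *: x) = a *: sbar x.
Proof. exact: (linZ _ _ (@sbar_linear k C)). Qed.
Lemma sbar0 : sbar (0 : C) = 0.
Proof. exact: (lin0 (@sbar_linear k C)). Qed.

Lemma sbar1 : sbar 1c = 1c.
Proof. by rewrite /sbar b11 mulr2n scalerDl scale1r addrK. Qed.

Lemma sbarK x : sbar (sbar x) = x.
Proof.
rewrite {2}/sbar sbarD sbarZ sbar1 -scaleN1r sbarZ scaleN1r {1}/sbar.
by rewrite opprB addrC subrK.
Qed.

Lemma bform_sbar1 x : bform (sbar x) 1c = bform x 1c.
Proof. by rewrite /sbar bformDl bformZl bformNl b11; ring. Qed.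

Lemma sbar_odd x : x \in part C true -> sbar x = - x.
Proof.
move=> hx; rewrite /sbar (bform_neq (p := true) (q := false)) ?un_one_even //.
by rewrite scale0r add0r.
Qed.

Lemma pm1x x : 1c ** x = sbar x.
Proof. by rewrite /para_mul sbar1 un_mul1x. Qed.

Lemma pmx1 x : x ** 1c = sbar x.
Proof. by rewrite /para_mul sbar1 un_mulx1. Qed.

(** This is the left composition identity at x, 1, z, because x • 1 is the
    conjugate of x. *)
Lemma smul_bar_polar p r x z : x \in part C p -> z \in part C r ->
  smul x (sbar z) + sgn (p && r) *: smul z (sbar x) = bform x z *: 1c.
Proof.
move=> hx hz; have := pm_left hx (un_one_even C) hz.
rewrite !pmx1 /para_mul !sbarK /= mul1r andbF /= addbF.
by [].
Qed.

(** The left composition identity for the conjugates of x and y and for 1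
    expresses the conjugate of x y by b(x,1) y' and y' x, where y' is the
    conjugate of y; these add up to y' times the conjugate of x. *)
Lemma sbarM p q x y : x \in part C p -> y \in part C q ->
  sbar (smul x y) = sgn (p && q) *: smul (sbar y) (sbar x).
Proof.
move=> hx hy.
have := pm_left (sbar_part hx) (sbar_part hy) (un_one_even C).
rewrite pmx1 pm1x sbarK /para_mul !sbarK bform_sbar1 !andbF !addbF mul1r.
move=> E; apply/eqP; rewrite -(inj_eq (addIr (sgn (p && q) *: smul (sbar y) x))).
rewrite {}E -scalerDr -smulDr; apply/eqP.
case: p hx => hx /=; last first.
  by rewrite scale1r /sbar subrK smulZr un_mulx1.
rewrite (sbar_odd hx) addNr smul0r scaler0.
by rewrite (bform_neq (p := true) (q := false)) ?un_one_even // scale0r.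
Qed.

Lemma sbar_para p q x y : x \in part C p -> y \in part C q ->
  sbar (x ** y) = sgn (p && q) *: smul y x.
Proof.
by move=> hx hy; rewrite /para_mul (sbarM (sbar_part hx) (sbar_part hy)) !sbarK.
Qed.

End Unital.

(** * Peirce coordinates of H_3(C) *)

(** Indices modulo 3 are always written relative to a base point i, as i, i + 1
    or i + 2, so that one computation covers the three cyclic positions. *)
Lemma ord3D (i : 'I_3) :
  (i + 1 + 1 = i + 2) * (i + 1 + 2 = i) * (i + 2 + 1 = i) * (i + 2 + 2 = i + 1).
Proof. by case: i => [[|[|[|i]]] hi] //; do !split; apply/val_inj. Qed.

Lemma ord3_neq (i : 'I_3) :
  ((i == i + 1) = false) * ((i == i + 2) = false) * ((i + 1 == i) = false)
  * ((i + 2 == i) = false) * ((i + 1 == i + 2) = false)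
  * ((i + 2 == i + 1) = false).
Proof. by case: i => [[|[|[|i]]] hi]. Qed.

Definition ord3E := (ord3D, ord3_neq, eqxx).

Lemma ord3P (i j : 'I_3) : [\/ j = i, j = i + 1 | j = i + 2].
Proof.
case: (eqVneq j i) => [->|n0]; first exact: Or31.
case: (eqVneq j (i + 1)) => [->|n1]; first exact: Or32.
apply: Or33; apply/eqP; move: n0 n1.
by case: i => [[|[|[|i]]] hi] //; case: j => [[|[|[|j]]] hj].
Qed.

Lemma sum_ord3 (V : nmodType) (i : 'I_3) (F : 'I_3 -> V) :
  \sum_j F j = F i + F (i + 1) + F (i + 2).
Proof.
rewrite (bigD1 i) //= (bigD1 (i + 1)) ?ord3E //= (bigD1 (i + 2)) ?ord3E //=.
rewrite big1 ?addr0 => [|j]; first exact: addrA.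
move=> /andP[/andP[n0 n1] n2].
by case: (ord3P i j) n0 n1 n2 => ->; rewrite ?eqxx.
Qed.

Section H3Matrices.
Variables (k : fieldType) (C : unital_normed_superalgebra k).
Local Notation "1c" := (un_one C).
Local Notation mat3 := {ffun 'I_3 * 'I_3 -> C}.

Definition diag_mx3 (i : 'I_3) : mat3 :=
  [ffun jl => if (jl.1 == i) && (jl.2 == i) then 1c else 0].

(** The factor 2 cancels the halves of the Jordan product: with it
    I_i(x) I_(i+1)(y) = I_(i+2)(x • y), without any scalar. *)
Definition off_mx3 (i : 'I_3) (x : C) : mat3 :=
  [ffun jl => if (jl.1 == i + 1) && (jl.2 == i + 2) then 2 *: sbar x
              else if (jl.1 == i + 2) && (jl.2 == i + 1) then 2 *: x else 0].

(** The space that carries H_3(C); projecting onto it makes I_i(x) linear in x,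
    for x of mixed parity too. *)
Definition Hsum := (herm_part C false + herm_part C true)%VS.

End H3Matrices.

(** The frame E_j, I_j(x) and its coordinates are locked, so that computations
    with them go through the multiplication table established below and do not
    unfold to matrices. *)
HB.lock Definition Ediag (k : fieldType) (C : unital_normed_superalgebra k)
  (i : 'I_3) : H3 C := sub_in (@herm_cap k C) false (diag_mx3 C i).

HB.lock Definition Ioff (k : fieldType) (C : unital_normed_superalgebra k)
  (i : 'I_3) (x : C) : H3 C := vsproj (Hsum C) (off_mx3 i x).

HB.lock Definition Ecoef (k : fieldType) (C : unital_normed_superalgebra k)
  (j : 'I_3) (h : H3 C) : k := 2^-1 * bform (H3_val h (j, j)) (un_one C).

HB.lock Definition Icoef (k : fieldType) (C : unital_normed_superalgebra k)
  (j : 'I_3) (h : H3 C) : C := 2^-1 *: H3_val h (j + 2, j + 1).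

Section H3coord.
Variables (k : fieldType) (C : unital_normed_superalgebra k).
Local Notation "1c" := (un_one C).
Local Notation mat3 := {ffun 'I_3 * 'I_3 -> C}.
Local Notation H := (H3 C).
Local Notation Ediag := (Ediag C).
Local Notation diag_mx3 := (diag_mx3 C).
Local Notation off_mx3 := (@off_mx3 k C).
Local Notation Ioff := (@Ioff k C).
Local Notation Ecoef := (@Ecoef k C).
Local Notation Icoef := (@Icoef k C).

Lemma off_mx3_linear i : linear (off_mx3 i).
Proof.
move=> a x y; apply/ffunP => jl; rewrite !ffunE.
case: ifP => _; first by rewrite sbar_linear scalerDr !scalerA mulrC.
case: ifP => _; first by rewrite scalerDr !scalerA mulrC.
by rewrite scaler0 addr0.
Qed.

Lemma Ioff_linear i : linear (Ioff i).
Proof. by move=> a x y; rewrite Ioff.unlock off_mx3_linear linearP. Qed.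

Lemma IoffD i x y : Ioff i (x + y) = Ioff i x + Ioff i y.
Proof. exact: (linD _ _ (@Ioff_linear i)). Qed.
Lemma IoffZ i a x : Ioff i (a *: x) = a *: Ioff i x.
Proof. exact: (linZ _ _ (@Ioff_linear i)). Qed.
Lemma Ioff0 i : Ioff i 0 = 0.
Proof. exact: (lin0 (@Ioff_linear i)). Qed.
Lemma IoffN i x : Ioff i (- x) = - Ioff i x.
Proof. by rewrite -scaleN1r IoffZ scaleN1r. Qed.

Lemma H3_val_linear : linear (@H3_val k C).
Proof. exact: sub_val_linear. Qed.

Lemma H3_val_inj (x y : H) : H3_val x = H3_val y -> x = y.
Proof. exact: subvs_inj. Qed.

Lemma H3_val_in p (x : H) : x \in part H p -> H3_val x \in herm_part C p.
Proof. exact: sub_val_in. Qed.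

Lemma Ecoef_linear j : linear (Ecoef j : H -> k^o).
Proof.
by move=> a x y; rewrite ?Ecoef.unlock H3_val_linear !ffunE bformDl bformZl
  /GRing.scale /=; ring.
Qed.

Lemma Icoef_linear j : linear (Icoef j).
Proof.
by move=> a x y; rewrite ?Icoef.unlock H3_val_linear !ffunE scalerDr !scalerA mulrC.
Qed.

Lemma IcoefD j x y : Icoef j (x + y) = Icoef j x + Icoef j y.
Proof. exact: (linD _ _ (@Icoef_linear j)). Qed.
Lemma IcoefZ j a x : Icoef j (a *: x) = a *: Icoef j x.
Proof. exact: (linZ _ _ (@Icoef_linear j)). Qed.
Lemma Icoef0 j : Icoef j 0 = 0.
Proof. exact: (lin0 (@Icoef_linear j)). Qed.
Lemma IcoefN j x : Icoef j (- x) = - Icoef j x.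
Proof. by rewrite -scaleN1r IcoefZ scaleN1r. Qed.
Lemma Icoef_sum j J (r : seq J) (P : pred J) F :
  Icoef j (\sum_(i <- r | P i) F i) = \sum_(i <- r | P i) Icoef j (F i).
Proof. exact: (lin_sum _ _ _ (@Icoef_linear j)). Qed.

Lemma EcoefD j x y : Ecoef j (x + y) = Ecoef j x + Ecoef j y.
Proof. exact: (linD _ _ (@Ecoef_linear j)). Qed.
Lemma EcoefZ j a x : Ecoef j (a *: x) = a * Ecoef j x.
Proof. exact: (linZ _ _ (@Ecoef_linear j)). Qed.
Lemma Ecoef0 j : Ecoef j 0 = 0.
Proof. exact: (lin0 (@Ecoef_linear j)). Qed.
Lemma EcoefN j x : Ecoef j (- x) = - Ecoef j x.
Proof. by rewrite -scaleN1r EcoefZ mulN1r. Qed.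
Lemma Ecoef_sum j J (r : seq J) (P : pred J) F :
  Ecoef j (\sum_(i <- r | P i) F i) = \sum_(i <- r | P i) Ecoef j (F i).
Proof. exact: (lin_sum _ _ _ (@Ecoef_linear j)). Qed.

Hypothesis two0 : (2 : k) != 0.
Hypothesis scC : symmetric_composition (para C).
Hypothesis b11 : bform 1c 1c = 2.

Lemma mulV2 : 2^-1 * 2 = 1 :> k. Proof. by rewrite mulVf. Qed.
Lemma mul2V : 2 * 2^-1 = 1 :> k. Proof. by rewrite divff. Qed.

Lemma diag_mx3_herm i : diag_mx3 i \in herm_part C false.
Proof.
apply/mem_herm; split.
  by apply/mem_ffun_part => jl; rewrite ffunE; case: ifP; rewrite ?mem0v ?un_one_even.
move=> j l; rewrite !ffunE /= andbC.
by case: ifP; rewrite ?(sbar1 b11) ?sbar0.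
Qed.

Lemma off_mx3_herm i p x : x \in part C p -> off_mx3 i x \in herm_part C p.
Proof.
move=> hx; apply/mem_herm; split.
  apply/mem_ffun_part => jl; rewrite ffunE.
  by do 2?[case: ifP => _]; rewrite ?mem0v ?rpredZ ?sbar_part.
move=> j l; rewrite !ffunE /=.
case: (ord3P i j) => ->; case: (ord3P i l) => ->;
  by rewrite !ord3E /= ?sbarZ ?(sbarK b11) ?sbar0.
Qed.

Lemma H3_val_diag i : H3_val (Ediag i) = diag_mx3 i.
Proof. by rewrite Ediag.unlock; exact: (sub_valE _ (diag_mx3_herm i)). Qed.

Lemma H3_val_off i x : H3_val (Ioff i x) = off_mx3 i x.
Proof.
rewrite Ioff.unlock; apply: vsprojK; rewrite -[x]hcomp_sum (linD _ _ (@off_mx3_linear i)).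
by apply: memv_add; apply/off_mx3_herm/hcomp_in.
Qed.

Lemma Ediag_part i : Ediag i \in part H false.
Proof. by rewrite Ediag.unlock; exact: sub_in_part. Qed.

Lemma Ioff_part i p x : x \in part C p -> Ioff i x \in part H p.
Proof. by move=> hx; apply/mem_sub_part; rewrite [vsval _]H3_val_off off_mx3_herm. Qed.

Lemma H3_bar (h : H) j l : H3_val h (j, l) = sbar (H3_val h (l, j)).
Proof.
have part_bar p (u : H) : u \in part H p ->
    H3_val u (j, l) = sbar (H3_val u (l, j)).
  by move=> hu; have /mem_herm[_ ->] := H3_val_in hu.
rewrite -[h]hcomp_sum (linD _ _ H3_val_linear) !ffunE sbarD.
by congr (_ + _); [exact: part_bar (hcomp_in false h) | exact: part_bar (hcomp_in true h)].
Qed.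

(** Applied to the diagonal entries of hermitian matrices, which are therefore
    scalars. *)
Lemma self_bar (x : C) : x = sbar x -> x = (2^-1 * bform x 1c) *: 1c.
Proof.
rewrite /sbar => /eqP; rewrite -subr_eq0 opprB addrA -mulr2n subr_eq0 => /eqP E.
by rewrite -scalerA -E -scaler_nat scalerA mulV2 scale1r.
Qed.

Lemma H3_decomp (h : H) :
  h = \sum_j (Ecoef j h *: Ediag j + Ioff j (Icoef j h)).
Proof.
apply: H3_val_inj; rewrite (lin_sum _ _ _ H3_val_linear).
apply/ffunP => -[j l]; rewrite sum_ffunE (sum_ord3 j).
rewrite !(linD _ _ H3_val_linear) !(linZ _ _ H3_val_linear) !H3_val_off !H3_val_diag.
rewrite !ffunE /=; case: (ord3P j l) => ->; rewrite !ord3E /= ?ord3E /=.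
- rewrite !scaler0 !addr0 Ecoef.unlock; exact/self_bar/H3_bar.
- rewrite !scaler0 !addr0 !add0r ?Icoef.unlock !ord3E sbarZ scalerA mul2V scale1r.
  exact: H3_bar.
by rewrite !scaler0 !addr0 !add0r ?Icoef.unlock !ord3E scalerA mul2V scale1r.
Qed.

Lemma Ecoef_diag j l : Ecoef j (Ediag l) = (j == l)%:R.
Proof.
rewrite ?Ecoef.unlock H3_val_diag ffunE /= andbb; case: eqP => _.
  by rewrite b11 mulV2.
by rewrite bform0l mulr0.
Qed.

Lemma Ecoef_off j l x : Ecoef j (Ioff l x) = 0.
Proof.
rewrite ?Ecoef.unlock H3_val_off ffunE /=.
by case: (ord3P l j) => ->; rewrite !ord3E /= bform0l mulr0.
Qed.

Lemma Icoef_diag j l : Icoef j (Ediag l) = 0.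
Proof.
rewrite ?Icoef.unlock H3_val_diag ffunE /=.
by case: (ord3P l j) => ->; rewrite !ord3E /= scaler0.
Qed.

Lemma Icoef_off j l x : Icoef j (Ioff l x) = if j == l then x else 0.
Proof.
rewrite ?Icoef.unlock H3_val_off ffunE /=.
by case: (ord3P l j) => ->; rewrite !ord3E /= ?ord3E /= ?scaler0 ?scalerA ?mulV2 ?scale1r.
Qed.

(** The product of H_3(C) is extended bilinearly from homogeneous elements; on
    these, clearing the factor 1/2 leaves an identity between matrices over C. *)
Lemma H3_smulE p q (x y z : H) :
    x \in part H p -> y \in part H q -> z \in part H (p (+) q) ->
    2 *: H3_val z = mat3_mul (H3_val x) (H3_val y)
                  + sgn (p && q) *: mat3_mul (H3_val y) (H3_val x) ->
  smul x y = z.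
Proof.
move=> hx hy hz E; rewrite /smul /= /H3_mul (sext2E (@H3_aux k C) hx hy) -E.
rewrite scalerA mulV2 scale1r; apply: H3_val_inj.
exact: (sub_valE _ (H3_val_in hz)).
Qed.

Lemma H3_smulC p q (x y : H) : x \in part H p -> y \in part H q ->
  smul x y = sgn (p && q) *: smul y x.
Proof.
move=> hx hy; rewrite /smul /= /H3_mul.
rewrite (sext2E (@H3_aux k C) hx hy) (sext2E (@H3_aux k C) hy hx).
rewrite addbC -(linZ _ _ (@sub_in_linear _ _ _ _ _)); congr (sub_in _ _ _).
rewrite !scalerDr !scalerA [q && p]andbC addrC; congr (_ + _).
  by rewrite mulrC.
by rewrite mulrAC sgn_sq mul1r.
Qed.

Lemma mul_diag_l i (a : mat3) :
  mat3_mul (diag_mx3 i) a = [ffun jl => if jl.1 == i then a jl else 0].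
Proof.
apply/ffunP => -[j l]; rewrite !ffunE /= (sum_ord3 i) !ffunE /= !ord3E !andbF andbT.
by rewrite !smul0l !addr0; case: eqP => [->|]; rewrite ?un_mul1x ?smul0l.
Qed.

Lemma mul_diag_r i (a : mat3) :
  mat3_mul a (diag_mx3 i) = [ffun jl => if jl.2 == i then a jl else 0].
Proof.
apply/ffunP => -[j l]; rewrite !ffunE /= (sum_ord3 i) !ffunE /= !ord3E.
by rewrite !smul0r !addr0; case: eqP => [->|]; rewrite ?un_mulx1 ?smul0r.
Qed.

Lemma mul_off_l i x (a : mat3) :
  mat3_mul (off_mx3 i x) a =
  [ffun jl => if jl.1 == i + 1 then 2 *: smul (sbar x) (a (i + 2, jl.2))
              else if jl.1 == i + 2 then 2 *: smul x (a (i + 1, jl.2)) else 0].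
Proof.
apply/ffunP => -[j l]; rewrite !ffunE /= (sum_ord3 i) !ffunE /= !ord3E !andbF !andbT.
by case: (ord3P i j) => ->; rewrite !ord3E /= ?smul0l ?smulZl ?addr0 ?add0r.
Qed.

Lemma Ediag_Ediag i j : smul (Ediag i) (Ediag j) = if i == j then Ediag i else 0.
Proof.
apply: (H3_smulE (Ediag_part i) (Ediag_part j)).
  by case: ifP; rewrite ?mem0v ?Ediag_part.
rewrite !H3_val_diag scale1r mul_diag_l mul_diag_r.
case: eqP => [<-|ne]; rewrite ?(lin0 H3_val_linear) ?scaler0 ?H3_val_diag;
  apply/ffunP => -[m l]; rewrite !ffunE /=.
  rewrite scaler_nat mulr2n.
  by case: (m == i); case: (l == i); rewrite //= ?addr0.
move/eqP/negPf: ne => ne.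
case: (m =P i) => [->|_]; case: (l =P i) => [->|_];
  by rewrite /= ?ne ?andbF ?if_same ?addr0.
Qed.

(** The eigenvalue of an idempotent of the frame on an off-diagonal Peirce space,
    as a function of whether the two indices agree. *)
Definition half_if (b : bool) : k := if b then 0 else 2^-1.

Lemma Ediag_Ioff i j x :
  smul (Ediag i) (Ioff j x) = half_if (i == j) *: Ioff j x.
Proof.
rewrite -[x]hcomp_sum IoffD smulDr scalerDr.
have hom p y : y \in part C p ->
  smul (Ediag i) (Ioff j y) = half_if (i == j) *: Ioff j y.
  move=> hx; apply: (H3_smulE (Ediag_part i) (Ioff_part j hx)).
    by rewrite rpredZ ?Ioff_part.
  rewrite (linZ _ _ H3_val_linear) H3_val_diag H3_val_off scale1r mul_diag_l mul_diag_r.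
  rewrite scalerA; apply/ffunP => -[m l]; rewrite !ffunE /= /half_if.
  case: (ord3P j i) => ->; case: (ord3P j m) => ->; case: (ord3P j l) => ->;
    rewrite !ord3E /= ?mul2V ?mulr0 ?scale1r ?scale0r ?scaler0 ?addr0 ?add0r //.
by congr (_ + _); apply/hom/hcomp_in.
Qed.

Lemma Ioff_Ediag i j x :
  smul (Ioff j x) (Ediag i) = half_if (i == j) *: Ioff j x.
Proof.
rewrite -[x]hcomp_sum IoffD smulDl scalerDr.
congr (_ + _);
  by rewrite (H3_smulC (Ioff_part j (hcomp_in _ x)) (Ediag_part i)) andbF scale1r
    Ediag_Ioff.
Qed.

Local Notation "x ** y" := (@para_mul k C x y) (at level 40).

(** The matrix product in one order has the single entry 4 (x • y), the product
    in the other order the single entry 4 y x in the transposed position, and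
    these are conjugate up to the sign of exchanging x and y. *)
Lemma Ioff_succ_hom i p q x y : x \in part C p -> y \in part C q ->
  smul (Ioff i x) (Ioff (i + 1) y) = Ioff (i + 2) (x ** y).
Proof.
move=> hx hy; apply: (H3_smulE (Ioff_part i hx) (Ioff_part _ hy)).
  exact/Ioff_part/pm_part.
rewrite !H3_val_off !mul_off_l; apply/ffunP => -[m l]; rewrite !ffunE /=.
case: (ord3P i m) => ->; case: (ord3P i l) => ->; rewrite !ord3E /= ?ord3E /=;
  rewrite ?smul0r ?scaler0 ?addr0 ?add0r // smulZr.
  rewrite (sbar_para scC b11 hx hy) !scalerA; congr (_ *: _); ring.
by [].
Qed.

Lemma Ioff_succ i x y :
  smul (Ioff i x) (Ioff (i + 1) y) = Ioff (i + 2) (x ** y).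
Proof.
rewrite -[x]hcomp_sum -[y]hcomp_sum !IoffD !(smulDl, smulDr).
rewrite !(Ioff_succ_hom i (hcomp_in _ _) (hcomp_in _ _)).
have [l r] := @para_bilin k C.
by rewrite -!IoffD !(linD _ _ (l _)) !(linD _ _ (r _)).
Qed.

Lemma Ioff_pred i p q x y : x \in part C p -> y \in part C q ->
  smul (Ioff (i + 1) x) (Ioff i y) = sgn (p && q) *: Ioff (i + 2) (y ** x).
Proof.
move=> hx hy.
by rewrite (H3_smulC (Ioff_part _ hx) (Ioff_part _ hy)) Ioff_succ.
Qed.

(** The right composition identity at x, 1, z. *)
Lemma bar_mul_polar p r x z : x \in part C p -> z \in part C r ->
  smul (sbar x) z + sgn (p && r) *: smul (sbar z) x = bform x z *: 1c.
Proof.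
move=> hx hz; have := pm_right scC hx (un_one_even C) hz.
rewrite !(pm1x b11) /para_mul !(sbarK b11) /= andbF mul1r /= addbF.
by [].
Qed.

Lemma Ioff_Ioff i x y :
  smul (Ioff i x) (Ioff i y) = (2 * bform x y) *: (Ediag (i + 1) + Ediag (i + 2)).
Proof.
have hom p q u v : u \in part C p -> v \in part C q ->
  smul (Ioff i u) (Ioff i v) = (2 * bform u v) *: (Ediag (i + 1) + Ediag (i + 2)).
  move=> hx hy; apply: (H3_smulE (Ioff_part i hx) (Ioff_part _ hy)).
    case: (eqVneq p q) => [->|ne]; first by rewrite addbb rpredZ ?rpredD ?Ediag_part.
    by rewrite (bform_neq ne hx hy) mulr0 scale0r mem0v.
  rewrite (linZ _ _ H3_val_linear) (linD _ _ H3_val_linear).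
  rewrite !H3_val_off !H3_val_diag !mul_off_l; apply/ffunP => -[m l]; rewrite !ffunE /=.
  case: (ord3P i m) => ->; case: (ord3P i l) => ->; rewrite !ord3E /= ?ord3E /=;
  rewrite ?smul0r ?scaler0 ?addr0 ?add0r ?scaler0 // !smulZr.
    by rewrite -[(2 * _) *: _]scalerA -(bar_mul_polar hx hy); module_eq k C; ring.
  rewrite -[(2 * _) *: _]scalerA -(smul_bar_polar scC b11 hx hy).
  by module_eq k C; ring.
rewrite -[x]hcomp_sum -[y]hcomp_sum !IoffD !(smulDl, smulDr).
rewrite !(hom _ _ _ _ (hcomp_in _ _) (hcomp_in _ _)) -!scalerDl.
by congr (_ *: _); rewrite !(bformDl, bformDr); ring.
Qed.

End H3coord.

(** * The derivations D_t and D_i(x) of H_3(C) *)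

Section Derivations.
Variables (k : fieldType) (A : superalgebra k).

Lemma end_part_comp p q (d e : 'End(A)) : d \in end_part A p ->
  e \in end_part A q -> (d \o e)%VF \in end_part A (p (+) q).
Proof.
move=> /mem_end_part hd /mem_end_part he; apply/mem_end_part => r x hx.
by rewrite comp_lfunE -addbA; apply/hd/he.
Qed.

Lemma scomm_part p q (d e : 'End(A)) : d \in end_part A p ->
  e \in end_part A q -> scomm d e \in end_part A (p (+) q).
Proof.
move=> hd he; rewrite (scommE hd he) rpredB ?rpredZ //; first exact: end_part_comp.
by rewrite addbC; apply: end_part_comp.
Qed.

Lemma lmul_part p (x : A) : x \in part A p -> lmul x \in end_part A p.
Proof. by move=> hx; apply/mem_end_part => q y hy; rewrite lmulE smul_part. Qed.

Lemma der_end p (d : 'End(A)) : d \in der_part A p -> d \in end_part A p.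
Proof. by case/mem_der. Qed.

Lemma scomm_der p q (d e : 'End(A)) : d \in der_part A p -> e \in der_part A q ->
  scomm d e \in der_part A (p (+) q).
Proof.
move=> hd he; have hde := scomm_part (der_end hd) (der_end he).
have /mem_der[/mem_end_part pd Hd] := hd; have /mem_der[/mem_end_part pe He] := he.
apply/mem_der; split=> // r s x y hx hy.
rewrite (scommE (der_end hd) (der_end he)) !(add_lfunE, opp_lfunE, scale_lfunE, comp_lfunE).
rewrite (Hd r s) // (He r s) // !linearD !linearZ /=.
rewrite (Hd _ _ _ _ (pe _ _ hx) hy) (Hd _ _ _ _ hx (pe _ _ hy)).
rewrite (He _ _ _ _ (pd _ _ hx) hy) (He _ _ _ _ hx (pd _ _ hy)).
rewrite !(smulDl, smulDr, smulNl, smulNr, smulZl, smulZr).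
clear; case: p; case: q; case: r; rewrite /sgn /= ?expr0 ?expr1; module_eq k A; ring.
Qed.

End Derivations.

Section DerivationMaps.
Variables (k : fieldType) (C : unital_normed_superalgebra k).
Local Notation "1c" := (un_one C).
Local Notation H := (H3 C).
Local Notation "x ** y" := (@para_mul k C x y) (at level 40).

(** Acts on the three off-diagonal Peirce spaces by the components of t and kills
    the diagonal; it is a derivation exactly when t is a triality triple. *)
Definition DT_fun (t : {ffun 'I_3 -> 'End(C)}) (h : H) : H :=
  \sum_i Ioff i (t i (Icoef i h)).

Lemma DT_fun_linear t : linear (DT_fun t).
Proof.
apply: linear_sum_fun => i; apply: (linear_comp (@Ioff_linear k C i)).
by apply: linear_comp (@Icoef_linear k C i); move=> a x y; rewrite linearP.
Qed.

End DerivationMaps.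

HB.lock Definition DT (k : fieldType) (C : unital_normed_superalgebra k)
  (t : {ffun 'I_3 -> 'End(C)}) : 'End(H3 C) := linfun (DT_fun t).

(** Twice the supercommutator of L_(I_i(x)) and L_(E_(i+1)); the sign is absent
    because E_(i+1) is even. *)
HB.lock Definition DI (k : fieldType) (C : unital_normed_superalgebra k)
    (i : 'I_3) (x : C) : 'End(H3 C) :=
  2 *: ((lmul (Ioff i x) \o lmul (Ediag C (i + 1)))%VF
        - (lmul (Ediag C (i + 1)) \o lmul (Ioff i x))%VF).

Section H3der.
Variables (k : fieldType) (C : unital_normed_superalgebra k).
Local Notation "1c" := (un_one C).
Local Notation H := (H3 C).
Local Notation "x ** y" := (@para_mul k C x y) (at level 40).

Local Notation DT := (@DT k C).
Local Notation DI := (@DI k C).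
Local Notation Ioff := (@Ioff k C).
Local Notation Icoef := (@Icoef k C).
Local Notation DT_fun := (@DT_fun k C).

Lemma DTE t h : DT t h = DT_fun t h.
Proof. by rewrite DT.unlock (linfunE (@DT_fun_linear k C t)). Qed.

Lemma DT_linear : linear DT.
Proof.
move=> a t u; apply/lfunP => h; rewrite add_lfunE scale_lfunE.
rewrite !DTE /DT_fun scaler_sumr -big_split /=.
by apply: eq_bigr => i _; rewrite !ffunE !(add_lfunE, scale_lfunE) IoffD IoffZ.
Qed.

Lemma DIE i x u : DI i x u =
  2 *: (smul (Ioff i x) (smul (Ediag C (i + 1)) u)
        - smul (Ediag C (i + 1)) (smul (Ioff i x) u)).
Proof. by rewrite DI.unlock !(add_lfunE, scale_lfunE, opp_lfunE, comp_lfunE) !lmulE. Qed.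

Lemma DI_linear i : linear (DI i).
Proof.
move=> a x y; apply/lfunP => h.
rewrite add_lfunE scale_lfunE !DIE IoffD IoffZ !(smulDl, smulDr, smulZl, smulZr).
module_eq k (H3 C); ring.
Qed.

Hypothesis two0 : (2 : k) != 0.
Hypothesis scC : symmetric_composition (para C).
Hypothesis b11 : bform 1c 1c = 2.

Lemma DT_diag t j : DT t (Ediag C j) = 0.
Proof.
rewrite DTE /DT_fun big1 // => i _.
by rewrite (Icoef_diag b11) linear0 Ioff0.
Qed.

Lemma DT_off t j x : DT t (Ioff j x) = Ioff j (t j x).
Proof.
rewrite DTE /DT_fun (bigD1 j) //= big1 ?addr0 => [|i ij].
  by rewrite (Icoef_off two0 b11) eqxx.
by rewrite (Icoef_off two0 b11) (negPf ij) linear0 Ioff0.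
Qed.

(** The premise q = false of the diagonal case reflects that the idempotents only
    contribute to the even part. *)
Lemma H3_part_ind q (P : H -> Prop) : lin_closed P ->
    (forall j, q = false -> P (Ediag C j)) ->
    (forall j x, x \in part C q -> P (Ioff j x)) ->
  forall u, u \in part H q -> P u.
Proof.
move=> [P0 Plin] PE PI u hu; rewrite (H3_decomp two0 b11 u).
have hv := iffLR (mem_ffun_part _ _) (iffLR (mem_herm _ _) (H3_val_in hu)).1.
have PD x y : P x -> P y -> P (x + y).
  by move=> hx hy; rewrite -[x]scale1r; apply: Plin.
apply: big_ind => // j _; apply: PD; last by apply: PI; rewrite Icoef.unlock rpredZ.
case: q {PI} PE hu hv => [_ hu hv|PE _ _].
  rewrite Ecoef.unlock (bform_neq (p := true) (q := false)) ?un_one_even //.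
  by rewrite mulr0 scale0r.
by rewrite -[_ *: _]addr0; apply: Plin => //; apply: PE.
Qed.

Lemma H3_lfun_ext (W : vectType k) (d e : 'Hom(H, W)) :
    (forall j, d (Ediag C j) = e (Ediag C j)) ->
    (forall j q x, x \in part C q -> d (Ioff j x) = e (Ioff j x)) -> d = e.
Proof.
move=> HE HI; apply/lfunP => u; rewrite -[u]hcomp_sum !linearD.
have L : lin_closed (fun u => d u = e u).
  by split=> [|a x y hx hy]; rewrite ?linear0 // !linearP /= hx hy.
by congr (_ + _); apply: (H3_part_ind L) (hcomp_in _ u) => // j x; apply: HI.
Qed.

Lemma Icoef_part q j u : u \in part H q -> Icoef j u \in part C q.
Proof.
move: u; apply: H3_part_ind => [|l _|l x hx].
- split=> [|a x y hx hy]; first by rewrite (lin0 (@Icoef_linear k C j)) mem0v.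
  by rewrite (@Icoef_linear k C j a x y); apply: rpredD => //; apply: rpredZ.
- by rewrite (Icoef_diag b11) mem0v.
by rewrite (Icoef_off two0 b11); case: ifP; rewrite ?mem0v.
Qed.

Lemma DT_part p (t : {ffun 'I_3 -> 'End(C)}) :
  (forall i, t i \in end_part C p) -> DT t \in end_part H p.
Proof.
move=> ht; apply/mem_end_part => q u hu.
rewrite DTE; apply: memv_suml => i _.
have hx : t i (Icoef i u) \in part C (p (+) q).
  by have /mem_end_part := ht i; apply; apply: Icoef_part.
exact: (Ioff_part b11 i hx).
Qed.

Lemma Ioff_succ3 i x y :
  [/\ smul (Ioff i x) (Ioff (i + 1) y) = Ioff (i + 2) (x ** y),
      smul (Ioff (i + 1) x) (Ioff (i + 2) y) = Ioff i (x ** y) &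
      smul (Ioff (i + 2) x) (Ioff i y) = Ioff (i + 1) (x ** y)].
Proof.
split; first exact: Ioff_succ.
  by have := Ioff_succ two0 scC b11 (i + 1) x y; rewrite !ord3E.
by have := Ioff_succ two0 scC b11 (i + 2) x y; rewrite !ord3E.
Qed.

Lemma Ioff_pred3 i p q x y : x \in part C p -> y \in part C q ->
  [/\ smul (Ioff (i + 1) x) (Ioff i y) = sgn (p && q) *: Ioff (i + 2) (y ** x),
      smul (Ioff (i + 2) x) (Ioff (i + 1) y) = sgn (p && q) *: Ioff i (y ** x) &
      smul (Ioff i x) (Ioff (i + 2) y) = sgn (p && q) *: Ioff (i + 1) (y ** x)].
Proof.
move=> hx hy; split; first exact: Ioff_pred.
  by have := Ioff_pred two0 scC b11 (i + 1) hx hy; rewrite !ord3E.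
by have := Ioff_pred two0 scC b11 (i + 2) hx hy; rewrite !ord3E.
Qed.

Let EE := Ediag_Ediag two0 b11.
Let EI := Ediag_Ioff two0 b11.
Let IE := Ioff_Ediag two0 b11.
Let II := Ioff_Ioff two0 scC b11.

Lemma DI_diag i x :
  [/\ DI i x (Ediag C i) = 0,
      DI i x (Ediag C (i + 1)) = 2^-1 *: Ioff i x &
      DI i x (Ediag C (i + 2)) = - (2^-1 *: Ioff i x)].
Proof.
rewrite !DIE !EE !IE !ord3E /half_if !(smul0r, smulZr) !IE !EI !ord3E /half_if.
split; module_eq k (H3 C); field; exact: two0.
Qed.

Lemma DI_off0 i x y :
  DI i x (Ioff i y) = (2 * bform x y) *: (Ediag C (i + 2) - Ediag C (i + 1)).
Proof.
rewrite !DIE !EI !II !ord3E /half_if !(smulDr, smulZr) !II !EE !ord3E.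
module_eq k (H3 C); field; exact: two0.
Qed.

Lemma DI_off1 i x y : DI i x (Ioff (i + 1) y) = - Ioff (i + 2) (x ** y).
Proof.
have [I1 _ _] := Ioff_succ3 i x y.
rewrite !DIE !EI !I1 !ord3E /half_if !(smulDr, smulZr) !EI !ord3E /half_if.
module_eq k (H3 C); field; exact: two0.
Qed.

Lemma DI_off2 i p q x y : x \in part C p -> y \in part C q ->
  DI i x (Ioff (i + 2) y) = sgn (p && q) *: Ioff (i + 1) (y ** x).
Proof.
move=> hx hy; have [_ _ I1] := Ioff_pred3 i hx hy.
rewrite !DIE !EI !ord3E /half_if !(smulDr, smulZr) !I1 !(smulDr, smulZr) !EI !ord3E /half_if.
move: (sgn _) => s; module_eq k (H3 C); field; exact: two0.
Qed.

Lemma DI_part i p x : x \in part C p -> DI i x \in end_part H p.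
Proof.
move=> hx; have hI := lmul_part (Ioff_part b11 i hx).
have hE := lmul_part (Ediag_part C (i + 1)).
rewrite DI.unlock; apply/memvZ/memvB; last exact: (end_part_comp hE hI).
by have := end_part_comp hI hE; rewrite addbF.
Qed.

End H3der.

(** * Verification of the Leibniz rule *)

Lemma lin_closed_eq (k : fieldType) (U V : vectType k) (f g : U -> V) :
  linear f -> linear g -> lin_closed (fun u => f u = g u).
Proof.
move=> lf lg; split=> [|a x y ex ey]; first by rewrite !lin0.
by rewrite lf lg ex ey.
Qed.

Lemma linear_lfun (k : fieldType) (U V : vectType k) (f : 'Hom(U, V)) : linear f.
Proof. by move=> a x y; rewrite linearP. Qed.

Section DerH3.
Variables (k : fieldType) (C : unital_normed_superalgebra k).
Local Notation "1c" := (un_one C).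
Local Notation H := (H3 C).
Local Notation E := (Ediag C).
Local Notation I := (@Ioff k C).
Local Notation "x ** y" := (@para_mul k C x y) (at level 40).

Hypothesis two0 : (2 : k) != 0.
Hypothesis scC : symmetric_composition (para C).
Hypothesis b11 : bform 1c 1c = 2.

Let EE := Ediag_Ediag two0 b11.
Let EI := Ediag_Ioff two0 b11.
Let IE := Ioff_Ediag two0 b11.
Let II := Ioff_Ioff two0 scC b11.
Let HC := @H3_smulC k C.

Lemma lfun_partE p (d : 'End(H)) q u : d \in end_part H p -> u \in part H q ->
  d u \in part H (p (+) q).
Proof. by move/mem_end_part; apply. Qed.

Definition leibniz (p : bool) (d : 'End(H)) (q : bool) (u v : H) : Prop :=
  d (smul u v) = smul (d u) v + sgn (p && q) *: smul u (d v).

Lemma leibniz_sym p (d : 'End(H)) q r u v : d \in end_part H p ->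
    u \in part H q -> v \in part H r ->
  leibniz p d q u v -> leibniz p d r v u.
Proof.
move=> hd hu hv; rewrite /leibniz => L.
rewrite (HC hv hu) lfZ L.
rewrite (HC (lfun_partE hd hu) hv) (HC hu (lfun_partE hd hv)).
move: (p) (q) (r) => [] [] []; rewrite /sgn /= ?expr0 ?expr1;
  module_eq k (H3 C); ring.
Qed.

Lemma leibniz_lin_l p (d : 'End(H)) q v : lin_closed (fun u => leibniz p d q u v).
Proof.
have [l _] := smul_bilin H.
apply: (@lin_closed_eq k H H); first exact: (linear_comp (linear_lfun d) (l v)).
apply: linear_add; first exact: (linear_comp (l v) (linear_lfun d)).
exact/linear_scale/l.
Qed.

Lemma leibniz_lin_r p (d : 'End(H)) q u : lin_closed (fun v => leibniz p d q u v).
Proof.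
have [_ r] := smul_bilin H.
apply: (@lin_closed_eq k H H); first exact: (linear_comp (linear_lfun d) (r u)).
apply: linear_add; first exact: r.
exact/linear_scale/(linear_comp (r u))/linear_lfun.
Qed.

(** By supercommutativity the Leibniz rule for (u, v) gives that for (v, u), so
    only pairs in one cyclic order have to be tested. *)
Lemma der_criterion p (d : 'End(H)) : d \in end_part H p ->
  (forall i, leibniz p d false (E i) (E i)) ->
  (forall i, leibniz p d false (E i) (E (i + 1))) ->
  (forall i j q x, x \in part C q -> leibniz p d false (E i) (I j x)) ->
  (forall i q r x y, x \in part C q -> y \in part C r ->
     leibniz p d q (I i x) (I i y)) ->
  (forall i q r x y, x \in part C q -> y \in part C r ->
     leibniz p d q (I i x) (I (i + 1) y)) ->
  d \in der_part H p.
Proof.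
move=> hd hEE hEE1 hEI hII hII1; apply/mem_der; split=> // q r u v hu hv.
have hE j := Ediag_part C j.
have hI j s x (hx : x \in part C s) := Ioff_part b11 j hx.
suff gen : leibniz p d q u v by [].
have LEE i j : leibniz p d false (E i) (E j).
  case: (ord3P i j) => -> //.
  apply: (leibniz_sym hd (hE _) (hE _)).
  by have := hEE1 (i + 2); rewrite !ord3E.
have LII i j s t x y : x \in part C s -> y \in part C t ->
    leibniz p d s (I i x) (I j y).
  move=> hx hy; case: (ord3P i j) => ->; [exact: hII hx hy | exact: hII1 hx hy|].
  apply: (leibniz_sym hd (hI _ _ _ hy) (hI _ _ _ hx)).
  by have := hII1 (i + 2) _ _ _ _ hy hx; rewrite !ord3E.
move: u hu; apply: (H3_part_ind two0 b11); first exact: leibniz_lin_l.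
  move=> j -> {q}; move: v hv; apply: (H3_part_ind two0 b11) => //.
    exact: leibniz_lin_r.
  by move=> l x; apply: hEI.
move=> j x hx; move: v hv; apply: (H3_part_ind two0 b11).
- exact: leibniz_lin_r.
- move=> l _; apply: (leibniz_sym hd (hE _) (hI _ _ _ hx)); exact: hEI hx.
by move=> l y; apply: LII.
Qed.

(** On the frame, the Leibniz rule for D_i(x) amounts to the composition
    identities and to the associativity of the norm. *)
Lemma DI_der i p x : x \in part C p -> DI i x \in der_part H p.
Proof.
move=> hx; have [D0 D1 D2] := DI_diag two0 b11 i x.
have O0 := DI_off0 two0 scC b11 i x; have O1 := DI_off1 two0 scC b11 i x.
have O2 q y (hy : y \in part C q) := DI_off2 two0 scC b11 i hx hy.
have succ3 := Ioff_succ3 two0 scC b11.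
have pred3 := Ioff_pred3 two0 scC b11.
apply: der_criterion; rewrite /leibniz.
- exact: DI_part.
- move=> j; case: (ord3P i j) => ->; rewrite !EE ?ord3E ?D0 ?D1 ?D2
    ?smul0l ?smul0r ?smulNl ?smulNr ?smulZl ?smulZr ?IE ?EI ?ord3E /half_if andbF /sgn /=;
    module_eq k (H3 C); field; done.
- move=> j; case: (ord3P i j) => ->; rewrite !EE ?ord3E ?D0 ?D1 ?D2 ?lf0
    ?smul0l ?smul0r ?smulNl ?smulNr ?smulZl ?smulZr ?IE ?EI ?ord3E /half_if andbF /sgn /=;
    module_eq k (H3 C); field; done.
- move=> j l q y hy; have [S1 S2 S3] := succ3 i x y.
  have [_ _ P3] := pred3 i _ _ _ _ hx hy; have O2' := O2 _ _ hy.
  rewrite EI lfZ andbF [sgn false]/sgn /= expr0 scale1r.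
  move: (sgn (p && q)) O2' P3 => s O2' P3.
  case: (ord3P i j) => ->; case: (ord3P i l) => ->; rewrite ?D0 ?D1 ?D2 ?O0 ?O1 ?O2'
    ?smul0l ?smulNl ?smulZl ?II ?S1 ?P3 ?smulNr ?smulZr ?smulDr ?smulNr ?EE ?EI
    ?ord3E /half_if; module_eq k (H3 C); field; done.
- move=> j q r y z hy hz; rewrite II; case: (ord3P i j) => ->.
  + rewrite !O0 lfZ lfD D1 D2 !(smulZl, smulZr, smulDl, smulDr, smulNl, smulNr).
    rewrite !IE !EI ?ord3E /half_if; move: (sgn _) => s.
    module_eq k (H3 C); field; done.
  + rewrite !O1 lfZ lfD ?ord3E D0 D2 !(smulNl, smulNr).
    have [_ -> _] := succ3 i y (x ** z).
    have [_ -> _] := pred3 i _ _ _ _ (pm_part hx hy) hz.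
    have := pm_right scC hz hx hy; move/(canRL (addrK _)) => ->.
    rewrite (bformC hy hz) IoffD IoffN !IoffZ.
    move: (bform _ _) => b; move: (p) (q) (r) => [] [] [];
      rewrite /sgn /= ?expr0 ?expr1; module_eq k (H3 C); field; done.
  + rewrite !(O2 _ _ hy) !(O2 _ _ hz) lfZ lfD ?ord3E D0 D1 !(smulZl, smulZr).
    have [_ -> _] := succ3 i (y ** x) z.
    have [_ -> _] := pred3 i _ _ _ _ hy (pm_part hz hx).
    have := pm_left scC hy hx hz; move/(canRL (addrK _)) => ->.
    rewrite IoffD IoffN !IoffZ.
    case: (eqVneq q r) => [<-|ne]; last rewrite (bform_neq ne hy hz);
      [move: (bform _ _) => b|]; move: (p) (q) (r) => [] [] [];
      rewrite /sgn /= ?expr0 ?expr1; module_eq k (H3 C); field; done.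
move=> j q r y z hy hz; case: (ord3P i j) => ->.
- have [-> _ _] := succ3 i y z.
  rewrite (O2 _ _ (pm_part hy hz)) O0 O1.
  rewrite !(smulZl, smulZr, smulDl, smulDr, smulNl, smulNr).
  have [_ _ ->] := pred3 i _ _ _ _ hy (pm_part hx hz).
  have := pm_left scC hy hz hx; move/(canRL (addrK _)) => ->.
  rewrite (bformC hx hy) IoffD IoffN !IoffZ !EI ?ord3E /half_if.
  move: (bform _ _) => b; move: (p) (q) (r) => [] [] [];
      rewrite /sgn /= ?expr0 ?expr1; module_eq k (H3 C); field; done.
- rewrite ?ord3E; have [_ -> _] := succ3 i y z.
  rewrite ?ord3E O0 O1 (O2 _ _ hz) !(smulNl, smulZr) !II ?ord3E.
  rewrite (pm_assoc scC) -(pm_assoc scC y) (bformC (pm_part hy hz) hx).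
  move: (bform _ _) => b; move: (p) (q) (r) => [] [] [];
      rewrite /sgn /= ?expr0 ?expr1; module_eq k (H3 C); field; done.
rewrite ?ord3E; have [_ _ ->] := succ3 i y z.
rewrite ?ord3E O0 O1 (O2 _ _ hy) !(smulZl, smulZr, smulDr, smulNr) !IE ?ord3E /half_if.
have [-> _ _] := pred3 i _ _ _ _ (pm_part hy hx) hz.
have := pm_right scC hx hy hz; move/(canRL (addrK _)) => ->.
rewrite IoffD IoffN !IoffZ.
move: (bform _ _) => b; move: (p) (q) (r) => [] [] [];
      rewrite /sgn /= ?expr0 ?expr1; module_eq k (H3 C); field; done.
Qed.
End DerH3.

(** * Derivations of H_3(C) and triality *)

Section TrialityShift.
Variables (k : fieldType) (S : normed_superalgebra k).
Hypothesis scS : symmetric_composition S.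

Lemma osp_end p (d : 'End(S)) : d \in osp_part S p -> d \in end_part S p.
Proof. by case/mem_osp. Qed.

Lemma ospE p (d : 'End(S)) q r x y : d \in osp_part S p ->
  x \in part S q -> y \in part S r ->
  bform (d x) y = - (sgn (p && q) * bform x (d y)).
Proof.
case/mem_osp=> _ H hx hy; apply/eqP; rewrite -addr_eq0; apply/eqP; exact: H hx hy.
Qed.

Lemma end_partE p (d : 'End(S)) q u : d \in end_part S p -> u \in part S q ->
  d u \in part S (p (+) q).
Proof. by move/mem_end_part; apply. Qed.

Definition trial p (d0 d1 d2 : 'End(S)) := forall q r x y,
  x \in part S q -> y \in part S r ->
  d0 (smul x y) = smul (d1 x) y + sgn (p && q) *: smul x (d2 y).

Lemma nondeg_eq x y :
  (forall m z, z \in part S m -> bform x z = bform y z) -> x = y.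
Proof.
move=> H; apply/eqP; rewrite -subr_eq0; apply/eqP; apply: (sc_nondeg scS) => z.
by rewrite -[z]hcomp_sum bformDr !bformDl !bformNl !(H _ _ (hcomp_in _ z)) !subrr addr0.
Qed.

(** Triality is cyclic: pair the relation with z under the norm, and use that the
    norm is associative and that the three maps are skew to move them across;
    the outcome is the relation for (z, x), paired with y. *)
Lemma trial_shift p d0 d1 d2 : d0 \in osp_part S p -> d1 \in osp_part S p ->
  d2 \in osp_part S p -> trial p d0 d1 d2 -> trial p d1 d2 d0.
Proof.
move=> h0 h1 h2 T q r x y hx hy; apply: nondeg_eq => m z hz.
have hd0 := end_partE (osp_end h0) hy; have hd1 := end_partE (osp_end h1) hz.
have hd2 := end_partE (osp_end h2) hx.
rewrite (ospE h1 (smul_part hx hy) hz) bformDl bformZl.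
rewrite (sc_assoc scS) (bformC hx (smul_part hy hd1)) (sc_assoc scS).
have /esym/(canRL (addrK _)) -> := T _ _ _ _ hz hx.
rewrite bformDr bformNr bformZr.
have -> : bform y (d0 (smul z x)) = - (sgn (p && r) * bform (d0 y) (smul z x)).
  by rewrite (ospE h0 hy (smul_part hz hx)) mulrN opprK mulrA sgn_sq mul1r.
rewrite -(sc_assoc scS) (bformC (smul_part hd0 hz) hx) -(sc_assoc scS x).
rewrite -(sc_assoc scS y) (bformC (smul_part hy hz) hd2) -(sc_assoc scS _ y).
move: (bform _ _) (bform _ _) => a b.
move: (p) (q) (r) (m) => [] [] [] []; rewrite /sgn /= ?expr0 ?expr1; ring.
Qed.

Lemma tri_trial p (t : {ffun 'I_3 -> 'End(S)}) : t \in tri_part S p ->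
  (forall i, t i \in osp_part S p) /\
  (forall i, trial p (t i) (t (i + 1)) (t (i + 2))).
Proof.
case/mem_tri => ho H; split=> // i.
have T0 : trial p (t 0) (t (0 + 1)) (t (0 + 2)) by rewrite !add0r; exact: H.
have T1 : trial p (t (0 + 1)) (t (0 + 1 + 1)) (t (0 + 1 + 2)).
  by rewrite !ord3E; apply: trial_shift.
have T2 : trial p (t (0 + 2)) (t (0 + 2 + 1)) (t (0 + 2 + 2)).
  by have := trial_shift (ho _) (ho _) (ho _) T1; rewrite !ord3E.
by case: (ord3P 0 i) => ->.
Qed.

End TrialityShift.

Section DerTri.
Variables (k : fieldType) (C : unital_normed_superalgebra k).
Local Notation "1c" := (un_one C).
Local Notation H := (H3 C).
Local Notation E := (Ediag C).
Local Notation I := (@Ioff k C).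
Local Notation "x ** y" := (@para_mul k C x y) (at level 40).

Hypothesis two0 : (2 : k) != 0.
Hypothesis scC : symmetric_composition (para C).
Hypothesis b11 : bform 1c 1c = 2.

Let EE := Ediag_Ediag two0 b11.
Let EI := Ediag_Ioff two0 b11.
Let II := Ioff_Ioff two0 scC b11.
Let IS := Ioff_succ two0 scC b11.

(** The Leibniz rule on I_i(x) I_i(y) is skewness of t_i, and on
    I_i(x) I_(i+1)(y) it is the triality relation in one of its cyclic forms. *)
Lemma DT_der p t : t \in tri_part (para C) p -> DT t \in der_part H p.
Proof.
move=> ht; have [ho hT] := tri_trial scC ht.
have te i : t i \in end_part C p by exact: osp_end (ho i).
have hD := DT_diag b11 t; have hO := DT_off two0 b11 t.
apply: (der_criterion two0 b11); rewrite /leibniz.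
- exact: DT_part.
- by move=> i; rewrite EE eqxx !hD smul0l smul0r scaler0 addr0.
- by move=> i; rewrite EE ord3E !hD lf0 smul0l smul0r scaler0 addr0.
- move=> i j q x hx; rewrite EI lfZ hO hD smul0l add0r EI.
  by rewrite andbF scale1r.
- move=> i q r x y hx hy; rewrite II lfZ lfD !hD !hO !II addr0 scaler0.
  rewrite scalerA -scalerDl.
  have -> : bform ((t i : 'End(C)) x) y = - (sgn (p && q) * bform x (t i y)).
    exact: (ospE (ho i) hx hy).
  rewrite [X in X *: _](_ : _ = 0) ?scale0r //.
  by rewrite mulrN mulrCA addNr.
move=> i q r x y hx hy; rewrite IS !hO !IS.
have [i2 i1] : t (i + 2 + 1) = t i /\ t (i + 2 + 2) = t (i + 1) by rewrite !ord3E.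
have := hT (i + 2) _ _ _ _ hx hy; rewrite i2 i1 => T.
rewrite -IoffZ -IoffD; congr (I _ _); exact: T.
Qed.

(** The converse reading of the same products. *)
Lemma tri_of_der p t : DT t \in der_part H p -> t \in tri_part (para C) p.
Proof.
case/mem_der=> /mem_end_part hp hL.
have hD := DT_diag b11 t; have hO := DT_off two0 b11 t.
have hI j s x (hx : x \in part C s) := Ioff_part b11 j hx.
have te i : t i \in end_part (para C) p.
  apply/mem_end_part => q x hx.
  have := hp _ _ (hI i _ _ hx); rewrite hO => /(Icoef_part two0 b11 i).
  by rewrite (Icoef_off two0 b11) eqxx.
apply/mem_tri; split=> [i|q r x y hx hy].
  apply/mem_osp; split=> // q r x y hx hy.
  have := hL _ _ _ _ (hI i _ _ hx) (hI i _ _ hy).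
  rewrite !hO !II lfZ lfD !hD addr0 scaler0 scalerA -scalerDl.
  move/(congr1 (Ecoef (i + 1))); rewrite EcoefZ.
  rewrite Ecoef0 EcoefD.
  rewrite !(Ecoef_diag two0 b11) !ord3E addr0 => /esym/eqP.
  rewrite mulr1 mulrCA -mulrDr mulf_eq0 (negPf two0) => /eqP; exact.
have := hL _ _ _ _ (hI (0 + 1) _ _ hx) (hI (0 + 2) _ _ hy).
rewrite !hO; have S := Ioff_succ3 two0 scC b11 0.
have [_ -> _] := S x y; have [_ -> _] := S (t (0 + 1) x) y.
have [_ -> _] := S x (t (0 + 2) y).
rewrite hO -IoffZ -IoffD => /(congr1 (Icoef 0)).
by rewrite !(Icoef_off two0 b11) eqxx !add0r.
Qed.

(** D_i(x) maps E_(i+1) to I_i(x)/2, and no other D_j(y) or D_t contributes an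
    I_i-component there, so this is the coordinate of d along D_i(C). *)
Definition dI (i : 'I_3) (d : 'End(H)) : C := 2 *: Icoef i (d (E (i + 1))).

Definition drest (d : 'End(H)) : 'End(H) := d - \sum_i DI i (dI i d).

Definition dtrip (d : 'End(H)) : {ffun 'I_3 -> 'End(C)} :=
  [ffun i => linfun (fun x => Icoef i (drest d (I i x)))].

Lemma dI_linear i : linear (dI i).
Proof.
move=> a d e; rewrite /dI add_lfunE scale_lfunE (@Icoef_linear k C i).
by module_eq k C; ring.
Qed.

Lemma drest_linear : linear drest.
Proof.
move=> a d e; rewrite /drest scalerBr scaler_sumr addrACA -opprD -big_split /=.
by congr (_ - _); apply: eq_bigr => i _; rewrite dI_linear DI_linear.
Qed.

Lemma dtrip_aux d i : linear (fun x => Icoef i (drest d (I i x))).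
Proof.
apply: (linear_comp (@Icoef_linear k C i)).
exact: (linear_comp (linear_lfun _) (@Ioff_linear k C i)).
Qed.

Lemma dtripE d i x : dtrip d i x = Icoef i (drest d (I i x)).
Proof. by rewrite ffunE (linfunE (dtrip_aux d i)). Qed.

Lemma dtrip_linear : linear dtrip.
Proof.
move=> a d e; have := dtripE e; have := dtripE d; have := dtripE (a *: d + e).
move: (dtrip _) (dtrip _) (dtrip _) => u v w hu hv hw.
apply/ffunP => i; apply/lfunP => x; rewrite !ffunE add_lfunE scale_lfunE.
rewrite hu hv hw drest_linear add_lfunE scale_lfunE.
exact: (@Icoef_linear k C i).
Qed.

Lemma DI_diagE i j x :
  DI i x (E j) = if j == i + 1 then 2^-1 *: I i x
                 else if j == i + 2 then - (2^-1 *: I i x) else 0.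
Proof.
have [D0 D1 D2] := DI_diag two0 b11 i x.
by case: (ord3P i j) => ->; rewrite ?ord3E.
Qed.

Lemma dI_DI i j x : dI j (DI i x) = if j == i then x else 0.
Proof.
rewrite /dI DI_diagE; case: (ord3P i j) => ->; rewrite ?ord3E.
- rewrite IcoefZ (Icoef_off two0 b11) eqxx.
  by rewrite scalerA divff // scale1r.
- by rewrite IcoefN IcoefZ (Icoef_off two0 b11) ord3E !scaler0 oppr0 scaler0.
by rewrite Icoef0 scaler0.
Qed.

Lemma drest_DI i x : drest (DI i x) = 0.
Proof.
rewrite /drest (bigD1 i) //= dI_DI eqxx big1 ?addr0 ?subrr // => j ji.
by rewrite dI_DI (negPf ji) (lin0 (@DI_linear k C j)).
Qed.

Lemma dtrip_DI i x : dtrip (DI i x) = 0.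
Proof.
apply/ffunP => j; apply/lfunP => y; rewrite dtripE ffunE.
by rewrite drest_DI !zero_lfunE Icoef0.
Qed.

Lemma dI_DT i t : dI i (DT t) = 0.
Proof. by rewrite /dI (DT_diag b11) Icoef0 scaler0. Qed.

Lemma drest_DT t : drest (DT t) = DT t.
Proof.
rewrite /drest big1 ?subr0 // => i _.
by rewrite dI_DT (lin0 (@DI_linear k C i)).
Qed.

Lemma dtrip_DT t : dtrip (DT t) = t.
Proof.
apply/ffunP => j; apply/lfunP => y; rewrite dtripE.
by rewrite drest_DT (DT_off two0 b11) (Icoef_off two0 b11) eqxx.
Qed.

Lemma Ecoef_mulE m i h : Ecoef m (smul (E i) h) = (m == i)%:R * Ecoef m h.
Proof.
have Z j : Ecoef m (smul (E i) (E j)) = (m == i)%:R * (m == j)%:R.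
  rewrite EE; case: (i =P j) => [<-|ij]; rewrite ?Ecoef0 ?(Ecoef_diag two0 b11).
    by case: (m == i); rewrite ?mulr0 ?mulr1.
  by case: (m =P i) => [->|]; rewrite ?mul0r // mul1r; move/eqP/negPf: ij => ->.
rewrite {1}[h](H3_decomp two0 b11) smul_sumr Ecoef_sum (bigD1 m) //=.
rewrite big1 ?addr0 => [|j jm];
  rewrite smulDr smulZr EI EcoefD !EcoefZ Z (Ecoef_off b11) mulr0 addr0.
  by rewrite eqxx mulr1 mulrC.
by rewrite [m == j]eq_sym (negPf jm) !mulr0.
Qed.

Lemma Icoef_mulE m i h : Icoef m (smul (E i) h) = half_if k (i == m) *: Icoef m h.
Proof.
have Z j : Icoef m (smul (E i) (E j)) = 0.
  by rewrite EE; case: ifP => _; rewrite ?Icoef0 ?(Icoef_diag b11).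
rewrite {1}[h](H3_decomp two0 b11) smul_sumr Icoef_sum (bigD1 m) //=.
rewrite big1 ?addr0 => [|j jm];
  rewrite smulDr smulZr EI IcoefD !IcoefZ Z (Icoef_off two0 b11).
  by rewrite eqxx scaler0 add0r.
by rewrite [m == j]eq_sym (negPf jm) !scaler0 addr0.
Qed.

Lemma H3_coord_eq (u v : H) : (forall j, Ecoef j u = Ecoef j v) ->
  (forall j, Icoef j u = Icoef j v) -> u = v.
Proof.
move=> hE hI; rewrite [u](H3_decomp two0 b11) [v](H3_decomp two0 b11).
by apply: eq_bigr => j _; rewrite hE hI.
Qed.

Lemma half0 : (2^-1 : k) != 0. Proof. by rewrite invr_eq0. Qed.

(** Such a derivation commutes with the multiplications by the idempotents, so it
    preserves their common eigenspaces. *)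
Lemma der_peirce p d : d \in der_part H p -> (forall j, d (E j) = 0) ->
  forall j q x, x \in part C q -> d (I j x) = I j (Icoef j (d (I j x))).
Proof.
case/mem_der=> _ hL hE j q x hx.
have hI := Ioff_part b11 j hx; set h := d _.
have M i : half_if k (i == j) *: h = smul (E i) h.
  have := hL _ _ _ _ (Ediag_part C i) hI.
  by rewrite hE smul0l add0r andbF scale1r EI lfZ.
apply: H3_coord_eq => m.
  rewrite (Ecoef_off b11); have := congr1 (Ecoef m) (M (j + 1)).
  have := congr1 (Ecoef m) (M j); rewrite !EcoefZ !Ecoef_mulE.
  rewrite !ord3E /half_if /GRing.scale /=; case: (ord3P j m) => ->; rewrite !ord3E.
  - by move=> /esym; rewrite mul0r mul1r.
  - rewrite mul1r => _ e; move: (mulVKf two0 (Ecoef (j + 1) h)); rewrite e.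
    by move/eqP; rewrite mulr2n mulrDl mul1r -subr_eq0 addrK => /eqP.
  by move=> _ /eqP; rewrite mul0r mulf_eq0 (negPf half0) => /eqP.
rewrite (Icoef_off two0 b11); case: eqP => [->//|/eqP mj].
have := congr1 (Icoef m) (M j); rewrite eqxx IcoefZ Icoef_mulE.
rewrite eq_sym (negPf mj) /half_if scale0r => /esym/eqP.
by rewrite scaler_eq0 (negPf half0) => /eqP.
Qed.

(** After subtraction of the D_i(x_i) prescribed by the values on the
    idempotents, d kills the idempotents, so it preserves the Peirce spaces and
    is of the form D_t. *)
Lemma der_split p d : d \in der_part H p ->
  [/\ forall i, dI i d \in part C p, dtrip d \in tri_part (para C) p
    & d = DT (dtrip d) + \sum_i DI i (dI i d)].
Proof.
move=> hd; have [hp hL] := iffLR (mem_der _ _) hd.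
have dp i : dI i d \in part C p.
  apply: memvZ; apply: (Icoef_part two0 b11).
  by have /mem_end_part := hp => /(_ _ _ (Ediag_part C (i + 1))); rewrite addbF.
have hr : drest d \in der_part H p.
  apply: memvB => //; apply: memv_suml => i _; exact: DI_der.
(* This rules out diagonal components and an I_j-component of d (E j). *)
have sq j : d (E j) = 2 *: smul (E j) (d (E j)).
  have := hL _ _ _ _ (Ediag_part C j) (Ediag_part C j).
  have hdE : d (E j) \in part H p.
    by have := lfun_partE hp (Ediag_part C j); rewrite addbF.
  rewrite EE eqxx (H3_smulC hdE (Ediag_part C j)) andbF !scale1r => E1.
  by rewrite {1}E1 scaler_nat mulr2n.
have dE j : drest d (E j) = 0.
  apply: H3_coord_eq => m.
    rewrite Ecoef0 /drest add_lfunE opp_lfunE sum_lfunE EcoefD EcoefN Ecoef_sum.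
    rewrite big1 => [|i _]; last first.
      rewrite DI_diagE; case: ifP => _; last case: ifP => _;
        by rewrite ?Ecoef0 ?EcoefN ?EcoefZ ?(Ecoef_off b11) ?mulr0 ?oppr0.
    rewrite subr0; have := congr1 (Ecoef m) (sq j).
    rewrite EcoefZ Ecoef_mulE mulrA; case: eqP => _; last by rewrite mulr0 mul0r.
    rewrite mulr1 => /eqP; rewrite mulr2n mulrDl mul1r eq_sym -subr_eq0 addrK.
    by move/eqP.
  rewrite Icoef0 /drest add_lfunE opp_lfunE sum_lfunE IcoefD IcoefN Icoef_sum.
  rewrite (bigD1 m) //= big1 => [|i im]; last first.
    rewrite DI_diagE; case: ifP => _; last case: ifP => _;
      by rewrite ?Icoef0 ?IcoefN ?IcoefZ ?(Icoef_off two0 b11) ?[m == i]eq_sym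
        ?(negPf im) ?scaler0 ?oppr0.
  rewrite addr0 DI_diagE; case: (ord3P m j) => ->; rewrite !ord3E.
  - have := congr1 (Icoef m) (sq m).
    rewrite IcoefZ Icoef_mulE eqxx /half_if scale0r scaler0 => ->.
    by rewrite Icoef0 subr0.
  - by rewrite IcoefZ (Icoef_off two0 b11) eqxx /dI scalerA mulVf // scale1r subrr.
  (* E_(m+1) E_(m+2) = 0 makes the I_m-components of the values at these two
     idempotents opposite to each other. *)
  have := hL _ _ _ _ (Ediag_part C (m + 1)) (Ediag_part C (m + 2)).
  have hdE : d (E (m + 1)) \in part H p.
    by have := lfun_partE hp (Ediag_part C (m + 1)); rewrite addbF.
  rewrite EE ord3E lf0 andbF scale1r (H3_smulC hdE (Ediag_part C (m + 2))).
  rewrite andbF scale1r => /(congr1 (Icoef m)); rewrite Icoef0 IcoefD.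
  rewrite !Icoef_mulE !ord3E /half_if -scalerDr => /esym/eqP.
  rewrite scaler_eq0 (negPf half0) /= addrC => /eqP E1.
  rewrite IcoefN IcoefZ (Icoef_off two0 b11) eqxx /dI scalerA mulVf // scale1r.
  by rewrite opprK.
have dD : drest d = DT (dtrip d).
  apply: (H3_lfun_ext two0 b11) => [j|j q x hx]; first by rewrite (DT_diag b11).
  rewrite (DT_off two0 b11) dtripE.
  exact: der_peirce hr dE _ _ _ hx.
split=> //; first by apply: tri_of_der; rewrite -dD.
by rewrite -dD /drest subrK.
Qed.

End DerTri.

(** * Commutators of derivations and multiplications *)

Lemma scomm_app (k : fieldType) (U : superspace k) p q (d e : 'End(U)) u :
  d \in end_part U p -> e \in end_part U q ->
  scomm d e u = d (e u) - sgn (p && q) *: e (d u).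
Proof.
move=> hd he.
by rewrite (scommE hd he) add_lfunE opp_lfunE scale_lfunE !comp_lfunE.
Qed.

Lemma theta_iterE (k : fieldType) (S : normed_superalgebra k) (i : 'I_3)
    (t : {ffun 'I_3 -> 'End(S)}) :
  [/\ iter i (@theta k S) t i = t 0, iter i (@theta k S) t (i + 1) = t 1
    & iter i (@theta k S) t (i + 2) = t 2].
Proof.
case: i => [[|[|[|i]]] hi] //; split; rewrite /= ?ffunE; congr (t _);
  by apply/val_inj.
Qed.

Section Brackets.
Variables (k : fieldType) (C : unital_normed_superalgebra k).
Local Notation "1c" := (un_one C).
Local Notation H := (H3 C).
Local Notation E := (Ediag C).
Local Notation I := (@Ioff k C).
Local Notation "x ** y" := (@para_mul k C x y) (at level 40).

Hypothesis two0 : (2 : k) != 0.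
Hypothesis scC : symmetric_composition (para C).
Hypothesis b11 : bform 1c 1c = 2.

Let EE := Ediag_Ediag two0 b11.
Let EI := Ediag_Ioff two0 b11.
Let IE := Ioff_Ediag two0 b11.
Let II := Ioff_Ioff two0 scC b11.

(** The triple t_{x,y} of the para-Hurwitz superalgebra, typed as maps of C. *)
Definition ttriple p q (x y : C) : {ffun 'I_3 -> 'End(C)} :=
  @t_triple k (para C) p q x y.

Definition shift_triple (i : 'I_3) (t : {ffun 'I_3 -> 'End(C)}) :
  {ffun 'I_3 -> 'End(C)} := iter i (@theta k (para C)) t.

Lemma ttriple0 p q r x y z : z \in part C r ->
  ttriple p q x y 0 z = (sgn (q && r) * bform x z) *: y
                    - (sgn (p && (q (+) r)) * bform y z) *: x.
Proof. by move=> hz; rewrite ffunE; apply: (@sigmaE k (para C)). Qed.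

Lemma ttriple1 p q r x y z : y \in part C q -> z \in part C r ->
  ttriple p q x y 1 z
  = (2^-1 * bform x y) *: z - sgn (p && (q (+) r)) *: ((y ** z) ** x).
Proof.
move=> hy hz; rewrite ffunE add_lfunE opp_lfunE scale_lfunE id_lfunE comp_lfunE.
congr (_ - _); apply: etrans (congr1 (@rmul k (para C) p x) _) _.
  exact: (@lmulE k (para C) y z).
exact: (@rmulE k (para C) p (q (+) r) x _ (pm_part hy hz)).
Qed.

Lemma ttriple2 p q r x y z : z \in part C r ->
  ttriple p q x y 2 z
  = (2^-1 * bform x y) *: z - sgn (q && r) *: (x ** (z ** y)).
Proof.
move=> hz; rewrite ffunE add_lfunE opp_lfunE scale_lfunE id_lfunE comp_lfunE.
congr (_ - _); apply: etrans (@lmulE k (para C) x _) _.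
rewrite (@rmulE k (para C) q r y _ hz); exact: (@smulZr k (para C)).
Qed.

Lemma DT_shift i t :
  [/\ forall z, DT (shift_triple i t) (I i z) = I i (t 0 z),
      forall z, DT (shift_triple i t) (I (i + 1) z) = I (i + 1) (t 1 z)
    & forall z, DT (shift_triple i t) (I (i + 2) z) = I (i + 2) (t 2 z)].
Proof.
have [t0 t1 t2] := @theta_iterE k (para C) i t.
by split=> z; rewrite (DT_off two0 b11) /shift_triple ?t0 ?t1 ?t2.
Qed.

Lemma scomm_DT_DI p q i (t : {ffun 'I_3 -> 'End(C)}) x :
    t \in tri_part (para C) p -> x \in part C q ->
  scomm (DT t) (DI i x) = DI i (t i x).
Proof.
move=> ht hx; have [ho hT] := tri_trial scC ht.
have tT j s r u v : u \in part C s -> v \in part C r ->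
    t j (u ** v) = t (j + 1) u ** v + sgn (p && s) *: (u ** t (j + 2) v).
  by move=> hu hv; exact: (hT j _ _ _ _ hu hv).
have te j : t j \in end_part C p by exact: osp_end (ho j).
have sE u := scomm_app u (der_end (DT_der two0 scC b11 ht)) (DI_part b11 i hx).
have hD := DT_diag b11 t; have hO := DT_off two0 b11 t.
have htx := end_partE (te i) hx.
have [D0 D1 D2] := DI_diag two0 b11 i x.
have [D0' D1' D2'] := DI_diag two0 b11 i (t i x).
apply: (H3_lfun_ext two0 b11) => [j|j r z hz];
  rewrite sE.
  rewrite hD lf0 scaler0 subr0; case: (ord3P i j) => ->.
  - by rewrite D0 D0' lf0.
  - by rewrite D1 D1' lfZ hO.
  by rewrite D2 D2' lfN lfZ hO.
rewrite hO; case: (ord3P i j) => ->.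
- rewrite !(DI_off0 two0 scC b11) lfZ lfB !hD subrr scaler0 sub0r.
  have -> : bform ((t i : 'End(C)) x) z = - (sgn (p && q) * bform x (t i z)).
    exact: (ospE (ho i) hx hz).
  rewrite scalerA -scaleNr; congr (_ *: _); rewrite mulrN; congr (- _); exact: mulrCA.
- rewrite !(DI_off1 two0 scC b11) lfN hO.
  have := tT (i + 2) _ _ _ _ hx hz; rewrite !ord3E => ->.
  rewrite IoffD IoffZ; module_eq k (H3 C); ring.
rewrite !(DI_off2 two0 scC b11 i hx hz) !(DI_off2 two0 scC b11 i htx hz).
rewrite (DI_off2 two0 scC b11 i hx (end_partE (te _) hz)) lfZ hO.
have := tT (i + 1) _ _ _ _ hz hx; rewrite !ord3E => ->.
rewrite IoffD IoffZ.
move: (p) (q) (r) => [] [] []; rewrite /sgn /= ?expr0 ?expr1; module_eq k (H3 C); ring.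
Qed.

Lemma scomm_DI_succ p q i x y : x \in part C p -> y \in part C q ->
  scomm (DI i x) (DI (i + 1) y) = DI (i + 2) (x ** y).
Proof.
move=> hx hy; have sE u := scomm_app u (DI_part b11 _ hx) (DI_part b11 _ hy).
have [A0 A1 A2] := DI_diag two0 b11 i x.
have [B0 B1 B2] := DI_diag two0 b11 (i + 1) y.
have [F0 F1 F2] := DI_diag two0 b11 (i + 2) (x ** y).
have A3 := DI_off0 two0 scC b11 i x; have A4 := DI_off1 two0 scC b11 i x.
have A5 r z (hz : z \in part C r) := DI_off2 two0 scC b11 i hx hz.
have B3 := DI_off0 two0 scC b11 (i + 1) y; have B4 := DI_off1 two0 scC b11 (i + 1) y.
have B5 r z (hz : z \in part C r) := DI_off2 two0 scC b11 (i + 1) hy hz.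
have F3 := DI_off0 two0 scC b11 (i + 2) (x ** y).
have F4 := DI_off1 two0 scC b11 (i + 2) (x ** y).
have F5 r z (hz : z \in part C r) := DI_off2 two0 scC b11 (i + 2) (pm_part hx hy) hz.
rewrite !ord3E in B0 B1 B2 B3 B4 B5 F0 F1 F2 F3 F4 F5.
apply: (H3_lfun_ext two0 b11) => [j|j r z hz];
  rewrite sE.
  case: (ord3P i j) => ->.
  - rewrite A0 B2 F1 lf0 lfN lfZ A4.
    module_eq k (H3 C); ring.
  - rewrite A1 B0 F2 lf0 lfZ (B5 _ _ hx).
    move: (p) (q) => [] []; rewrite /sgn /= ?expr0 ?expr1; module_eq k (H3 C); ring.
  rewrite A2 B1 F0 lfN !lfZ (B5 _ _ hx) A4.
  move: (p) (q) => [] []; rewrite /sgn /= ?expr0 ?expr1; module_eq k (H3 C); ring.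
case: (ord3P i j) => ->.
- rewrite (B5 _ _ hz) F4 A3 !lfZ lfB B1 B0 (A5 _ _ (pm_part hz hy)).
  have := pm_left scC hx hy hz; move/(canRL (addrK _)) => ->.
  rewrite IoffD IoffN !IoffZ.
  case: (eqVneq p r) => [<-|ne]; last rewrite (bform_neq ne hx hz);
    [move: (bform _ _) => b|]; move: (p) (q) (r) => [] [] [];
    rewrite /sgn /= ?expr0 ?expr1; module_eq k (H3 C); field; done.
- rewrite B3 lfZ lfB A0 A2 A4 lfN B4 (F5 _ _ hz).
  have := pm_right scC hz hx hy; move/(canRL (addrK _)) => ->.
  rewrite IoffD IoffN !IoffZ (bformC hy hz).
  move: (bform _ _) => b;  move: (p) (q) (r) => [] [] [];
    rewrite /sgn /= ?expr0 ?expr1; module_eq k (H3 C); field; done.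
rewrite B4 lfN A3 (A5 _ _ hz) lfZ B3 F3.
rewrite (pm_assoc scC) -(pm_assoc scC y) (bformC (pm_part hy hz) hx).
move: (bform _ _) => b;  move: (p) (q) (r) => [] [] [];
    rewrite /sgn /= ?expr0 ?expr1; module_eq k (H3 C); field; done.
Qed.

(** This is where the triples t_{x,y} come from: they describe how commutators of
    the D_i(x), for a fixed i, act on the off-diagonal Peirce spaces. *)
Lemma scomm_DI_same p q i x y : x \in part C p -> y \in part C q ->
  scomm (DI i x) (DI i y) = 2 *: DT (shift_triple i (ttriple p q x y)).
Proof.
move=> hx hy; have sE u := scomm_app u (DI_part b11 _ hx) (DI_part b11 _ hy).
have [A0 A1 A2] := DI_diag two0 b11 i x.
have [B0 B1 B2] := DI_diag two0 b11 i y.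
have A3 := DI_off0 two0 scC b11 i x; have A4 := DI_off1 two0 scC b11 i x.
have A5 r z (hz : z \in part C r) := DI_off2 two0 scC b11 i hx hz.
have B3 := DI_off0 two0 scC b11 i y; have B4 := DI_off1 two0 scC b11 i y.
have B5 r z (hz : z \in part C r) := DI_off2 two0 scC b11 i hy hz.
have [T0 T1 T2] := DT_shift i (ttriple p q x y).
have hD := DT_diag b11 (shift_triple i (ttriple p q x y)).
have bxy : bform y x = sgn (p && q) * bform x y.
  by rewrite (bformC hx hy) mulrA sgn_sq mul1r.
apply: (H3_lfun_ext two0 b11) => [j|j r z hz];
  rewrite sE scale_lfunE.
  rewrite hD scaler0; case: (ord3P i j) => ->;
    rewrite ?A0 ?A1 ?A2 ?B0 ?B1 ?B2 ?lf0 ?lfN ?lfZ ?A3 ?B3 ?bxy;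
    try move: (bform _ _) => b; move: (p) (q) => [] []; rewrite /sgn /= ?expr0 ?expr1;
    module_eq k (H3 C); field; done.
case: (ord3P i j) => ->.
- rewrite T0 (ttriple0 _ _ _ _ hz) A3 B3 !lfZ !lfB A1 A2 B1 B2 IoffD IoffN !IoffZ.
  have -> : sgn (q && r) * bform x z = sgn (p && q) * bform x z.
    case: (eqVneq p r) => [->|ne]; first by rewrite andbC.
    by rewrite (bform_neq ne hx hz) !mulr0.
  have -> : sgn (p && (q (+) r)) * bform y z = bform y z.
    case: (eqVneq q r) => [->|ne]; first by rewrite addbb andbF mul1r.
    by rewrite (bform_neq ne hy hz) !mulr0.
  move: (bform x z) (bform y z) (sgn _) => b c s.
  module_eq k (H3 C); field; done.
- rewrite T1 (ttriple1 _ _ hy hz) A4 B4 !lfN.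
  rewrite (A5 _ _ (pm_part hy hz)) (B5 _ _ (pm_part hx hz)).
  have := pm_left scC hx hz hy; move/(canRL (addrK _)) => ->.
  rewrite !(IoffD, IoffN, IoffZ); move: (bform _ _) => b.
  move: (p) (q) (r) => [] [] []; rewrite /sgn /= ?expr0 ?expr1;
    module_eq k (H3 C); field; done.
rewrite T2 (ttriple2 _ _ _ _ hz) (A5 _ _ hz) (B5 _ _ hz) !lfZ A4 B4.
have := pm_right scC hy hz hx; move/(canRL (addrK _)) => ->.
rewrite !(IoffD, IoffN, IoffZ) bxy.
case: (eqVneq p q) => [<-|ne]; last rewrite (bform_neq ne hx hy);
  [move: (bform _ _) => b|]; move: (p) (q) (r) => [] [] [];
  rewrite /sgn /= ?expr0 ?expr1; module_eq k (H3 C); field; done.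
Qed.

(** It is half a commutator of derivations of H_3(C), seen on the Peirce spaces. *)
Lemma shift_ttriple_tri p q i x y : x \in part C p -> y \in part C q ->
  shift_triple i (ttriple p q x y) \in tri_part (para C) (p (+) q).
Proof.
move=> hx hy; apply: (tri_of_der two0 scC b11).
have := scomm_DI_same i hx hy => /(congr1 (fun d : 'End(H) => 2^-1 *: d)).
rewrite scalerA mulVf // scale1r => <-; apply: memvZ.
by apply: scomm_der; apply: DI_der.
Qed.

Lemma scomm_LE_LE i j : scomm (lmul (E i)) (lmul (E j)) = 0.
Proof.
have sE u := scomm_app u (lmul_part (Ediag_part C i)) (lmul_part (Ediag_part C j)).
apply: (H3_lfun_ext two0 b11) => [l|l r z hz];
  rewrite sE zero_lfunE !lmulE scale1r.
  rewrite !EE; case: (j =P l) => [->|jl]; case: (i =P l) => [->|il];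
    rewrite ?smul0r ?EE ?eqxx ?subrr //.
  - by case: eqP il; rewrite ?subr0.
  by case: eqP jl; rewrite ?subr0.
by rewrite !EI !smulZr !EI !scalerA mulrC subrr.
Qed.

Lemma scomm_LE_LI p i x : x \in part C p ->
  [/\ scomm (lmul (E i)) (lmul (I i x)) = 0,
      scomm (lmul (E (i + 1))) (lmul (I i x)) = - (2^-1 *: DI i x)
    & scomm (lmul (E (i + 2))) (lmul (I i x)) = 2^-1 *: DI i x].
Proof.
move=> hx; have [_ P1 P2] := Ioff_pred3 two0 scC b11 i hx hx.
have [A0 A1 A2] := DI_diag two0 b11 i x.
have A3 := DI_off0 two0 scC b11 i x; have A4 := DI_off1 two0 scC b11 i x.
have A5 r z (hz : z \in part C r) := DI_off2 two0 scC b11 i hx hz.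
have hL := lmul_part (Ioff_part b11 i hx).
have hE j := lmul_part (Ediag_part C j).
have S z := Ioff_succ3 two0 scC b11 i x z.
have P r z (hz : z \in part C r) := Ioff_pred3 two0 scC b11 i hx hz.
have sE j u := scomm_app u (hE j) hL.
split; apply: (H3_lfun_ext two0 b11) => [j|j r z hz];
  rewrite sE ?zero_lfunE ?opp_lfunE ?scale_lfunE !lmulE scale1r;
  try (have [S1 _ _] := S z; have [_ _ P3] := P _ _ hz);
  case: (ord3P i j) => ->;
  rewrite ?EE ?EI ?IE ?II ?S1 ?P3 ?A0 ?A1 ?A2 ?A3 ?A4 ?(A5 _ _ hz) ?ord3E /half_if
    ?smul0r ?smulZr ?smulDr ?EE ?EI ?IE ?II ?S1 ?P3 ?smulZr ?EI ?ord3E /half_if;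
  try (move: (sgn _) => s); module_eq k (H3 C); field; done.
Qed.

Lemma scomm_LI_LI_succ p q i x y : x \in part C p -> y \in part C q ->
  scomm (lmul (I i x)) (lmul (I (i + 1) y)) = DI (i + 2) (x ** y).
Proof.
move=> hx hy; have sE u :=
  scomm_app u (lmul_part (Ioff_part b11 i hx)) (lmul_part (Ioff_part b11 (i + 1) hy)).
have [F0 F1 F2] := DI_diag two0 b11 (i + 2) (x ** y).
have F3 := DI_off0 two0 scC b11 (i + 2) (x ** y).
have F4 := DI_off1 two0 scC b11 (i + 2) (x ** y).
have F5 r z (hz : z \in part C r) := DI_off2 two0 scC b11 (i + 2) (pm_part hx hy) hz.
rewrite !ord3E in F0 F1 F2 F3 F4 F5.
have succ3 := Ioff_succ3 two0 scC b11; have pred3 := Ioff_pred3 two0 scC b11.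
have [S1 _ _] := succ3 i x y; have [P1 _ _] := pred3 i _ _ _ _ hy hx.
have II1 u v := II (i + 1) u v; have II2 u v := II (i + 2) u v.
rewrite !ord3E in II1 II2.
apply: (H3_lfun_ext two0 b11) => [j|j r z hz]; rewrite sE !lmulE.
  case: (ord3P i j) => ->; rewrite !IE ?F0 ?F1 ?F2 !ord3E /half_if !smulZr ?S1 ?P1;
    move: (p) (q) => [] []; rewrite /sgn /= ?expr0 ?expr1;
    module_eq k (H3 C); field; done.
case: (ord3P i j) => ->.
- have [-> _ _] := pred3 i _ _ _ _ hy hz.
  rewrite II F4 !(smulZr, smulDr) !IE !ord3E /half_if.
  have [_ _ ->] := pred3 i _ _ _ _ hx (pm_part hz hy).
  have := pm_left scC hx hy hz; move/(canRL (addrK _)) => ->.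
  rewrite IoffD IoffN !IoffZ.
  case: (eqVneq p r) => [<-|ne]; last rewrite (bform_neq ne hx hz);
    [move: (bform _ _) => b|]; move: (p) (q) (r) => [] [] [];
    rewrite /sgn /= ?expr0 ?expr1; module_eq k (H3 C); field; done.
- have [-> _ _] := succ3 i x z; rewrite II1 (F5 _ _ hz) !(smulZr, smulDr) !IE !ord3E /half_if.
  have [_ -> _] := succ3 i y (x ** z).
  have := pm_right scC hz hx hy; move/(canRL (addrK _)) => ->.
  rewrite IoffD IoffN !IoffZ (bformC hy hz).
  move: (bform _ _) => b;  move: (p) (q) (r) => [] [] [];
    rewrite /sgn /= ?expr0 ?expr1; module_eq k (H3 C); field; done.
have [_ -> _] := succ3 i y z; have [_ _ ->] := pred3 i _ _ _ _ hx hz.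
rewrite F3 smulZr II II1 (pm_assoc scC) -(pm_assoc scC y) (bformC (pm_part hy hz) hx).
move: (bform _ _) => b;  move: (p) (q) (r) => [] [] [];
    rewrite /sgn /= ?expr0 ?expr1; module_eq k (H3 C); field; done.
Qed.

(** Same computation as for the commutator of D_i(x) and D_i(y), with the opposite
    sign: multiplication by I_i(x) and D_i(x) agree on I_(i+2)(C) and differ by a
    sign on I_(i+1)(C). *)
Lemma scomm_LI_LI_same p q i x y : x \in part C p -> y \in part C q ->
  scomm (lmul (I i x)) (lmul (I i y))
  = - (2 *: DT (shift_triple i (ttriple p q x y))).
Proof.
move=> hx hy; have sE u :=
  scomm_app u (lmul_part (Ioff_part b11 i hx)) (lmul_part (Ioff_part b11 i hy)).
have [T0 T1 T2] := DT_shift i (ttriple p q x y).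
have hD := DT_diag b11 (shift_triple i (ttriple p q x y)).
have succ3 := Ioff_succ3 two0 scC b11; have pred3 := Ioff_pred3 two0 scC b11.
have bxy : bform y x = sgn (p && q) * bform x y.
  by rewrite (bformC hx hy) mulrA sgn_sq mul1r.
apply: (H3_lfun_ext two0 b11) => [j|j r z hz]; rewrite sE opp_lfunE scale_lfunE !lmulE.
  rewrite hD scaler0; case: (ord3P i j) => ->; rewrite !IE !ord3E /half_if !smulZr !II bxy;
    move: (bform _ _) => b; move: (p) (q) => [] []; rewrite /sgn /= ?expr0 ?expr1;
    module_eq k (H3 C); field; done.
case: (ord3P i j) => ->.
- rewrite T0 (ttriple0 _ _ _ _ hz) !II !(smulZr, smulDr) !IE !ord3E /half_if IoffD IoffN !IoffZ.
  have -> : sgn (q && r) * bform x z = sgn (p && q) * bform x z.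
    case: (eqVneq p r) => [->|ne]; first by rewrite andbC.
    by rewrite (bform_neq ne hx hz) !mulr0.
  have -> : sgn (p && (q (+) r)) * bform y z = bform y z.
    case: (eqVneq q r) => [->|ne]; first by rewrite addbb andbF mul1r.
    by rewrite (bform_neq ne hy hz) !mulr0.
  move: (bform x z) (bform y z) (sgn _) => b c s.
  module_eq k (H3 C); field; done.
- rewrite T1 (ttriple1 _ _ hy hz).
  have [-> _ _] := succ3 i y z; have [-> _ _] := succ3 i x z.
  have [_ _ ->] := pred3 i _ _ _ _ hx (pm_part hy hz).
  have [_ _ ->] := pred3 i _ _ _ _ hy (pm_part hx hz).
  have := pm_left scC hx hz hy; move/(canRL (addrK _)) => ->.
  rewrite !(IoffD, IoffN, IoffZ); move: (bform _ _) => b.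
  move: (p) (q) (r) => [] [] []; rewrite /sgn /= ?expr0 ?expr1;
    module_eq k (H3 C); field; done.
rewrite T2 (ttriple2 _ _ _ _ hz).
have [_ _ ->] := pred3 i _ _ _ _ hx hz; have [_ _ ->] := pred3 i _ _ _ _ hy hz.
rewrite !smulZr.
have [-> _ _] := succ3 i y (z ** x); have [-> _ _] := succ3 i x (z ** y).
have := pm_right scC hy hz hx; move/(canRL (addrK _)) => ->.
rewrite !(IoffD, IoffN, IoffZ) bxy.
case: (eqVneq p q) => [<-|ne]; last rewrite (bform_neq ne hx hy);
  [move: (bform _ _) => b|]; move: (p) (q) (r) => [] [] [];
  rewrite /sgn /= ?expr0 ?expr1; module_eq k (H3 C); field; done.
Qed.

End Brackets.

(** * Triality for the split quaternions *)

Section QuaternionTriality.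
Variable k : fieldType.
Local Notation M2 := 'M[k]_2.
Local Notation S4 := (para (Mat2 k)).

Lemma ord2P (i : 'I_2) : i = 0 \/ i = 1.
Proof. by case: i => [[|[|i]] hi] //; [left|right]; apply/val_inj. Qed.

Lemma mul2E (A B : M2) i j : (A *m B) i j = A i 0 * B 0 j + A i 1 * B 1 j.
Proof.
rewrite mxE !big_ord_recl big_ord0 addr0; congr (_ + A i _ * B _ j);
  exact/val_inj.
Qed.

Lemma sub2E (A B : M2) i j : (A - B) i j = A i j - B i j.
Proof. by rewrite !mxE. Qed.

Lemma mx2P (A B : M2) : A 0 0 = B 0 0 -> A 0 1 = B 0 1 -> A 1 0 = B 1 0 ->
  A 1 1 = B 1 1 -> A = B.
Proof.
by move=> *; apply/matrixP => i j; case: (ord2P i) => ->; case: (ord2P j) => ->.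
Qed.

Lemma tr2E (A : M2) : \tr A = A 0 0 + A 1 1.
Proof.
rewrite /mxtrace !big_ord_recl big_ord0 addr0; congr (_ + A _ _); exact/val_inj.
Qed.

Lemma trace0E (A : M2) : \tr A = 0 -> A 1 1 = - A 0 0.
Proof. by rewrite tr2E => /eqP; rewrite addrC addr_eq0 => /eqP. Qed.

Lemma polar2E (A B : M2) : polar_det A B =
  A 0 0 * B 1 1 + A 1 1 * B 0 0 - A 0 1 * B 1 0 - A 1 0 * B 0 1.
Proof. by rewrite /polar_det !det2E !mxE; ring. Qed.

Definition bar2 (x : M2) : M2 := (\tr x)%:M - x.

Lemma bar2E (x : M2) : [/\ bar2 x 0 0 = x 1 1, bar2 x 1 1 = x 0 0,
  bar2 x 0 1 = - x 0 1 & bar2 x 1 0 = - x 1 0].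
Proof.
by rewrite /bar2 tr2E !mxE /= ?mulr1n ?mulr0n; split; ring.
Qed.

Lemma sbar_Mat2 (x : M2) : sbar (x : Mat2 k) = bar2 x.
Proof.
rewrite /sbar /bar2; congr (_ - _); rewrite -scalemx1; congr (_ *: _).
by rewrite [LHS]polar2E tr2E !mxE /=; ring.
Qed.

Lemma para_Mat2 (x y : M2) : para_mul (x : Mat2 k) y = bar2 x *m bar2 y.
Proof. by rewrite /para_mul !sbar_Mat2. Qed.

Lemma bar2M (x y : M2) : bar2 (x *m y) = bar2 y *m bar2 x.
Proof.
have [x0 x1 x2 x3] := bar2E x; have [y0 y1 y2 y3] := bar2E y.
have [z0 z1 z2 z3] := bar2E (x *m y).
by apply: mx2P; rewrite ?z0 ?z1 ?z2 ?z3 !mul2E ?x0 ?x1 ?x2 ?x3 ?y0 ?y1 ?y2 ?y3; ring.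
Qed.

Lemma bar2_linear : linear bar2.
Proof.
move=> a x y; rewrite /bar2 linearP /= raddfD /= -scale_scalar_mx scalerBr.
by rewrite opprD addrACA.
Qed.

Lemma bar2B x y : bar2 (x - y) = bar2 x - bar2 y.
Proof. by rewrite -scaleN1r addrC bar2_linear scaleN1r addrC. Qed.

Lemma bar2K x : bar2 (bar2 x) = x.
Proof.
have [x0 x1 x2 x3] := bar2E x; have [z0 z1 z2 z3] := bar2E (bar2 x).
by apply: mx2P; rewrite ?z0 ?z1 ?z2 ?z3 ?x0 ?x1 ?x2 ?x3 ?opprK.
Qed.

Lemma bar2_trace0 a : \tr a = 0 -> bar2 a = - a.
Proof. by rewrite /bar2 => ->; rewrite raddf0 sub0r. Qed.

Lemma bar2_1 : bar2 1%:M = 1%:M.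
Proof. by rewrite /bar2 mxtrace1 mulr2n raddfD /= addrK. Qed.

Definition lr_fun (a b x : M2) : M2 := a *m x - x *m b.

Lemma lr_fun_linear a b : linear (lr_fun a b).
Proof.
move=> c x y; rewrite /lr_fun mulmxDr mulmxDl -scalemxAr -scalemxAl scalerBr.
by rewrite opprD addrACA.
Qed.

Definition lr_mul (a b : M2) : 'End(Mat2 k) := linfun (lr_fun a b).

Lemma lr_mulE a b (x : M2) : lr_mul a b x = a *m x - x *m b.
Proof. exact: (linfunE (@lr_fun_linear a b)). Qed.

(** With traceless a_0, a_1, a_2 these triples are three commuting copies of sl_2
    that make up the triality algebra of the quaternions; each a_i acts from the
    left in one component and from the right in the next one. *)
Definition Qtriple (a : {ffun 'I_3 -> M2}) : {ffun 'I_3 -> 'End(Mat2 k)} :=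
  [ffun i => lr_mul (a i) (a (i + 2))].

Lemma QtripleE a i (x : M2) : Qtriple a i x = a i *m x - x *m a (i + 2).
Proof. by rewrite ffunE lr_mulE. Qed.

Lemma even_end (d : 'End(Mat2 k)) : d \in end_part (Mat2 k) false.
Proof.
apply/mem_end_part => q x /even_memP[->|->]; first exact: memvf.
by rewrite lf0 mem0v.
Qed.

Lemma Qtriple_tri (a : {ffun 'I_3 -> M2}) : (forall i, \tr (a i) = 0) ->
  Qtriple a \in tri_part S4 false.
Proof.
move=> ta; have e i := trace0E (ta i); apply/mem_tri; split=> [i|q r x y _ _].
  apply/mem_osp; split=> [|q r x y _ _]; first exact: even_end.
  rewrite /sgn /= expr0 mul1r.
  rewrite [LHS](_ : _ = polar_det (Qtriple a i x) y + polar_det (x : M2) (Qtriple a i y)) //.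
  by rewrite !QtripleE !polar2E !sub2E !mul2E !e; ring.
rewrite /sgn /= expr0 scale1r.
rewrite [LHS](_ : _ = Qtriple a 0 (bar2 x *m bar2 y)); last by rewrite -para_Mat2.
rewrite [RHS](_ : _ = bar2 (Qtriple a 1 x) *m bar2 y + bar2 x *m bar2 (Qtriple a 2 y));
  last by rewrite -!para_Mat2.
rewrite !QtripleE !bar2B !bar2M !(bar2_trace0 (ta _)).
have -> : 1 + 2 = 0 :> 'I_3 by apply/val_inj.
have -> : 2 + 2 = 1 :> 'I_3 by apply/val_inj.
rewrite add0r; move: (bar2 x) (bar2 y) (a 0) (a 1) (a 2) => u v p s r'.
rewrite mulmxBr mulmxBl !(mulmxN, mulNmx) !mulmxA.
by module_eq k ('M[k]_2); ring.
Qed.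

Hypothesis two0 : (2 : k) != 0.

Local Notation dm := (delta_mx : 'I_2 -> 'I_2 -> M2).

Lemma sum2E (F : 'I_2 -> k) : \sum_i F i = F 0 + F 1.
Proof.
rewrite !big_ord_recl big_ord0 addr0; congr (_ + F _); exact/val_inj.
Qed.

(** If d is x |-> a x - x b with a and b traceless, then this half of
    a partial trace of d is a, and b is found from the other partial trace. *)
Definition lcoef (d : 'End(Mat2 k)) : M2 :=
  \matrix_(j, l) (2^-1 * \sum_u (d (dm l u) : M2) j u).

Definition rcoef (d : 'End(Mat2 k)) : M2 :=
  \matrix_(j, l) (- (2^-1 * \sum_s (d (dm s j) : M2) s l)).

Lemma mx2_decomp (x : M2) : x = x 0 0 *: dm 0 0 + x 0 1 *: dm 0 1
  + x 1 0 *: dm 1 0 + x 1 1 *: dm 1 1.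
Proof. by apply: mx2P; rewrite !mxE /=; ring. Qed.

Lemma polar_delta (s u : 'I_2) (N : M2) :
  polar_det (dm s u) N = (if s == u then 1 else -1) * N (1 - s) (1 - u).
Proof.
have e : 1 - 1 = 0 :> 'I_2 by apply/val_inj.
case: (ord2P s) => ->; case: (ord2P u) => ->; rewrite polar2E !mxE /= ?subr0 ?e; ring.
Qed.

(** The isomorphism of so_4 with two copies of sl_2. On matrix units, skewness for
    the polar form of det leaves six independent entries of d, which are those of
    the two traceless matrices. *)
Lemma so_lr (d : 'End(Mat2 k)) :
    (forall x y : M2, polar_det (d x : M2) y + polar_det x (d y) = 0) ->
  [/\ d = lr_mul (lcoef d) (rcoef d), \tr (lcoef d) = 0 & \tr (rcoef d) = 0].
Proof.
move=> so; pose D s u j l := (d (dm s u) : M2) j l.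
have so' s u s' u' : (if s' == u' then 1 else -1) * D s u (1 - s') (1 - u')
    + (if s == u then 1 else -1) * D s' u' (1 - s) (1 - u) = 0.
  by rewrite -(so (dm s u) (dm s' u')) polar_delta polar_detC polar_delta.
have e : 1 - 1 = 0 :> 'I_2 by apply/val_inj.
have dbl (c : k) : c + c = 0 -> c = 0.
  move=> h; apply/eqP; have /eqP : 2 * c = 0 by rewrite mulr2n mulrDl mul1r.
  by rewrite mulf_eq0 (negPf two0).
have z00 : D 0 0 1 1 = 0.
  by apply: dbl; have := so' 0 0 0 0; rewrite /= !subr0 !mul1r.
have z11 : D 1 1 0 0 = 0.
  by apply: dbl; have := so' 1 1 1 1; rewrite /= !e !mul1r.
have z01 : D 0 1 1 0 = 0.
  by apply/dbl/oppr_inj; have := so' 0 1 0 1; rewrite /= !subr0 !e oppr0 opprD !mulN1r.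
have z10 : D 1 0 0 1 = 0.
  by apply/dbl/oppr_inj; have := so' 1 0 1 0; rewrite /= !subr0 !e oppr0 opprD !mulN1r.
have y1 : D 1 1 1 1 = - D 0 0 0 0.
  by have := so' 0 0 1 1; rewrite /= !subr0 !e !mul1r addrC => /eqP; rewrite addr_eq0 => /eqP.
have y2 : D 1 0 1 0 = - D 0 1 0 1.
  have := so' 0 1 1 0; rewrite /= !subr0 !e !mulN1r => /eqP.
  by rewrite addr_eq0 opprK eq_sym => /eqP.
have y3 : D 0 1 1 1 = D 0 0 1 0.
  by have := so' 0 0 0 1; rewrite /= !subr0 !e mulN1r mul1r addrC => /eqP;
    rewrite subr_eq0 => /eqP.
have y4 : D 1 0 1 1 = D 0 0 0 1.
  by have := so' 0 0 1 0; rewrite /= !subr0 !e mulN1r mul1r addrC => /eqP;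
    rewrite subr_eq0 => /eqP.
have y5 : D 0 1 0 0 = D 1 1 1 0.
  by have := so' 1 1 0 1; rewrite /= !subr0 !e mulN1r mul1r addrC => /eqP;
    rewrite subr_eq0 => /eqP.
have y6 : D 1 0 0 0 = D 1 1 0 1.
  by have := so' 1 1 1 0; rewrite /= !subr0 !e mulN1r mul1r addrC => /eqP;
    rewrite subr_eq0 => /eqP.
have zE := (z00, z11, z01, z10, y1, y2, y3, y4, y5, y6).
have lE j l : lcoef d j l = 2^-1 * (D l 0 j 0 + D l 1 j 1) by rewrite mxE sum2E.
have rE j l : rcoef d j l = - (2^-1 * (D 0 j 0 l + D 1 j 1 l)) by rewrite mxE sum2E.
split; last first.
- by rewrite tr2E !rE !zE; ring.
- by rewrite tr2E !lE !zE; ring.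
apply/lfunP => x; rewrite lr_mulE.
have dE j l : (d x : M2) j l = (x : M2) 0 0 * D 0 0 j l + (x : M2) 0 1 * D 0 1 j l
    + (x : M2) 1 0 * D 1 0 j l + (x : M2) 1 1 * D 1 1 j l.
  by rewrite {1}(mx2_decomp x) !lfD !lfZ !mxE.
by apply: mx2P; rewrite dE sub2E !mul2E !lE !rE !zE; field.
Qed.

Lemma central_trace0 (p : M2) : (forall u, p *m u = u *m p) -> \tr p = 0 -> p = 0.
Proof.
move=> cp tp.
have E j l u := congr1 (fun A : M2 => A j l) (cp u).
have := E 0 1 (dm 0 1); have := E 0 0 (dm 0 1); have := E 0 0 (dm 1 0).
rewrite !mul2E !mxE /= !(mulr0, mul0r, mulr1, mul1r, add0r, addr0) => e1 e2 e3.
have p00 : p 0 0 = 0.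
  move: e3; rewrite (trace0E tp) => /eqP; rewrite -addr_eq0 -mulr2n -mulr_natl.
  by rewrite mulf_eq0 (negPf two0) => /eqP.
by apply: mx2P; rewrite ?(trace0E tp) ?p00 ?mxE ?oppr0 // -?e2.
Qed.

Definition Qcoef (t : {ffun 'I_3 -> 'End(Mat2 k)}) : {ffun 'I_3 -> M2} :=
  [ffun i => lcoef (t i)].

(** If d_i is x |-> a_i x - x b_i, the triality relation says that
    p u v - u v q + u r v = 0 for all u and v, where p, q, r are differences of
    an a and a b. Taking u or v to be 1 shows that p and q are central and
    traceless, so b_i = a_(i+2). *)
Lemma tri_Qtriple t : t \in tri_part S4 false ->
  (forall i, \tr (Qcoef t i) = 0) /\ t = Qtriple (Qcoef t).
Proof.
case/mem_tri => ho hT.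
have so i := so_lr (d := t i).
have {}so i : [/\ t i = lr_mul (lcoef (t i)) (rcoef (t i)), \tr (lcoef (t i)) = 0
    & \tr (rcoef (t i)) = 0].
  apply: so => x y; have [_ H] := iffLR (mem_osp _ _) (ho i).
  by have := H false false x y (memvf _) (memvf _); rewrite /sgn /= expr0 mul1r.
have la i : \tr (lcoef (t i)) = 0 by case: (so i).
have ra i : \tr (rcoef (t i)) = 0 by case: (so i).
have tE i (x : M2) : t i x = lcoef (t i) *m x - x *m rcoef (t i).
  rewrite -lr_mulE; have [e _ _] := so i.
  exact: (congr1 (fun f : 'End(Mat2 k) => f x) e).
have ta i : \tr (Qcoef t i) = 0 by rewrite ffunE.
split=> //.
have T (u v : M2) : lcoef (t 0) *m (u *m v) - u *m v *m rcoef (t 0)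
    = (u *m - lcoef (t 1) - - rcoef (t 1) *m u) *m v
      + u *m (v *m - lcoef (t 2) - - rcoef (t 2) *m v).
  have := hT false false (bar2 u) (bar2 v) (memvf _) (memvf _).
  rewrite /sgn /= expr0 scale1r.
  rewrite [smul _ _](_ : _ = u *m v); last first.
    by rewrite /smul /= para_Mat2 !bar2K.
  rewrite tE => ->; rewrite [smul (t 1 _) _]para_Mat2 [smul _ (t 2 _)]para_Mat2.
  by rewrite !tE !bar2K !bar2B !bar2M !bar2K !bar2_trace0.
pose p := lcoef (t 0) - rcoef (t 1); pose q := rcoef (t 0) - lcoef (t 2).
pose r := lcoef (t 1) - rcoef (t 2).
have T' (u v : M2) : p *m u *m v - u *m v *m q + u *m r *m v = 0.
  apply/eqP; rewrite -(subr_eq0 _ 0) subr0; apply/eqP.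
  have /eqP := T u v; rewrite -subr_eq0 => /eqP <-.
  rewrite /p /q /r; move: (lcoef _) (lcoef _) (lcoef _) (rcoef _) (rcoef _) (rcoef _).
  move=> a0 a1 a2 b0 b1 b2.
  rewrite !(mulmxBr, mulmxBl, mulmxN, mulNmx) !mulmxA.
  by module_eq k ('M[k]_2); ring.
have tp : \tr p = 0 by rewrite linearB /= la ra subr0.
have tq : \tr q = 0 by rewrite linearB /= la ra subr0.
have rE : r = q - p.
  have := T' 1%:M 1%:M; rewrite !mulmx1 !mul1mx addrC => /eqP.
  by rewrite addr_eq0 opprB => /eqP.
have p0 : p = 0.
  apply: central_trace0 => // u; apply/eqP; rewrite -subr_eq0; apply/eqP.
  rewrite -(T' u 1%:M) !mulmx1 rE [u *m (q - p)]mulmxBr.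
  by module_eq k ('M[k]_2); ring.
have q0 : q = 0.
  apply: central_trace0 => // v; apply/eqP; rewrite -subr_eq0; apply/eqP.
  rewrite -(T' 1%:M v) !mulmx1 !mul1mx rE [(q - p) *m v]mulmxBl.
  by module_eq k ('M[k]_2); ring.
have r0 : r = 0 by rewrite rE p0 q0 subrr.
have rl i : rcoef (t i) = lcoef (t (i + 2)).
  case: (ord3P 0 i) => ->; rewrite !add0r.
  - by apply/eqP; rewrite -subr_eq0; apply/eqP.
  - have -> : 1 + 2 = 0 :> 'I_3 by apply/val_inj.
    by apply/esym/eqP; rewrite -subr_eq0; apply/eqP.
  have -> : 2 + 2 = 1 :> 'I_3 by apply/val_inj.
  by apply/esym/eqP; rewrite -subr_eq0; apply/eqP.
apply/ffunP => i; rewrite !ffunE -rl; by case: (so i).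
Qed.

Lemma lcoef_lr (a b : M2) : \tr b = 0 -> lcoef (lr_mul a b) = a.
Proof.
move=> tb; apply: mx2P; rewrite mxE sum2E !lr_mulE !sub2E !mul2E !mxE /=
  (trace0E tb); field; done.
Qed.

Lemma Qcoef_Qtriple (a : {ffun 'I_3 -> M2}) : (forall i, \tr (a i) = 0) ->
  Qcoef (Qtriple a) = a.
Proof. by move=> ta; apply/ffunP => i; rewrite !ffunE lcoef_lr. Qed.

Lemma lcoef_linear : linear lcoef.
Proof.
move=> c d e; apply/matrixP => i j; rewrite !mxE !sum2E.
by rewrite !add_lfunE !scale_lfunE !mxE; ring.
Qed.

Lemma Qtriple_linear : linear Qtriple.
Proof.
move=> c a b; apply/ffunP => i; apply/lfunP => x; rewrite !ffunE add_lfunE.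
rewrite scale_lfunE !lr_mulE !(mulmxDr, mulmxDl) -!scalemxAl -!scalemxAr.
by rewrite scalerBr opprD addrACA.
Qed.

Lemma scomm_lr (a b a' b' : M2) :
  scomm (lr_mul a b) (lr_mul a' b')
  = lr_mul (a *m a' - a' *m a) (b *m b' - b' *m b).
Proof.
apply/lfunP => x; rewrite (scomm_app _ (even_end _) (even_end _)) /sgn /= expr0 scale1r.
rewrite !lr_mulE !(mulmxBr, mulmxBl) !mulmxA.
by module_eq k ('M[k]_2); ring.
Qed.

Definition Qspread (i : 'I_3) (a0 a1 a2 : M2) : {ffun 'I_3 -> M2} :=
  [ffun j => if j == i then a0 else if j == i + 1 then a1 else a2].

Local Notation tq := (@t_triple k S4 false false).

Lemma sgnF : sgn false = 1 :> k. Proof. by []. Qed.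

Lemma t_Mat2 (x y : M2) :
  [/\ forall z : M2, tq x y 0 z = polar_det x z *: y - polar_det y z *: x,
      forall z : M2, tq x y 1 z = (2^-1 * polar_det x y) *: z
        - bar2 (bar2 y *m bar2 z) *m bar2 x &
      forall z : M2, tq x y 2 z = (2^-1 * polar_det x y) *: z
        - bar2 x *m bar2 (bar2 z *m bar2 y)].
Proof.
have sE (u v : M2) : @smul k S4 u v = bar2 u *m bar2 v := para_Mat2 u v.
split=> z; rewrite ffunE.
- rewrite (@sigmaE k S4 false false false x y z (memvf _)) /= !sgnF !mul1r.
  by [].
- rewrite [LHS](_ : _ = (2^-1 * polar_det x y) *: z
    - @rmul k S4 false x (@lmul k S4 y z)); last first.
    by rewrite add_lfunE opp_lfunE scale_lfunE id_lfunE comp_lfunE.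
  congr (_ - _); rewrite (@rmulE k S4 false false x _ (memvf _)) sgnF scale1r.
  by rewrite lmulE !sE.
rewrite [LHS](_ : _ = (2^-1 * polar_det x y) *: z
    - @lmul k S4 x (@rmul k S4 false y z)); last first.
  by rewrite add_lfunE opp_lfunE scale_lfunE id_lfunE comp_lfunE.
congr (_ - _); rewrite (@rmulE k S4 false false y _ (memvf _)) sgnF scale1r.
by rewrite lmulE !sE.
Qed.

Lemma Qspread_trace i a0 a1 a2 : \tr a0 = 0 -> \tr a1 = 0 -> \tr a2 = 0 ->
  forall j, \tr (Qspread i a0 a1 a2 j) = 0.
Proof. by move=> t0 t1 t2 j; rewrite ffunE; do 2?case: ifP. Qed.

(** The matrices of a triple are recovered from its three components; the lemmas
    below find them for x and y in k1 or of trace 0. *)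
Lemma theta_t_Mat2 (i : 'I_3) (x y a0 a1 a2 : M2) :
  (forall z : M2, tq x y 0 z = a0 *m z - z *m a2) ->
  (forall z : M2, tq x y 1 z = a1 *m z - z *m a0) ->
  (forall z : M2, tq x y 2 z = a2 *m z - z *m a1) ->
  iter i (@theta k S4) (tq x y) = Qtriple (Qspread i a0 a1 a2).
Proof.
move=> h0 h1 h2; have [e0 e1 e2] := theta_iterE i (tq x y).
have Q0 : Qspread i a0 a1 a2 i = a0 by rewrite ffunE eqxx.
have Q1 : Qspread i a0 a1 a2 (i + 1) = a1 by rewrite ffunE !ord3E.
have Q2 : Qspread i a0 a1 a2 (i + 2) = a2 by rewrite ffunE !ord3E.
apply/ffunP => j; case: (ord3P i j) => ->; apply/lfunP => z;
  [rewrite e0 | rewrite e1 | rewrite e2]; rewrite QtripleE ?ord3E ?Q0 ?Q1 ?Q2;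
  [exact: h0 | exact: h1 | exact: h2].
Qed.

Lemma half_if2 : (2^-1 : k) * 2 = 1. Proof. exact: mulV2. Qed.

Lemma scale2E c (A : M2) i j : (c *: A) i j = c * A i j. Proof. exact: mxE. Qed.
Lemma opp2E (A : M2) i j : (- A) i j = - A i j. Proof. exact: mxE. Qed.
Lemma one2E : [/\ (1%:M : M2) 0 0 = 1, (1%:M : M2) 0 1 = 0,
  (1%:M : M2) 1 0 = 0 & (1%:M : M2) 1 1 = 1].
Proof. by rewrite !mxE. Qed.

Lemma t_1b (i : 'I_3) b : \tr b = 0 ->
  iter i (@theta k S4) (tq (1%:M : M2) b) = Qtriple (Qspread i b 0 (- b)).
Proof.
move=> tb; have [h0 h1 h2] := t_Mat2 1%:M b; have [i0 i1 i2 i3] := one2E.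
have p1 : polar_det 1%:M b = 0.
  by rewrite polar2E i0 i1 i2 i3 (trace0E tb); ring.
apply: theta_t_Mat2 => z; rewrite ?h0 ?h1 ?h2.
- have [z0 z1 z2 z3] := bar2E z.
  apply: mx2P; rewrite !(sub2E, scale2E, mul2E, opp2E) !polar2E i0 i1 i2 i3
    (trace0E tb); ring.
- rewrite p1 mulr0 scale0r mul0mx bar2_1 mulmx1 bar2M !bar2K.
  by [].
rewrite p1 mulr0 scale0r mulmx0 bar2_1 mul1mx bar2M !bar2K mulNmx subr0 sub0r.
by [].
Qed.

Lemma t_b1 (i : 'I_3) b : \tr b = 0 ->
  iter i (@theta k S4) (tq b (1%:M : M2)) = Qtriple (Qspread i (- b) 0 b).
Proof.
move=> tb; have [h0 h1 h2] := t_Mat2 b 1%:M; have [i0 i1 i2 i3] := one2E.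
have p1 : polar_det b 1%:M = 0.
  by rewrite polar2E i0 i1 i2 i3 (trace0E tb); ring.
apply: theta_t_Mat2 => z; rewrite ?h0 ?h1 ?h2.
- apply: mx2P; rewrite !(sub2E, scale2E, mul2E, opp2E) !polar2E i0 i1 i2 i3
    (trace0E tb); ring.
- rewrite p1 mulr0 scale0r mul0mx bar2_1 mul1mx !bar2K (bar2_trace0 tb).
  by rewrite !mulmxN.
rewrite p1 mulr0 scale0r mulmx0 bar2_1 mulmx1 !bar2K (bar2_trace0 tb) mulNmx.
by rewrite sub0r opprK subr0.
Qed.

Lemma t_11 (i : 'I_3) : iter i (@theta k S4) (tq (1%:M : M2) (1%:M : M2))
  = Qtriple (Qspread i 0 0 0).
Proof.
have [h0 h1 h2] := t_Mat2 1%:M 1%:M; have [i0 i1 i2 i3] := one2E.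
have p1 : polar_det (1%:M : M2) 1%:M = 2.
  by rewrite polar2E i0 i1 i2 i3; ring.
apply: theta_t_Mat2 => z; rewrite ?h0 ?h1 ?h2 mul0mx mulmx0 subrr.
- by rewrite subrr.
- by rewrite p1 half_if2 bar2_1 mul1mx mulmx1 bar2K scale1r subrr.
by rewrite p1 half_if2 bar2_1 mul1mx mulmx1 bar2K scale1r subrr.
Qed.

Lemma t_ab (i : 'I_3) a b : \tr a = 0 -> \tr b = 0 ->
  iter i (@theta k S4) (tq a b)
  = Qtriple (Qspread i (2^-1 *: (a *m b - b *m a)) 0 (2^-1 *: (a *m b - b *m a))).
Proof.
move=> ta tb; have [h0 h1 h2] := t_Mat2 a b.
apply: theta_t_Mat2 => z; rewrite ?h0 ?h1 ?h2.
- apply: mx2P; rewrite !(sub2E, scale2E, mul2E) !polar2E !(trace0E ta) !(trace0E tb);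
    field; done.
- rewrite mul0mx bar2M !bar2K (bar2_trace0 ta).
  apply: mx2P; rewrite !(sub2E, scale2E, mul2E, opp2E) !polar2E !(trace0E ta) !(trace0E tb);
    rewrite ?mxE; field; done.
rewrite mulmx0 bar2M !bar2K (bar2_trace0 ta).
apply: mx2P; rewrite !(sub2E, scale2E, mul2E, opp2E) !polar2E !(trace0E ta) !(trace0E tb);
    rewrite ?mxE; field; done.
Qed.

End QuaternionTriality.

(** * Spanning sets of the two Lie superalgebras *)

Lemma lin_closedD (k : fieldType) (V : vectType k) (P : V -> Prop) x y :
  lin_closed P -> P x -> P y -> P (x + y).
Proof. by move=> [_ L] hx hy; rewrite -[x]scale1r; apply: L. Qed.

Section GInduction.
Variables (k : fieldType) (S S' : normed_superalgebra k).
Local Notation G := (g_superalgebra S S').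

Lemma iota_linear i : linear (@Defs.iota k S S' i).
Proof.
move=> a m n; congr (_, _); first by rewrite /= scaler0 addr0.
apply/ffunP => j; rewrite /= !ffunE.
by case: (j == i); rewrite ?scaler0 ?addr0.
Qed.

Lemma g_of_tri_linear : linear (@g_of_tri k S S').
Proof.
move=> a d e; congr (_, _); last by rewrite /= scaler0 addr0.
by congr (_, _); rewrite /= scaler0 addr0.
Qed.

Lemma g_of_tri'_linear : linear (@g_of_tri' k S S').
Proof.
move=> a d e; congr (_, _); last by rewrite /= scaler0 addr0.
by congr (_, _); rewrite /= scaler0 addr0.
Qed.

Lemma g_decomp (X : G) :
  X = g_of_tri S' X.1.1 + g_of_tri' S X.1.2 + \sum_i Defs.iota i (X.2 i).
Proof.
have s1 (F : 'I_3 -> G) : (\sum_i F i).1 = \sum_i (F i).1.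
  exact: (big_morph (fun Y : G => Y.1)).
have s2 (F : 'I_3 -> G) : (\sum_i F i).2 = \sum_i (F i).2.
  exact: (big_morph (fun Y : G => Y.2)).
case: X => [[d d'] m]; congr (_, _).
  by rewrite s1 big1 // addr0; congr (_, _); rewrite /= ?addr0 ?add0r.
rewrite s2 /= !add0r; apply/ffunP => j; rewrite sum_ffunE (bigD1 j) //= ffunE eqxx.
by rewrite big1 ?addr0 // => i ij; rewrite ffunE eq_sym (negPf ij).
Qed.

Lemma g_part_ind r (P : G -> Prop) : lin_closed P ->
    (forall d, d \in part (tri S) r -> P (g_of_tri S' d)) ->
    (forall d, d \in part (tri S') r -> P (g_of_tri' S d)) ->
    (forall i p q x y, p (+) q = r -> x \in part S p -> y \in part S' q ->
       P (Defs.iota i (tens x y))) ->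
  forall X, X \in part G r -> P X.
Proof.
move=> LP P1 P2 P3 X hX; have [h1 h2 h3] := g_ssP hX.
rewrite (g_decomp X); apply: (lin_closedD LP).
  by apply: (lin_closedD LP); [apply: P1 | apply: P2].
apply: big_ind => [|x y|i _]; [by case: LP | exact: lin_closedD|].
have hm := iffLR (mem_ffun_part _ _) h3 i.
move: (X.2 i) hm; apply: tens_part_ind; last exact: P3.
have L := @iota_linear i; split; first by rewrite (lin0 L); case: LP.
by move=> a x y hx hy; rewrite L; apply: (proj2 LP).
Qed.

Lemma g_ind (P : G -> Prop) : lin_closed P ->
    (forall r d, d \in part (tri S) r -> P (g_of_tri S' d)) ->
    (forall r d, d \in part (tri S') r -> P (g_of_tri' S d)) ->
    (forall i p q x y, x \in part S p -> y \in part S' q ->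
       P (Defs.iota i (tens x y))) ->
  forall X, P X.
Proof.
move=> LP P1 P2 P3 X; rewrite -[X]hcomp_sum.
apply: (lin_closedD LP); apply: g_part_ind (hcomp_in _ X) => //;
  by [apply: P1 | apply: P2 | move=> i p q x y _; apply: P3].
Qed.

End GInduction.

Section TKKInduction.
Variables (k : fieldType) (A : superalgebra k).
Local Notation T := (TKK A).

Lemma TKK_of_tens_linear : linear (@TKK_of_tens k A).
Proof. by move=> a m n; congr (_, _); rewrite /= scaler0 addr0. Qed.

Lemma TKK_of_der_linear : linear (@TKK_of_der k A).
Proof. by move=> a m n; congr (_, _); rewrite /= scaler0 addr0. Qed.

Lemma TKK_part_ind r (P : T -> Prop) : lin_closed P ->
    (forall a x, x \in part A r -> P (TKK_of_tens (tens a x))) ->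
    (forall d, d \in part (der A) r -> P (TKK_of_der d)) ->
  forall X, X \in part T r -> P X.
Proof.
move=> LP P1 P2 X /mem_dsum_part[h1 h2].
have -> : X = TKK_of_tens X.1 + TKK_of_der X.2.
  by case: X {h1 h2} => m d; congr (_, _); rewrite /= ?addr0 ?add0r.
apply: (lin_closedD LP); last exact: P2.
have [tl _] := @tens_bilin k (Q0 k) A.
move: (X.1) h1; apply: tens_part_ind.
  have L := TKK_of_tens_linear; split; first by rewrite (lin0 L); case: LP.
  by move=> a x y hx hy; rewrite L; apply: (proj2 LP).
move=> p q a x pq /even_memP[p0|->] hx; last first.
  by rewrite (lin0 (tl x)) (lin0 TKK_of_tens_linear); case: LP.
by apply: P1; rewrite -pq p0.
Qed.

Lemma TKK_ind (P : T -> Prop) : lin_closed P ->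
    (forall a p x, x \in part A p -> P (TKK_of_tens (tens a x))) ->
    (forall p d, d \in part (der A) p -> P (TKK_of_der d)) ->
  forall X, P X.
Proof.
move=> LP P1 P2 X; rewrite -[X]hcomp_sum.
apply: (lin_closedD LP); apply: TKK_part_ind (hcomp_in _ X) => //;
  by [move=> a x; apply: P1 | apply: P2].
Qed.

End TKKInduction.

Section SubVal.
Variables (k : fieldType) (V : vectType k) (W : bool -> {vspace V}).
Hypothesis capW : (W false :&: W true)%VS = 0%VS.

Lemma sub_val_inj : injective (@sub_val k V W capW).
Proof. exact: subvs_inj. Qed.

(** Linear on all of V, unlike the two homogeneous injections, with which it
    agrees on their domains. *)
Definition sub_of (x : V) : sub_ss capW := vsproj (W false + W true)%VS x.

Lemma sub_of_linear : linear sub_of.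
Proof. by move=> a x y; exact: linearP. Qed.

Lemma sub_ofE p x : x \in W p -> sub_of x = sub_in capW p x.
Proof.
move=> hx; apply: sub_val_inj; rewrite (sub_valE capW hx).
exact: (vsprojK (sub_W hx)).
Qed.

Lemma sub_of_val x : sub_of (sub_val x) = x.
Proof. exact: vsvalK. Qed.

Lemma sub_ofK p x : x \in W p -> sub_val (sub_of x) = x.
Proof. by move=> hx; apply: vsprojK (sub_W hx). Qed.

Lemma sub_of_part p x : x \in W p -> sub_of x \in part (sub_ss capW) p.
Proof. by move=> hx; rewrite (sub_ofE hx) sub_in_part. Qed.

End SubVal.

(** * The linear bijection *)

Lemma sum_only (V : nmodType) (J : finType) (i : J) (F : J -> V) :
  (forall j, j != i -> F j = 0) -> \sum_j F j = F i.
Proof. by move=> H; rewrite (bigD1 i) //= big1 ?addr0 // => j; apply: H. Qed.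

Section IsoMaps.
Variables (k : fieldType) (C : unital_normed_superalgebra k).
Local Notation M2 := 'M[k]_2.
Local Notation S4 := (para (Mat2 k)).
Local Notation S' := (para C).
Local Notation H := (H3 C).
Local Notation G := (g_superalgebra S4 S').
Local Notation T := (TKK H).
Local Notation E := (Ediag C).
Local Notation I := (@Ioff k C).
Local Notation iota := Defs.iota.

Definition q0 (m : M2) : Q0 k := vsproj (sl2 k) m.

Definition traceless (m : M2) : M2 := m - (2^-1 * \tr m)%:M.

Definition Dtri (d : tri_ss S') : der_ss H := sub_of (der_cap H) (DT (tri_val d)).

Definition Dinn (i : 'I_3) (x : C) : der_ss H := sub_of (der_cap H) (DI i x).

Definition f_tens (i : 'I_3) (m : tens_vect S4 S') : tens_ss (even_ss (Q0 k)) H :=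
  tlift (fun (c : M2) (x : C) => 2^-1 *: tens (q0 (traceless c)) (I i x)) m.

Definition f_der (i : 'I_3) (m : tens_vect S4 S') : der_ss H :=
  tlift (fun (c : M2) (x : C) => (2^-1 * \tr c) *: Dinn i x) m.

Definition f_diag (d : tri_ss S4) : tens_ss (even_ss (Q0 k)) H :=
  \sum_j tens (q0 (lcoef (tri_val d j))) (E (j + 2)).

(** The j-th copy of sl_2 in the triality algebra of the quaternions goes to
    Q^0 (x) E_(j+2), a triality triple of C to its derivation, and the element
    c (x) x of the i-th tensor product is split along c = c_0 + (tr c / 2) 1 into
    c_0 (x) I_i(x) / 2 and (tr c / 2) D_i(x). *)
Definition f_fun (X : G) : T :=
  (f_diag X.1.1 + \sum_i f_tens i (X.2 i), Dtri X.1.2 + \sum_i f_der i (X.2 i)).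

Lemma q0_linear : linear q0. Proof. by move=> a x y; exact: linearP. Qed.

Lemma traceless_linear : linear traceless.
Proof.
move=> a x y; rewrite /traceless linearP /= mulrDr raddfD /= mulrCA.
by rewrite -[(a * _)%:M]scale_scalar_mx scalerBr opprD addrACA.
Qed.

Lemma Dinn_linear i : linear (Dinn i).
Proof. exact: (linear_comp (@sub_of_linear _ _ _ _) (@DI_linear k C i)). Qed.

Lemma Dtri_linear : linear Dtri.
Proof.
apply: (linear_comp (@sub_of_linear _ _ _ _)).
exact: (linear_comp (@DT_linear k C) (@tri_val_linear k S')).
Qed.

Lemma f_tens_bilin i :
  bilin (fun (c : M2) (x : C) => 2^-1 *: tens (q0 (traceless c)) (I i x)).
Proof.
apply: bilin_scale; apply: (bilin_arg _ _ (@tens_bilin k (Q0 k) H)).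
  exact: (linear_comp q0_linear traceless_linear).
exact: Ioff_linear.
Qed.

Lemma half_trace_linear : linear (fun c : M2 => 2^-1 * \tr c : k^o).
Proof. by move=> a x y; rewrite linearP /= mulrDr mulrCA. Qed.

Lemma f_der_bilin i : bilin (fun (c : M2) (x : C) => (2^-1 * \tr c) *: Dinn i x).
Proof.
exact: (bilin_arg half_trace_linear (@Dinn_linear i) (@scale_bilin k (der_ss H))).
Qed.

Lemma f_diag_linear : linear f_diag.
Proof.
have [l _] := @tens_bilin k (Q0 k) H.
apply: linear_sum_fun => j; apply: (linear_comp (l (E (j + 2)))).
apply: (linear_comp q0_linear); apply: (linear_comp (@lcoef_linear k)).
exact: (linear_comp (@linear_app k _ _ j) (@tri_val_linear k S4)).
Qed.

Lemma f_fun_linear : linear f_fun.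
Proof.
have l1 := @linear_fst k (tri_ss S4 * tri_ss S')%type {ffun 'I_3 -> tens_vect S4 S'}.
have l2 := @linear_snd k (tri_ss S4 * tri_ss S')%type {ffun 'I_3 -> tens_vect S4 S'}.
have l11 := linear_comp (@linear_fst k (tri_ss S4) (tri_ss S')) l1.
have l12 := linear_comp (@linear_snd k (tri_ss S4) (tri_ss S')) l1.
have lA : linear (fun X : G => f_diag X.1.1 + \sum_i f_tens i (X.2 i)).
  apply: linear_add; first exact: (linear_comp f_diag_linear l11).
  apply: linear_sum_fun => i; apply: (linear_comp (tlift_linear _)).
  exact: (linear_comp (@linear_app k _ _ i) l2).
have lB : linear (fun X : G => Dtri X.1.2 + \sum_i f_der i (X.2 i)).
  apply: linear_add; first exact: (linear_comp Dtri_linear l12).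
  apply: linear_sum_fun => i; apply: (linear_comp (tlift_linear _)).
  exact: (linear_comp (@linear_app k _ _ i) l2).
by move=> a X Y; rewrite /f_fun lA lB.
Qed.

Lemma f_tri (d : tri_ss S4) : f_fun (g_of_tri S' d) = TKK_of_tens (f_diag d).
Proof.
congr (_, _).
  by rewrite big1 ?addr0 // => i _; rewrite ffunE; exact: (lin0 (tlift_linear _)).
rewrite big1 ?addr0 => [|i _]; first exact: (lin0 Dtri_linear).
by rewrite ffunE; exact: (lin0 (tlift_linear _)).
Qed.

Lemma f_tri' (d : tri_ss S') : f_fun (g_of_tri' S4 d) = TKK_of_der (Dtri d).
Proof.
congr (_, _).
  rewrite big1 ?addr0 => [|i _]; first exact: (lin0 f_diag_linear).
  by rewrite ffunE; exact: (lin0 (tlift_linear _)).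
by rewrite big1 ?addr0 // => i _; rewrite ffunE; exact: (lin0 (tlift_linear _)).
Qed.

Lemma f_iota i m : f_fun (iota i m) = (f_tens i m, f_der i m).
Proof.
have z1 j : j != i -> f_tens j ((iota i m).2 j) = 0.
  by move=> ji; rewrite ffunE (negPf ji); exact: (lin0 (tlift_linear _)).
have z2 j : j != i -> f_der j ((iota i m).2 j) = 0.
  by move=> ji; rewrite ffunE (negPf ji); exact: (lin0 (tlift_linear _)).
rewrite /f_fun (lin0 f_diag_linear) (lin0 Dtri_linear) !add0r.
by rewrite (sum_only z1) (sum_only z2) !ffunE eqxx.
Qed.

Hypothesis two0 : (2 : k) != 0.
Hypothesis scC : symmetric_composition (para C).
Hypothesis b11 : bform (un_one C) (un_one C) = 2.

Lemma q0K m : \tr m = 0 -> Q0_val (q0 m) = m.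
Proof. by move=> tm; apply: vsprojK; apply/mem_sl2. Qed.

Lemma Q0_valK (a : Q0 k) : q0 (Q0_val a) = a.
Proof. exact: vsvalK. Qed.

Lemma Q0_trace (a : Q0 k) : \tr (Q0_val a) = 0.
Proof. by apply/mem_sl2; exact: subvsP. Qed.

Lemma traceless0 m : \tr m = 0 -> traceless m = m.
Proof. by rewrite /traceless => ->; rewrite mulr0 raddf0 subr0. Qed.

Lemma traceless1 : traceless 1%:M = 0.
Proof. by rewrite /traceless mxtrace1 mulVf // subrr. Qed.

Lemma traceless_decomp m : m = traceless m + (2^-1 * \tr m) *: 1%:M.
Proof. by rewrite /traceless scalemx1 subrK. Qed.

Lemma traceless_trace m : \tr (traceless m) = 0.
Proof.
rewrite /traceless linearB /= mxtrace_scalar mulr2n -mulrDl.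
rewrite [2^-1 + _](_ : _ = 1) ?mul1r ?subrr //.
by rewrite -mulr2n -[LHS]mulr_natr mulVf.
Qed.

Lemma f_iota1 i (x : C) :
  f_fun (iota i (tens (1%:M : S4) (x : S'))) = TKK_of_der (Dinn i x).
Proof.
have [l _] := @tens_bilin k (Q0 k) H.
rewrite f_iota /f_tens /f_der (tlift_tens _ _ (f_tens_bilin i)).
rewrite (tlift_tens _ _ (f_der_bilin i)) traceless1 mxtrace1 mulVf // scale1r.
by rewrite (lin0 q0_linear) (lin0 (l _)) scaler0.
Qed.

Lemma f_iota0 i (a : M2) (x : C) : \tr a = 0 ->
  f_fun (iota i (tens (a : S4) (x : S'))) = TKK_of_tens (2^-1 *: tens (q0 a) (I i x)).
Proof.
move=> ta.
rewrite f_iota /f_tens /f_der (tlift_tens _ _ (f_tens_bilin i)).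
by rewrite (tlift_tens _ _ (f_der_bilin i)) traceless0 // ta mulr0 scale0r.
Qed.

Lemma DI_val i x : sub_val (Dinn i x) = DI i x.
Proof.
rewrite -[x]hcomp_sum (linD _ _ (@Dinn_linear i)) (linD _ _ (@sub_val_linear _ _ _ _)).
rewrite (linD _ _ (@DI_linear k C i)); congr (_ + _);
  by apply: sub_ofK; apply: (DI_der two0 scC b11); apply: hcomp_in.
Qed.

Lemma DT_val d : sub_val (Dtri d) = DT (tri_val d).
Proof.
rewrite -[d]hcomp_sum (linD _ _ Dtri_linear) (linD _ _ (@sub_val_linear _ _ _ _)).
rewrite (linD _ _ (@tri_val_linear k S')) (linD _ _ (@DT_linear k C)).
congr (_ + _); apply: sub_ofK; apply: (DT_der two0 scC b11);
  by apply: sub_val_in; apply: hcomp_in.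
Qed.

Lemma Dinn_part i p x : x \in part C p -> Dinn i x \in part (der_ss H) p.
Proof. by move=> hx; apply: sub_of_part; apply: DI_der. Qed.

Lemma Dtri_part p d : d \in part (tri_ss S') p -> Dtri d \in part (der_ss H) p.
Proof.
by move=> hd; apply: sub_of_part; apply: (DT_der two0 scC b11); apply: sub_val_in.
Qed.

Definition g_diag (m : tens_vect (Q0 k) H) : tri_ss S4 :=
  tlift (fun a h => @tri_in k S4 false
    (Qtriple [ffun j : 'I_3 => Ecoef (j + 2) h *: Q0_val a])) m.

Definition g_off (i : 'I_3) (m : tens_vect (Q0 k) H) : tens_vect S4 S' :=
  tlift (fun a h => 2 *: tens (Q0_val a : S4) (Icoef i h : S')) m.

(** The inverse reads off the Peirce coordinates of the elements of H_3(C) and the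
    components of a derivation along D_t and the D_i(C). *)
Definition g_fun (Y : T) : G :=
  ((g_diag Y.1, sub_of (tri_cap S') (dtrip (der_val Y.2))),
   [ffun i => g_off i Y.1 + tens (1%:M : S4) (dI i (der_val Y.2) : S')]).

Lemma g_diag_bilin : bilin (fun (a : Q0 k) (h : H) => @tri_in k S4 false
    (Qtriple [ffun j : 'I_3 => Ecoef (j + 2) h *: Q0_val a])).
Proof.
have lT : linear (fun a => @tri_in k S4 false (@Qtriple k a)).
  exact: (linear_comp (@tri_in_linear k S4 false) (@Qtriple_linear k)).
apply: (bilin_comp lT); apply: bilin_ffun => j; apply: bilin_flip.
exact: (bilin_arg (@Ecoef_linear k C (j + 2)) (@Q0_val_linear k) (@scale_bilin k _)).
Qed.

Lemma g_off_bilin i : bilin (fun (a : Q0 k) (h : H) =>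
  2 *: tens (Q0_val a : S4) (Icoef i h : S') : tens_vect S4 S').
Proof.
apply: bilin_scale.
exact: (bilin_arg (@Q0_val_linear k) (@Icoef_linear k C i) (@tens_bilin k S4 S')).
Qed.

Lemma g_fun_linear : linear g_fun.
Proof.
have lv := @sub_val_linear _ _ _ (der_cap H).
have [_ tr] := @tens_bilin k S4 S'.
move=> a X Y; congr (_, _).
  congr (_, _); first exact: (tlift_linear _).
  exact: (linear_comp (@sub_of_linear _ _ _ (tri_cap S'))
           (linear_comp (@dtrip_linear k C) lv)).
apply/ffunP => i; rewrite !ffunE.
exact: (linear_add (linear_comp (tlift_linear _) (@linear_fst k _ _))
  (linear_comp (tr _) (linear_comp (@dI_linear k C i)
     (linear_comp lv (@linear_snd k _ _))))).
Qed.

Lemma dI0 i : dI i (0 : 'End(H)) = 0. Proof. exact: (lin0 (@dI_linear k C i)). Qed.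

Lemma g_tens a h : g_fun (TKK_of_tens (tens a h)) =
  ((@tri_in k S4 false (Qtriple [ffun j : 'I_3 => Ecoef (j + 2) h *: Q0_val a]), 0),
   [ffun i => 2 *: tens (Q0_val a : S4) (Icoef i h : S')]).
Proof.
have [_ tr] := @tens_bilin k S4 S'.
have v0 : der_val (TKK_of_tens (tens a h)).2 = 0.
  exact: (lin0 (@sub_val_linear _ _ _ (der_cap H))).
rewrite /g_fun v0; congr (_, _, _); first exact: (tlift_tens _ _ g_diag_bilin).
  by rewrite (lin0 (@dtrip_linear k C)); exact: (lin0 (@sub_of_linear _ _ _ (tri_cap S'))).
apply/ffunP => i; rewrite !ffunE /g_off (tlift_tens _ _ (g_off_bilin i)) dI0.
by rewrite (lin0 (tr _)) addr0.
Qed.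

Lemma g_der d : g_fun (TKK_of_der d) =
  ((0, sub_of (tri_cap S') (dtrip (der_val d))),
   [ffun i => tens (1%:M : S4) (dI i (der_val d) : S')]).
Proof.
congr (_, _, _); first exact: (lin0 (tlift_linear _)).
by apply/ffunP => i; rewrite !ffunE /g_off (lin0 (tlift_linear _)) add0r.
Qed.

Lemma g_part_even p d : d \in part (tri_ss S4) p -> p = false \/ d = 0.
Proof.
case: p => hd; [right | by left]; apply: sub_val_inj.
rewrite (lin0 (@sub_val_linear _ _ _ _)).
have [ho _] := iffLR (mem_tri _ _) (sub_val_in hd).
apply/ffunP => i; apply/lfunP => x; rewrite ffunE zero_lfunE.
have [/mem_end_part he _] := iffLR (mem_osp _ _) (ho i).
have : sub_val d i x \in part S4 true by exact: (he false x (memvf _)).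
by rewrite memv0 => /eqP.
Qed.

Lemma tri_Qcoef d : d \in part (tri_ss S4) false ->
  (forall j, \tr (lcoef (tri_val d j)) = 0) /\
  d = @tri_in k S4 false (Qtriple [ffun j => lcoef (tri_val d j)]).
Proof.
move=> hd; have [tt te] := tri_Qtriple two0 (sub_val_in hd); split.
  by move=> j; have := tt j; rewrite ffunE.
apply: sub_val_inj; rewrite /tri_in sub_valE; first exact: te.
by apply: Qtriple_tri => j; have := tt j; rewrite ffunE.
Qed.

Lemma g_tens_E a j : g_fun (TKK_of_tens (tens a (E j))) =
  g_of_tri S' (@tri_in k S4 false
    (Qtriple [ffun l : 'I_3 => (l + 2 == j)%:R *: Q0_val a])).
Proof.
have [_ tr] := @tens_bilin k S4 S'.
rewrite g_tens; congr (_, _, _).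
  congr (@tri_in k S4 false (@Qtriple k _)); apply/ffunP => l.
  by rewrite !ffunE (Ecoef_diag two0 b11).
by apply/ffunP => i; rewrite !ffunE (Icoef_diag b11) (lin0 (tr _)) scaler0.
Qed.

Lemma g_tens_I a j x : g_fun (TKK_of_tens (tens a (I j x))) =
  iota j (2 *: tens (Q0_val a : S4) (x : S')).
Proof.
have [_ tr] := @tens_bilin k S4 S'.
rewrite g_tens; congr (_, _, _).
  rewrite [X in Qtriple X](_ : _ = 0) ?(lin0 (@Qtriple_linear k)).
    exact: (lin0 (@tri_in_linear k S4 false)).
  by apply/ffunP => l; rewrite !ffunE (Ecoef_off b11) scale0r.
apply/ffunP => i; rewrite !ffunE (Icoef_off two0 b11).
by case: (i == j); rewrite // (lin0 (tr _)) scaler0.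
Qed.

Lemma f_funK_tri d : d \in part (tri_ss S4) false ->
  g_fun (f_fun (g_of_tri S' d)) = g_of_tri S' d.
Proof.
move=> /tri_Qcoef[tt de]; rewrite f_tri /f_diag.
have L1 := linear_comp g_fun_linear (@TKK_of_tens_linear k H).
have L2 : linear (fun a => g_of_tri S' (@tri_in k S4 false (@Qtriple k a))).
  apply: (linear_comp (@g_of_tri_linear k S4 S')).
  exact: (linear_comp (@tri_in_linear k S4 false) (@Qtriple_linear k)).
rewrite (lin_sum _ _ _ L1); under eq_bigr => j _ do rewrite g_tens_E q0K //.
rewrite -(lin_sum _ _ _ L2) [in RHS]de.
congr (@g_of_tri k S4 S' (@tri_in k S4 false (@Qtriple k _))).
apply/ffunP => l; rewrite sum_ffunE (sum_only (i := l)) => [|j jl]; rewrite !ffunE.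
  by rewrite eqxx scale1r.
by rewrite (inj_eq (addIr 2)) eq_sym (negPf jl) scale0r.
Qed.

Lemma f_funK_tri' d : g_fun (f_fun (g_of_tri' S4 d)) = g_of_tri' S4 d.
Proof.
have [_ tr] := @tens_bilin k S4 S'.
rewrite f_tri' g_der [der_val _]DT_val (dtrip_DT two0 b11) /g_of_tri'.
rewrite [sub_of _ _]sub_of_val; congr (_, _).
by apply/ffunP => i; rewrite !ffunE (dI_DT b11) (lin0 (tr _)).
Qed.

Lemma f_funK_iota i (c : M2) (x : C) :
  g_fun (f_fun (iota i (tens (c : S4) (x : S')))) = iota i (tens (c : S4) (x : S')).
Proof.
have [tl tr] := @tens_bilin k S4 S'.
have L1 := linear_comp (linear_comp g_fun_linear f_fun_linear)
  (linear_comp (@iota_linear k S4 S' i) (tl x)).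
have L2 := linear_comp (@iota_linear k S4 S' i) (tl x).
rewrite [c]traceless_decomp addrC (L1 _ 1%:M) (L2 _ 1%:M); congr (_ *: _ + _).
  rewrite f_iota1 g_der [der_val _]DI_val (dtrip_DI two0 b11).
  rewrite [sub_of _ _](lin0 (@sub_of_linear _ _ _ (tri_cap S'))); congr (_, _).
  by apply/ffunP => j; rewrite !ffunE (dI_DI two0 b11); case: eqP => // _; exact: (lin0 (tr _)).
have L3 := linear_comp g_fun_linear (@TKK_of_tens_linear k H).
rewrite (f_iota0 _ _ (traceless_trace c)) (linZ _ _ L3) g_tens_I.
rewrite (linZ _ _ (@iota_linear k S4 S' i)) scalerA mulVf // scale1r.
by rewrite (q0K (traceless_trace c)).
Qed.

Lemma f_funK : cancel f_fun g_fun.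
Proof.
have lc : linear (fun X : G => g_fun (f_fun X)) := linear_comp g_fun_linear f_fun_linear.
apply: g_ind.
- exact: (lin_closed_eq lc (@linear_id k G)).
- move=> p d hd; case: (g_part_even hd) => [p0|->].
    by apply: f_funK_tri; rewrite -p0.
  by rewrite (lin0 (@g_of_tri_linear k S4 S')) (lin0 f_fun_linear) (lin0 g_fun_linear).
- by move=> p d _; apply: f_funK_tri'.
by move=> i p q x y _ _; apply: f_funK_iota.
Qed.

Lemma f_diag_Q (b : {ffun 'I_3 -> M2}) : (forall j, \tr (b j) = 0) ->
  f_diag (@tri_in k S4 false (Qtriple b)) = \sum_j tens (q0 (b j)) (E (j + 2)).
Proof.
move=> tb; apply: eq_bigr => j _; congr (tens (q0 _) _).
rewrite /tri_val /tri_in sub_valE; last exact: Qtriple_tri.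
by have := congr1 (fun f : {ffun 'I_3 -> M2} => f j) (Qcoef_Qtriple two0 tb); rewrite ffunE.
Qed.

Lemma g_funK : cancel g_fun f_fun.
Proof.
have [tl tr] := @tens_bilin k (Q0 k) H; have [_ tr'] := @tens_bilin k S4 S'.
have lc : linear (fun Y : T => f_fun (g_fun Y)) := linear_comp f_fun_linear g_fun_linear.
have lt a := linear_comp (@TKK_of_tens_linear k H) (tr a).
apply: TKK_ind.
- exact: (lin_closed_eq lc (@linear_id k T)).
- move=> a p h; move: h; apply: (H3_part_ind two0 b11).
  + exact: (lin_closed_eq (linear_comp lc (lt a)) (lt a)).
  + move=> j _; rewrite g_tens_E f_tri f_diag_Q => [|l]; last first.
      by rewrite ffunE mxtraceZ Q0_trace mulr0.
    congr TKK_of_tens; rewrite (sum_only (i := j + 1)) => [|l lj]; rewrite ffunE.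
      by rewrite !ord3E scale1r Q0_valK.
    rewrite [l + 2 == j](_ : _ = false) ?scale0r ?(lin0 q0_linear) ?(lin0 (tl _)) //.
    apply: contra_neqF lj => /eqP <-; rewrite -addrA.
    by rewrite [2 + 1](_ : _ = 0) ?addr0 //; apply/val_inj.
  move=> j x _; rewrite g_tens_I.
  have L := linear_comp f_fun_linear (@iota_linear k S4 S' j).
  rewrite (linZ _ _ L) (f_iota0 _ _ (Q0_trace a)) Q0_valK.
  by rewrite (linZ _ _ (@TKK_of_tens_linear k H)) scalerA divff // scale1r.
move=> p d /sub_val_in hd; have [hx ht e] := der_split two0 scC b11 hd.
have gE : g_fun (TKK_of_der d) = g_of_tri' S4 (sub_of (tri_cap S') (dtrip (der_val d)))
    + \sum_i iota i (tens (1%:M : S4) (dI i (der_val d) : S')).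
  rewrite g_der [LHS]g_decomp (lin0 (@g_of_tri_linear k S4 S')) add0r.
  by congr (_ + _); apply: eq_bigr => i _; rewrite ffunE.
rewrite gE (linD _ _ f_fun_linear) (lin_sum _ _ _ f_fun_linear) f_tri'.
under eq_bigr => i _ do rewrite f_iota1.
rewrite -(lin_sum _ _ _ (@TKK_of_der_linear k H)) -(linD _ _ (@TKK_of_der_linear k H)).
congr TKK_of_der; apply: sub_val_inj.
have lv := @sub_val_linear _ _ _ (der_cap H).
rewrite (linD _ _ lv) (lin_sum _ _ _ lv) DT_val [RHS]e; congr (DT _ + _).
  exact: sub_ofK ht.
by apply: eq_bigr => i _; rewrite DI_val.
Qed.

Lemma f_fun_part p X : X \in part G p -> f_fun X \in part T p.
Proof.
move: X; apply: g_part_ind.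
- split=> [|a x y hx hy]; first by rewrite (lin0 f_fun_linear) mem0v.
  by rewrite f_fun_linear rpredD ?rpredZ.
- move=> d hd; case: (g_part_even hd) => [p0|->]; last first.
    by rewrite (lin0 (@g_of_tri_linear k S4 S')) (lin0 f_fun_linear) mem0v.
  rewrite f_tri; apply: TKK_of_tens_part; apply: memv_suml => j _; rewrite p0.
  exact: (@tens_in k (even_ss (Q0 k)) H false false _ _ (even_mem _) (Ediag_part C _)).
- by move=> d hd; rewrite f_tri'; apply: TKK_of_der_part; apply: Dtri_part.
move=> i q r c x qr hc hx; case: (even_memP hc) => [q0E|->]; last first.
  have [tl _] := @tens_bilin k S4 S'.
  by rewrite (lin0 (tl _)) (lin0 (@iota_linear _ _ _ _)) (lin0 f_fun_linear) mem0v.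
have hxp : x \in part C p by rewrite -qr q0E.
have [tl tr] := @tens_bilin k S4 S'.
have L := linear_comp f_fun_linear (linear_comp (@iota_linear k S4 S' i) (tl x)).
rewrite [c]traceless_decomp addrC (L _ 1%:M); apply: rpredD.
  apply: rpredZ; rewrite f_iota1; apply: TKK_of_der_part; exact: Dinn_part.
rewrite (f_iota0 _ _ (traceless_trace _)); apply/TKK_of_tens_part/memvZ.
exact: (@tens_in k (even_ss (Q0 k)) H false p _ _ (even_mem _) (Ioff_part b11 i hxp)).
Qed.

End IsoMaps.

(** * Superanticommutativity *)

Section Anticommutativity.
Variables (k : fieldType).

Lemma scomm_anti (U : superspace k) p q (d e : 'End(U)) :
  d \in end_part U p -> e \in end_part U q ->
  scomm e d = - (sgn (p && q) *: scomm d e).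
Proof.
move=> hd he; rewrite (scommE hd he) (scommE he hd) andbC scalerBr scalerA sgn_sq.
by rewrite scale1r opprB.
Qed.

Lemma sskew_anti (U V : superspace k) (f : U -> U -> V) p q x y : bilin f ->
  x \in part U p -> y \in part U q ->
  sskew f y x = - (sgn (p && q) *: sskew f x y).
Proof.
move=> bf hx hy; rewrite (sskewE bf hx hy) (sskewE bf hy hx) andbC scalerBr.
by rewrite scalerA sgn_sq scale1r opprB.
Qed.

Variable A : superalgebra k.
Hypothesis comA : forall p q (x y : A), x \in part A p -> y \in part A q ->
  smul x y = sgn (p && q) *: smul y x.

Lemma der_smul_val p q (d e : der A) : d \in part (der A) p -> e \in part (der A) q ->
  der_val (smul d e) = scomm (der_val d) (der_val e).
Proof.
move=> hd he; rewrite /smul /= /der_br (sext2E (@der_br_aux k A) hd he).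
by apply: sub_valE; apply: scomm_der; apply: sub_val_in.
Qed.

Lemma der_anti p q (d e : der A) : d \in part (der A) p -> e \in part (der A) q ->
  smul e d = - (sgn (p && q) *: smul d e).
Proof.
move=> hd he; apply: sub_val_inj; have lv := @sub_val_linear _ _ _ (der_cap A).
rewrite -scaleN1r (linZ _ _ lv) (linZ _ _ lv) scaleN1r.
rewrite [LHS](der_smul_val he hd) [sub_val (smul d e)](der_smul_val hd he).
by apply: scomm_anti; apply: der_end; apply: sub_val_in.
Qed.

Lemma TKK_tens_der p q a x d : x \in part A p -> d \in part (der A) q ->
  smul (TKK_of_tens (tens a x)) (TKK_of_der d)
  = - (sgn (p && q) *: TKK_of_tens (tens a (der_val d x))).
Proof.
move=> hx hd.
have hm : tens a x \in part (tens_ss (even_ss (Q0 k)) A) p.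
  exact: (@tens_in k (even_ss (Q0 k)) A false p a x (even_mem a) hx).
rewrite -(TKK_der_tens a hd hx) /smul /= /TKK_br.
have hX := TKK_of_tens_part hm; have hY := TKK_of_der_part hd.
rewrite (sskew_anti (@TKK_skew_bilin k A) hY hX) [q && p]andbC.
have [dl dr] := der_br_bilin A.
have z1 m : TKK_mul (m : tens_vect (Q0 k) A) 0 = 0 by exact: tens_ext2_0r.
have z2 m : TKK_mul 0 (m : tens_vect (Q0 k) A) = 0 by exact: tens_ext2_0l.
have z3 m : TKK_der (m : tens_vect (Q0 k) A) 0 = 0 by exact: tens_ext2_0r.
have z4 m : TKK_der 0 (m : tens_vect (Q0 k) A) = 0 by exact: tens_ext2_0l.
rewrite /= z1 z2 z3 z4 (lin0 (dl _)) (lin0 (dr _)) !add0r.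
by congr (_, _); rewrite /= scaler0 oppr0.
Qed.

Lemma Q0_br_anti (a b : Q0 k) : Q0_br b a = - Q0_br a b.
Proof.
apply: subvs_inj; rewrite [LHS]Q0_brE linearN /=.
by rewrite -[vsval _]/(Q0_val _) Q0_brE opprB.
Qed.

Lemma inner_der_anti p q (x y : A) : x \in part A p -> y \in part A q ->
  inner_der q p y x = - (sgn (p && q) *: inner_der p q x y).
Proof.
move=> hx hy; have L := @sub_in_linear _ _ _ (der_cap A) (p (+) q).
rewrite /inner_der /der_in (scomm_anti (lmul_part hx) (lmul_part hy)) addbC.
by rewrite -scaleN1r !(linZ _ _ L) scaleN1r.
Qed.

Lemma TKK_anti p q (X Y : TKK A) : X \in part (TKK A) p -> Y \in part (TKK A) q ->
  smul Y X = - (sgn (p && q) *: smul X Y).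
Proof.
have [l r] := smul_bilin (TKK A).
have [tl tr] := @tens_bilin k (Q0 k) A.
have lt := @TKK_of_tens_linear k A; have ld := @TKK_of_der_linear k A.
have cl (V W : vectType k) (c : k) (f : V -> W) : linear f ->
    linear (fun v => - (c *: f v)).
  by move=> lf a u v; rewrite lf scalerDr opprD scalerA mulrC -scalerA scalerN.
move=> hX hY; move: X hX; apply: TKK_part_ind.
- by apply: lin_closed_eq; [exact: r | apply: cl; exact: l].
- move=> a x hx; move: Y hY; apply: TKK_part_ind.
  + by apply: lin_closed_eq; [exact: l | apply: cl; exact: r].
  + move=> b y hy; rewrite !(TKK_tens_tens _ _ hx hy) !(TKK_tens_tens _ _ hy hx).
    rewrite (inner_der_anti hx hy) polar_detC (comA hy hx) andbC Q0_br_anti.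
    rewrite (linZ _ _ (tr _)) -[- Q0_br a b]scaleN1r (linZ _ _ (tl _)) !(linZ _ _ lt).
    rewrite -[- (sgn (p && q) *: inner_der _ _ _ _)]scaleN1r !(linZ _ _ ld).
    module_eq k (TKK A); ring.
  move=> d hd; rewrite (TKK_der_tens a hd hx) (TKK_tens_der a hx hd).
  by rewrite scalerN opprK scalerA sgn_sq scale1r.
move=> d hd; move: Y hY; apply: TKK_part_ind.
- by apply: lin_closed_eq; [exact: l | apply: cl; exact: r].
- by move=> a x hx; rewrite (TKK_der_tens a hd hx) (TKK_tens_der a hx hd) andbC.
move=> e he; rewrite (TKK_der_der hd he) (TKK_der_der he hd) (der_anti hd he).
by rewrite -scaleN1r !(linZ _ _ ld) scaleN1r.
Qed.

End Anticommutativity.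

Section GAnti.
Variables (k : fieldType) (S S' : normed_superalgebra k).
Local Notation G := (g_superalgebra S S').

Lemma tri_br_anti (S0 : normed_superalgebra k) p q (d e : tri_ss S0) :
  d \in part (tri_ss S0) p -> e \in part (tri_ss S0) q ->
  tri_br e d = - (sgn (p && q) *: tri_br d e).
Proof.
move=> hd he; have L := @tri_in_linear k S0 (p (+) q).
rewrite /tri_br (sext2E (@tri_br_aux k S0) hd he) (sext2E (@tri_br_aux k S0) he hd).
rewrite [q (+) p]addbC -(linZ _ _ L) -scaleN1r -(linZ _ _ L) scaleN1r.
congr (tri_in _ _); apply/ffunP => i; rewrite !ffunE.
exact: (scomm_anti (tri_val_part i hd) (tri_val_part i he)).
Qed.

(** The mixed terms of the bracket are antisymmetrized by construction and those
    within the triality algebras are supercommutators; there remain the two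
    terms with values in the triality algebras, which vanish on the pairs of
    elements below. *)
Lemma g_anti p q (X Y : G) : X \in part G p -> Y \in part G q ->
    g_tri X.2 Y.2 = 0 -> g_tri Y.2 X.2 = 0 ->
    g_tri' X.2 Y.2 = 0 -> g_tri' Y.2 X.2 = 0 ->
  smul Y X = - (sgn (p && q) *: smul X Y).
Proof.
move=> hX hY t1 t2 t3 t4; rewrite /smul /= /g_br t1 t2 t3 t4 !addr0.
have [X1 X2 _] := g_ssP hX; have [Y1 Y2 _] := g_ssP hY.
rewrite (tri_br_anti X1 Y1) (tri_br_anti X2 Y2).
rewrite (sskew_anti _ hX hY) //.
pose f1 := @linear_fst k (tri_ss S * tri_ss S')%type {ffun 'I_3 -> tens_vect S S'}.
pose f2 := @linear_snd k (tri_ss S * tri_ss S')%type {ffun 'I_3 -> tens_vect S S'}.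
pose f11 := linear_comp (@linear_fst k (tri_ss S) (tri_ss S')) f1.
pose f12 := linear_comp (@linear_snd k (tri_ss S) (tri_ss S')) f1.
apply: bilin_add; last exact: (bilin_arg f2 f2 (@g_mul_bilin k S S')).
apply: bilin_add; first exact: (bilin_arg f11 f2 (@g_act_bilin k S S')).
exact: (bilin_arg f12 f2 (@g_act'_bilin k S S')).
Qed.

Lemma g_anti0 p q (X Y : G) : X \in part G p -> Y \in part G q -> X.2 = 0 ->
  smul Y X = - (sgn (p && q) *: smul X Y).
Proof.
move=> hX hY X0; apply: (g_anti hX hY); rewrite X0.
- by have [l _] := @g_tri_bilin k S S'; exact: (lin0 (l _)).
- by have [_ r] := @g_tri_bilin k S S'; exact: (lin0 (r _)).
- by have [l _] := @g_tri'_bilin k S S'; exact: (lin0 (l _)).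
by have [_ r] := @g_tri'_bilin k S S'; exact: (lin0 (r _)).
Qed.

Lemma g_anti_iota p q i m n :
  m \in part (tens_ss S S') p -> n \in part (tens_ss S S') q ->
  smul (Defs.iota (i + 1) n) (Defs.iota i m)
  = - (sgn (p && q) *: smul (Defs.iota i m) (Defs.iota (i + 1) n)).
Proof.
move=> hm hn; have ne (j : 'I_3) : (j == j + 1) = false by rewrite ord3E.
apply: (g_anti (iota_part i hm) (iota_part _ hn));
  rewrite /g_tri /g_tri' big1 // => j _; rewrite !ffunE;
  case: (eqVneq j i) => [->|_]; rewrite ?ne ?tens_ext2_0l ?tens_ext2_0r //.
Qed.

End GAnti.

(** * Brackets of generators *)

Lemma linN (k : fieldType) (U V : lmodType k) (f : U -> V) x :
  linear f -> f (- x) = - f x.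
Proof. by move=> lf; rewrite -scaleN1r (linZ _ _ lf) scaleN1r. Qed.

Lemma linB (k : fieldType) (U V : lmodType k) (f : U -> V) x y :
  linear f -> f (x - y) = f x - f y.
Proof. by move=> lf; rewrite (linD _ _ lf) (linN _ lf). Qed.

Section Morphism.
Variables (k : fieldType) (C : unital_normed_superalgebra k).
Local Notation M2 := 'M[k]_2.
Local Notation S4 := (para (Mat2 k)).
Local Notation S' := (para C).
Local Notation H := (H3 C).
Local Notation G := (g_superalgebra S4 S').
Local Notation T := (TKK H).
Local Notation E := (Ediag C).
Local Notation I := (@Ioff k C).
Local Notation iota := Defs.iota.
Local Notation f := (@f_fun k C).
Local Notation Dinn := (@Dinn k C).
Local Notation "x ** y" := (@para_mul k C x y) (at level 40).

Hypothesis two0 : (2 : k) != 0.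
Hypothesis scC : symmetric_composition (para C).
Hypothesis b11 : bform (un_one C) (un_one C) = 2.

Definition Qdelta (j : 'I_3) (a : M2) : {ffun 'I_3 -> M2} :=
  [ffun l => if l == j then a else 0].

(** Together with the triality triples of C, the following elements span. The unit
    of the quaternions is kept apart from the traceless ones since it is sent to
    derivations and these to Q^0 (x) H_3(C). *)
Definition gA (j : 'I_3) (a : M2) : G :=
  g_of_tri S' (@tri_in k S4 false (Qtriple (Qdelta j a))).
Definition gC (i : 'I_3) (x : C) : G := iota i (tens (1%:M : S4) (x : S')).
Definition gD (i : 'I_3) (a : M2) (x : C) : G := iota i (tens (a : S4) (x : S')).

Lemma Qdelta_trace j a : \tr a = 0 -> forall l, \tr (Qdelta j a l) = 0.
Proof. by move=> ta l; rewrite ffunE; case: ifP; rewrite ?mxtrace0. Qed.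

Lemma gA_part j a : gA j a \in part G false.
Proof. by apply: g_of_tri_part; exact: sub_in_part. Qed.

Lemma gC_part i p x : x \in part C p -> gC i x \in part G p.
Proof.
move=> hx; apply: iota_part.
exact: (@tens_in k S4 S' false p _ _ (even_mem _) hx).
Qed.

Lemma gD_part i p a x : x \in part C p -> gD i a x \in part G p.
Proof.
move=> hx; apply: iota_part.
exact: (@tens_in k S4 S' false p _ _ (even_mem _) hx).
Qed.

Lemma gen_ind (P : G -> Prop) : lin_closed P ->
    (forall j a, \tr a = 0 -> P (gA j a)) ->
    (forall p d, d \in part (tri S') p -> P (g_of_tri' S4 d)) ->
    (forall i p x, x \in part C p -> P (gC i x)) ->
    (forall i p a x, \tr a = 0 -> x \in part C p -> P (gD i a x)) ->
  forall X, P X.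
Proof.
move=> LP PA PB PC PD; apply: g_ind => // [p d hd|i p q c x hc hx].
  case: (g_part_even hd) => [p0|->]; last first.
    by rewrite (lin0 (@g_of_tri_linear k S4 S')); case: LP.
  rewrite p0 in hd; have [tt ->] := tri_Qcoef two0 hd.
  have L : linear (fun a => g_of_tri S' (@tri_in k S4 false (@Qtriple k a))).
    apply: (linear_comp (@g_of_tri_linear k S4 S')).
    exact: (linear_comp (@tri_in_linear k S4 false) (@Qtriple_linear k)).
  rewrite [X in Qtriple X](_ : _ = \sum_j Qdelta j (lcoef (tri_val d j))).
    rewrite (lin_sum _ _ _ L); apply: big_ind => [|X Y|j _]; first by case: LP.
      exact: lin_closedD.
    exact: PA.
  apply/ffunP => l; rewrite sum_ffunE (sum_only (i := l)) => [|j jl]; rewrite !ffunE.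
    by rewrite eqxx.
  by rewrite eq_sym (negPf jl).
have [tl tr] := @tens_bilin k S4 S'.
have L := linear_comp (@iota_linear k S4 S' i) (tl x).
rewrite [c]traceless_decomp addrC (L _ 1%:M); apply: (proj2 LP).
  exact: PC hx.
by apply: (PD _ _ _ _ _ hx); apply: traceless_trace.
Qed.

Lemma f_gA j a : \tr a = 0 -> f (gA j a) = TKK_of_tens (tens (q0 a) (E (j + 2))).
Proof.
move=> ta; have [tl _] := @tens_bilin k (Q0 k) H.
rewrite /gA f_tri (f_diag_Q C two0 (Qdelta_trace j ta)); congr TKK_of_tens.
rewrite (sum_only (i := j)) => [|l lj]; rewrite ffunE ?eqxx //.
by rewrite (negPf lj) (lin0 (@q0_linear k)) (lin0 (tl _)).
Qed.

Lemma f_gB d : f (g_of_tri' S4 d) = TKK_of_der (Dtri d).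
Proof. exact: f_tri'. Qed.

Lemma f_gC i x : f (gC i x) = TKK_of_der (Dinn i x).
Proof. exact: (f_iota1 two0). Qed.

Lemma f_gD i a x : \tr a = 0 ->
  f (gD i a x) = 2^-1 *: TKK_of_tens (tens (q0 a) (I i x)).
Proof.
by move=> ta; rewrite /gD (f_iota0 i x ta) (linZ _ _ (@TKK_of_tens_linear k H)).
Qed.

Lemma f_gen i (c : M2) x : f (gD i c x) =
  2^-1 *: TKK_of_tens (tens (q0 (traceless c)) (I i x))
  + (2^-1 * \tr c) *: TKK_of_der (Dinn i x).
Proof.
have [tl tr] := @tens_bilin k S4 S'.
have L := linear_comp (@f_fun_linear k C) (linear_comp (@iota_linear k S4 S' i) (tl x)).
rewrite /gD {1}[c]traceless_decomp addrC (L _ 1%:M) addrC.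
congr (_ + _ *: _); first exact: (f_gD i x (traceless_trace two0 c)).
exact: f_gC.
Qed.

Let hE i := Ediag_part C i.
Let hI i p x (hx : x \in part C p) := Ioff_part b11 i hx.

Lemma der_in_Dinn p i x : x \in part C p -> @der_in k H p (DI i x) = Dinn i x.
Proof. by move=> hx; rewrite /Dinn (sub_ofE (der_cap H) (DI_der two0 scC b11 i hx)). Qed.

Lemma inner_EE i j : inner_der false false (E i) (E j) = 0.
Proof.
rewrite /inner_der (scomm_LE_LE two0 b11).
exact: (lin0 (@sub_in_linear _ _ _ (der_cap H) _)).
Qed.

Lemma inner_EI p i x : x \in part C p ->
  [/\ inner_der false p (E i) (I i x) = 0,
      inner_der false p (E (i + 1)) (I i x) = - (2^-1 *: Dinn i x)
    & inner_der false p (E (i + 2)) (I i x) = 2^-1 *: Dinn i x].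
Proof.
move=> hx; have L := @sub_in_linear _ _ _ (der_cap H) p.
have [s0 s1 s2] := scomm_LE_LI two0 scC b11 i hx.
rewrite /inner_der s0 s1 s2 /= -[- (_ *: DI i x)]scaleN1r /der_in !(linZ _ _ L) (lin0 L).
by rewrite -/(@der_in k H p _) (der_in_Dinn i hx) scaleN1r.
Qed.

Lemma inner_II_succ p q i x y : x \in part C p -> y \in part C q ->
  inner_der p q (I i x) (I (i + 1) y) = Dinn (i + 2) (x ** y).
Proof.
move=> hx hy; rewrite /inner_der (scomm_LI_LI_succ two0 scC b11 i hx hy).
exact: der_in_Dinn (pm_part hx hy).
Qed.

(** The term theta^i(t_{x,y}) of the bracket of two elements of the i-th tensor
    product. *)
Definition tri_t p q i (x y : C) : tri_ss S' :=
  @tri_in k S' (p (+) q) (shift_triple i (ttriple p q x y)).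

Lemma tri_t_val p q i x y : x \in part C p -> y \in part C q ->
  sub_val (Dtri (tri_t p q i x y)) = DT (shift_triple i (ttriple p q x y)).
Proof.
move=> hx hy; rewrite (DT_val two0 scC b11); congr (DT _).
by apply: sub_valE; apply: (shift_ttriple_tri two0 scC b11).
Qed.

Lemma inner_II_same p q i x y : x \in part C p -> y \in part C q ->
  inner_der p q (I i x) (I i y) = - (2 *: Dtri (tri_t p q i x y)).
Proof.
move=> hx hy; apply: sub_val_inj; have lv := @sub_val_linear _ _ _ (der_cap H).
rewrite -scaleN1r !(linZ _ _ lv) scaleN1r (tri_t_val i hx hy).
rewrite -(scomm_LI_LI_same two0 scC b11 i hx hy).
apply: sub_valE; rewrite (scomm_LI_LI_same two0 scC b11 i hx hy).
rewrite memvN; apply: memvZ; apply: (DT_der two0 scC b11).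
exact: (shift_ttriple_tri two0 scC b11).
Qed.

Definition mor (X Y : G) : Prop := f (smul X Y) = smul (f X) (f Y).

Lemma mor_lin_l Y : lin_closed (mor^~ Y).
Proof.
have [l _] := smul_bilin G; have [l' _] := smul_bilin T.
apply: (@lin_closed_eq k G T); first exact: (linear_comp (@f_fun_linear k C) (l Y)).
exact: (linear_comp (l' _) (@f_fun_linear k C)).
Qed.

Lemma mor_lin_r X : lin_closed (mor X).
Proof.
have [_ l] := smul_bilin G; have [_ l'] := smul_bilin T.
apply: (@lin_closed_eq k G T); first exact: (linear_comp (@f_fun_linear k C) (l X)).
exact: (linear_comp (l' _) (@f_fun_linear k C)).
Qed.

Lemma mor_sym p q X Y : X \in part G p -> Y \in part G q ->
  smul Y X = - (sgn (p && q) *: smul X Y) -> mor X Y -> mor Y X.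
Proof.
move=> hX hY e m; have L := @f_fun_linear k C.
rewrite /mor e -scaleN1r !(linZ _ _ L) scaleN1r m.
rewrite (@TKK_anti k H (@H3_smulC k C) p q (f X) (f Y)) //;
  exact: (f_fun_part two0 scC b11).
Qed.

Lemma q0_br (a b : M2) : \tr a = 0 -> \tr b = 0 ->
  Q0_br (q0 a) (q0 b) = q0 (a *m b - b *m a).
Proof. by move=> ta tb; rewrite /Q0_br !q0K. Qed.

Lemma br_trace (a b : M2) : \tr (a *m b - b *m a) = 0.
Proof. by rewrite linearB /= mxtrace_mulC subrr. Qed.

Lemma tri_smul_val (S0 : normed_superalgebra k) p q (d e : tri S0) :
  d \in part (tri S0) p -> e \in part (tri S0) q ->
  smul d e = tri_in (p (+) q) [ffun i => scomm (tri_val d i) (tri_val e i)].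
Proof. by move=> hd he; rewrite /smul /= /tri_br (sext2E (@tri_br_aux k S0) hd he). Qed.

Lemma gA_val j a : \tr a = 0 ->
  tri_val (@tri_in k S4 false (Qtriple (Qdelta j a))) = Qtriple (Qdelta j a).
Proof. by move=> ta; apply: sub_valE; apply: Qtriple_tri; apply: Qdelta_trace. Qed.

Lemma mor_AA j l a b : \tr a = 0 -> \tr b = 0 -> mor (gA j a) (gA l b).
Proof.
move=> ta tb; have ha := @sub_in_part _ _ _ (tri_cap S4) false.
rewrite /mor (f_gA j ta) (f_gA l tb) (TKK_tens_tens _ _ (hE _) (hE _)).
rewrite inner_EE scaler0 (lin0 (@TKK_of_der_linear k H)) addr0.
rewrite (Ediag_Ediag two0 b11) (inj_eq (addIr 2)) q0_br //.
rewrite /gA (@g_tri_tri k S4 S' _ _ _ _ (ha _) (ha _)) (tri_smul_val (ha _) (ha _)).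
rewrite [X in tri_in _ X](_ : _ = Qtriple (Qdelta j (if j == l then a *m b - b *m a else 0))).
  have := @f_gA j (if j == l then a *m b - b *m a else 0); rewrite /gA => ->.
    case: eqP => // _; have [tl tr] := @tens_bilin k (Q0 k) H.
    by rewrite (lin0 (@q0_linear k)) (lin0 (tl _)) (lin0 (tr _)).
  by case: eqP => _; rewrite ?mxtrace0 ?br_trace.
apply/ffunP => i; rewrite ffunE !gA_val // !ffunE scomm_lr; congr (lr_mul _ _).
  case: (eqVneq i j) => [->|ij]; last by case: ifP => _; rewrite !(mul0mx, mulmx0) subr0.
  by case: (eqVneq j l) => // _; rewrite !(mul0mx, mulmx0) subr0.
case: (eqVneq (i + 2) j) => [->|ij]; last by case: ifP => _; rewrite !(mul0mx, mulmx0) subr0.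
by case: (eqVneq j l) => // _; rewrite !(mul0mx, mulmx0) subr0.
Qed.

Let ha a : @tri_in k S4 false a \in part (tri_ss S4) false := sub_in_part _ false a.
Let h1 (a : M2) : a \in part S4 false := even_mem a.
Let lt := @TKK_of_tens_linear k H.
Let ld := @TKK_of_der_linear k H.
Let tl y : linear (fun a : Q0 k => tens a (y : H)) := (@tens_bilin k (Q0 k) H).1 y.
Let tr (a : Q0 k) : linear (fun y : H => tens a y) := (@tens_bilin k (Q0 k) H).2 a.
Let lq := @q0_linear k.

Lemma Qdelta_act j i a (c : M2) : \tr a = 0 ->
  tri_val (@tri_in k S4 false (Qtriple (Qdelta j a))) i c
  = (if i == j then a *m c else 0) - (if i + 2 == j then c *m a else 0).
Proof.
move=> ta; rewrite gA_val // QtripleE !ffunE.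
by case: (i == j); case: (i + 2 == j); rewrite ?mul0mx ?mulmx0.
Qed.

(** This lemma and trace_polar split a c along k1 and the traceless matrices. *)
Lemma half_comm (a c : M2) : \tr a = 0 -> \tr c = 0 ->
  traceless (a *m c) = 2^-1 *: (a *m c - c *m a).
Proof.
move=> ta tc; rewrite /traceless tr2E.
apply: mx2P; rewrite !(sub2E, scale2E, mul2E) ?mxE /= !(trace0E ta) !(trace0E tc);
  field; done.
Qed.

Lemma half_commN (a c : M2) : \tr a = 0 -> \tr c = 0 ->
  traceless (- (c *m a)) = 2^-1 *: (a *m c - c *m a).
Proof.
move=> ta tc; rewrite (linN _ (@traceless_linear k)) half_comm // -scalerN.
by rewrite opprB.
Qed.

Lemma trace_polar (a c : M2) : \tr a = 0 -> \tr c = 0 ->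
  \tr (a *m c) = - polar_det a c.
Proof.
by move=> ta tc; rewrite tr2E polar2E !mul2E (trace0E ta) (trace0E tc); ring.
Qed.

Lemma gD0 i x : gD i 0 x = 0.
Proof.
have [l _] := @tens_bilin k S4 S'.
by rewrite /gD (lin0 (l _)) (lin0 (@iota_linear k S4 S' i)).
Qed.

Lemma gA_gD j i p a c x : \tr a = 0 -> x \in part C p ->
  smul (gA j a) (gD i c x)
  = gD i ((if i == j then a *m c else 0) - (if i + 2 == j then c *m a else 0)) x.
Proof.
move=> ta hx; rewrite /gA /gD (@g_tri_iota k S4 S' false false p _ i _ _ (ha _) (h1 _) hx).
congr (iota i (tens _ _)); exact: Qdelta_act.
Qed.

Lemma gB_gD p q i c d x : d \in part (tri S') p -> x \in part C q ->
  smul (g_of_tri' S4 d) (gD i c x) = gD i c (tri_val d i x).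
Proof.
move=> hd hx; rewrite /gD (@g_tri'_iota k S4 S' p false q _ i _ _ hd (h1 _) hx).
by rewrite andbF sgnF scale1r.
Qed.

Lemma gC_gD i x : gC i x = gD i 1%:M x. Proof. by []. Qed.

Lemma mor_AC j i p a x : \tr a = 0 -> x \in part C p -> mor (gA j a) (gC i x).
Proof.
move=> ta hx; rewrite /mor (f_gA j ta) f_gC.
rewrite (TKK_tens_der _ (hE _) (Dinn_part two0 scC b11 i hx)).
rewrite [der_val _](DI_val two0 scC b11) gC_gD (gA_gD _ _ _ ta hx).
rewrite mulmx1 mul1mx sgnF scale1r.
have [D0 D1 D2] := DI_diag two0 b11 i x.
case: (ord3P i j) => ->; rewrite !ord3E.
- rewrite subr0 (f_gD _ _ ta) D2 -[- (2^-1 *: _)]scaleN1r.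
  by rewrite !(linZ _ _ (tr _)) !(linZ _ _ lt) scaleN1r opprK.
- by rewrite subrr gD0 (lin0 (@f_fun_linear k C)) D0 (lin0 (tr _)) (lin0 lt) oppr0.
have ta' : \tr (- a) = 0 by rewrite linearN /= ta oppr0.
rewrite sub0r (f_gD _ _ ta') D1 -[- a]scaleN1r (linZ _ _ lq) (linZ _ _ (tl _)).
by rewrite !(linZ _ _ (tr _)) !(linZ _ _ lt) !scaleN1r scalerN.
Qed.

Lemma mor_AD j i p a c x : \tr a = 0 -> \tr c = 0 -> x \in part C p ->
  mor (gA j a) (gD i c x).
Proof.
move=> ta tc hx; rewrite /mor (f_gA j ta) (f_gD i x tc) smulZr.
rewrite (TKK_tens_tens _ _ (hE _) (hI i hx)) q0_br // !q0K //.
rewrite (gA_gD _ _ _ ta hx) f_gen (Ediag_Ioff two0 b11).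
have [I0 I1 I2] := inner_EI i hx.
case: (ord3P i j) => ->; rewrite !ord3E /half_if.
- rewrite subr0 half_comm // trace_polar // I2.
  rewrite (linZ _ _ lq) (linZ _ _ (tl _)) (linZ _ _ (tr _)) !(linZ _ _ lt) !(linZ _ _ ld).
  module_eq k (TKK (H3 C)); field; done.
- rewrite subrr I0 scaler0 (lin0 ld) scale0r (lin0 (tr _)) (lin0 lt) mxtrace0.
  rewrite traceless0 ?mxtrace0 // (lin0 lq) (lin0 (tl _)) (lin0 lt).
  by rewrite mulr0 scale0r !addr0 !scaler0.
rewrite sub0r half_commN // linearN /= trace_polar // polar_detC I1.
rewrite (linZ _ _ lq) (linZ _ _ (tl _)) (linZ _ _ (tr _)) !(linZ _ _ lt).
rewrite !(linZ _ _ ld) (linN _ ld) (linZ _ _ ld).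
by module_eq k (TKK (H3 C)); field.
Qed.

Lemma mor_BA j q a d : \tr a = 0 -> d \in part (tri S') q ->
  mor (gA j a) (g_of_tri' S4 d).
Proof.
move=> ta hd; rewrite /mor (f_gA j ta) f_gB /gA.
rewrite (@g_tri_tri' k S4 S' _ _ _ _ (ha _) hd) (lin0 (@f_fun_linear k C)).
rewrite (TKK_tens_der _ (hE _) (Dtri_part two0 scC b11 hd)).
rewrite [der_val _](DT_val two0 scC b11) (DT_diag b11) (lin0 (tr _)) (lin0 lt).
by rewrite scaler0 oppr0.
Qed.

Lemma scomm_DT p q (t u : {ffun 'I_3 -> 'End(C)}) :
    t \in tri_part S' p -> u \in tri_part S' q ->
  scomm (DT t) (DT u) = DT [ffun i => scomm (t i) (u i)].
Proof.
move=> ht hu; have [to _] := tri_trial scC ht; have [uo _] := tri_trial scC hu.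
have te i : t i \in end_part C p by exact: osp_end (to i).
have ue i : u i \in end_part C q by exact: osp_end (uo i).
have sE v := scomm_app v (der_end (DT_der two0 scC b11 ht)) (der_end (DT_der two0 scC b11 hu)).
apply: (H3_lfun_ext two0 b11) => [j|j r x hx]; rewrite sE.
  by rewrite !(DT_diag b11) !lf0 scaler0 subr0.
rewrite !(DT_off two0 b11) ffunE (scomm_app x (te j) (ue j)).
by rewrite IoffD IoffN IoffZ.
Qed.

Lemma mor_BB p q d e : d \in part (tri S') p -> e \in part (tri S') q ->
  mor (g_of_tri' S4 d) (g_of_tri' S4 e).
Proof.
move=> hd he; rewrite /mor (@g_tri'_tri' k S4 S' _ _ _ _ hd he) !f_gB.
have hd' := Dtri_part two0 scC b11 hd; have he' := Dtri_part two0 scC b11 he.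
rewrite (TKK_der_der hd' he'); congr TKK_of_der; apply: sub_val_inj.
rewrite [RHS](der_smul_val hd' he') (DT_val two0 scC b11) ![der_val _](DT_val two0 scC b11).
have hdt := sub_val_in hd; have het := sub_val_in he.
rewrite (tri_smul_val hd he) (scomm_DT hdt het); congr (DT _).
apply: sub_valE; apply: (tri_of_der two0 scC b11); rewrite -(scomm_DT hdt het).
by apply: scomm_der; apply: (DT_der two0 scC b11).
Qed.

Lemma mor_BC p q i d x : d \in part (tri S') p -> x \in part C q ->
  mor (g_of_tri' S4 d) (gC i x).
Proof.
move=> hd hx; rewrite /mor f_gB gC_gD (gB_gD _ _ hd hx) -!gC_gD !f_gC.
have hd' := Dtri_part two0 scC b11 hd; have hx' := Dinn_part two0 scC b11 i hx.
rewrite (TKK_der_der hd' hx'); congr TKK_of_der.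
apply: sub_val_inj; rewrite [RHS](der_smul_val hd' hx') (DI_val two0 scC b11).
rewrite [der_val (Dtri d)](DT_val two0 scC b11) [der_val _](DI_val two0 scC b11).
by rewrite (scomm_DT_DI two0 scC b11 i (sub_val_in hd) hx).
Qed.

Lemma mor_BD p q i a d x : \tr a = 0 -> d \in part (tri S') p -> x \in part C q ->
  mor (g_of_tri' S4 d) (gD i a x).
Proof.
move=> ta hd hx; rewrite /mor f_gB (f_gD i x ta) (gB_gD _ _ hd hx).
have hd' := Dtri_part two0 scC b11 hd.
rewrite smulZr (TKK_der_tens _ hd' (hI i hx)) (f_gD _ _ ta).
by rewrite [der_val _](DT_val two0 scC b11) (DT_off two0 b11).
Qed.

Let gsucc i p q (c c' : M2) x y : x \in part C p -> y \in part C q ->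
  smul (gD i c x) (gD (i + 1) c' y) = gD (i + 2) (bar2 c *m bar2 c') (x ** y).
Proof.
move=> hx hy; rewrite /gD.
rewrite (@g_iota_succ k S4 S' i false p false q _ _ _ _ (h1 _) hx (h1 _) hy).
rewrite andbF sgnF scale1r; congr (iota _ (tens _ _)); exact: para_Mat2.
Qed.

Let der_val_Dinn i x : der_val (Dinn i x) = DI i x := DI_val two0 scC b11 i x.
Let hDinn i p x (hx : x \in part C p) := Dinn_part two0 scC b11 i hx.

Lemma mor_CC_succ i p q x y : x \in part C p -> y \in part C q ->
  mor (gC i x) (gC (i + 1) y).
Proof.
move=> hx hy; rewrite /mor !gC_gD (gsucc _ _ _ hx hy) bar2_1 mulmx1 -!gC_gD !f_gC.
rewrite (TKK_der_der (hDinn i hx) (hDinn (i + 1) hy)); congr TKK_of_der.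
apply: sub_val_inj; rewrite [RHS](der_smul_val (hDinn i hx) (hDinn (i + 1) hy)).
rewrite !der_val_Dinn (scomm_DI_succ two0 scC b11 i hx hy).
exact: der_val_Dinn.
Qed.

Lemma mor_CD_succ i p q a x y : \tr a = 0 -> x \in part C p -> y \in part C q ->
  mor (gC i x) (gD (i + 1) a y).
Proof.
move=> ta hx hy; rewrite /mor !gC_gD (gsucc _ _ _ hx hy) -!gC_gD.
rewrite bar2_1 mul1mx (bar2_trace0 ta) f_gC (f_gD _ _ ta) smulZr.
rewrite (TKK_der_tens _ (hDinn i hx) (hI (i + 1) hy)) der_val_Dinn.
rewrite (DI_off1 two0 scC b11) f_gD ?linearN /= ?ta ?oppr0 //.
by rewrite (linN _ lq) (linN _ (tl _)) (linN _ (tr _)).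
Qed.

Lemma mor_DC_succ i p q a x y : \tr a = 0 -> x \in part C p -> y \in part C q ->
  mor (gD i a x) (gC (i + 1) y).
Proof.
move=> ta hx hy; rewrite /mor !gC_gD (gsucc _ _ _ hx hy) -!gC_gD.
rewrite bar2_1 mulmx1 (bar2_trace0 ta) f_gC (f_gD _ _ ta) smulZl.
rewrite (TKK_tens_der _ (hI i hx) (hDinn (i + 1) hy)) der_val_Dinn.
have := DI_off2 two0 scC b11 (i + 1) hy hx; rewrite !ord3E => ->.
rewrite (linZ _ _ (tr _)) (linZ _ _ lt) scalerA [q && p]andbC sgn_sq scale1r.
rewrite f_gD ?linearN /= ?ta ?oppr0 //.
by rewrite (linN _ lq) (linN _ (tl _)) (linN _ lt) scalerN.
Qed.

Lemma mor_DD_succ i p q a b x y : \tr a = 0 -> \tr b = 0 ->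
  x \in part C p -> y \in part C q -> mor (gD i a x) (gD (i + 1) b y).
Proof.
move=> ta tb hx hy; rewrite /mor (gsucc _ _ _ hx hy) !bar2_trace0 //.
rewrite mulmxN mulNmx opprK f_gen half_comm // trace_polar // !f_gD //.
rewrite smulZl smulZr (TKK_tens_tens _ _ (hI i hx) (hI (i + 1) hy)) q0_br // !q0K //.
rewrite (Ioff_succ two0 scC b11) (inner_II_succ i hx hy).
rewrite (linZ _ _ lq) (linZ _ _ (tl _)) !(linZ _ _ lt) !(linZ _ _ ld).
module_eq k (TKK (H3 C)); field; done.
Qed.

(** The bracket of two elements of the i-th tensor product, for quaternions whose
    triple has known matrices a_j. *)
Let gsame (i : 'I_3) p q (c c' : M2) x y (a : {ffun 'I_3 -> M2}) :
    x \in part C p -> y \in part C q -> (forall j, \tr (a j) = 0) ->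
    iter i (@theta k S4) (@t_triple k S4 false false c c') = Qtriple a ->
  f (smul (gD i c x) (gD i c' y)) =
  bform x y *: TKK_of_tens (\sum_j tens (q0 (a j)) (E (j + 2)))
  + polar_det c c' *: TKK_of_der (Dtri (tri_t p q i x y)).
Proof.
move=> hx hy ta e; rewrite /gD.
rewrite (@g_iota_iota k S4 S' i false p false q _ _ _ _ (h1 _) hx (h1 _) hy).
rewrite (linD _ _ (@f_fun_linear k C)) e /= sgnF !mul1r.
have L1 := linear_comp (@f_fun_linear k C) (@g_of_tri_linear k S4 S').
have L2 := linear_comp (@f_fun_linear k C) (@g_of_tri'_linear k S4 S').
rewrite (linZ _ _ L1) (linZ _ _ L2); congr (_ *: _ + _ *: _).
  by rewrite f_tri (f_diag_Q C two0 ta).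
exact: f_tri'.
Qed.

Lemma sum_Qspread i a0 a1 a2 :
  \sum_j tens (q0 (Qspread i a0 a1 a2 j)) (E (j + 2))
  = tens (q0 a0) (E (i + 2)) + tens (q0 a1) (E i) + tens (q0 a2) (E (i + 1)).
Proof. by rewrite (sum_ord3 i) !ffunE !ord3E. Qed.

Lemma tens_q0_0 u : tens (q0 0) (u : H) = 0.
Proof. by rewrite (lin0 lq) (lin0 (tl _)). Qed.

Lemma mor_CC_same i p q x y : x \in part C p -> y \in part C q ->
  mor (gC i x) (gC i y).
Proof.
move=> hx hy; have t00 : \tr (0 : M2) = 0 by rewrite mxtrace0.
rewrite /mor !gC_gD (gsame hx hy (Qspread_trace i t00 t00 t00) (t_11 two0 i)).
rewrite sum_Qspread !tens_q0_0 !addr0 (lin0 lt) scaler0 add0r.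
have -> : polar_det (1%:M : M2) 1%:M = 2.
  by have [i0 i1 i2 i3] := one2E k; rewrite polar2E i0 i1 i2 i3; ring.
rewrite -!gC_gD !f_gC (TKK_der_der (hDinn i hx) (hDinn i hy)) -(linZ _ _ ld).
congr TKK_of_der; apply: sub_val_inj.
rewrite [RHS](der_smul_val (hDinn i hx) (hDinn i hy)) !der_val_Dinn.
rewrite (scomm_DI_same two0 scC b11 i hx hy) (linZ _ _ (@sub_val_linear _ _ _ _)).
by rewrite (tri_t_val i hx hy).
Qed.

Lemma mor_CD_same i p q a x y : \tr a = 0 -> x \in part C p -> y \in part C q ->
  mor (gC i x) (gD i a y).
Proof.
move=> ta hx hy; have t00 : \tr (0 : M2) = 0 by rewrite mxtrace0.
have tN : \tr (- a) = 0 by rewrite linearN /= ta oppr0.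
rewrite /mor gC_gD (gsame hx hy (Qspread_trace i ta t00 tN) (t_1b i ta)).
rewrite sum_Qspread tens_q0_0 addr0 (linN _ lq) (linN _ (tl _)) -(linB _ _ (tr _)).
have -> : polar_det (1%:M : M2) a = 0.
  have [i0 i1 i2 i3] := one2E k; rewrite polar2E i0 i1 i2 i3 (trace0E ta); ring.
rewrite scale0r addr0 -gC_gD f_gC (f_gD _ _ ta) smulZr.
rewrite (TKK_der_tens _ (hDinn i hx) (hI i hy)) der_val_Dinn (DI_off0 two0 scC b11).
rewrite (linZ _ _ (tr _)) (linZ _ _ lt) scalerA mulrA mulVf // mul1r.
by [].
Qed.

Lemma mor_DC_same i p q a x y : \tr a = 0 -> x \in part C p -> y \in part C q ->
  mor (gD i a x) (gC i y).
Proof.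
move=> ta hx hy; have t00 : \tr (0 : M2) = 0 by rewrite mxtrace0.
have tN : \tr (- a) = 0 by rewrite linearN /= ta oppr0.
rewrite /mor gC_gD (gsame hx hy (Qspread_trace i tN t00 ta) (t_b1 i ta)).
rewrite sum_Qspread tens_q0_0 addr0 (linN _ lq) (linN _ (tl _)).
rewrite [- _ + tens _ _]addrC -(linB _ _ (tr _)).
have -> : polar_det a (1%:M : M2) = 0.
  have [i0 i1 i2 i3] := one2E k; rewrite polar2E i0 i1 i2 i3 (trace0E ta); ring.
rewrite scale0r addr0 -gC_gD f_gC (f_gD _ _ ta) smulZl.
rewrite (TKK_tens_der _ (hI i hx) (hDinn i hy)) der_val_Dinn (DI_off0 two0 scC b11).
rewrite (linZ _ _ (tr _)) (linZ _ _ lt) -opprB (linN _ (tr _)) (linN _ lt).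
rewrite (bformC hx hy) -scalerN scalerA.
by move: (sgn _) => s; module_eq k (TKK (H3 C)); field; done.
Qed.

Lemma mor_DD_same i p q a b x y : \tr a = 0 -> \tr b = 0 ->
  x \in part C p -> y \in part C q -> mor (gD i a x) (gD i b y).
Proof.
move=> ta tb hx hy; have t00 : \tr (0 : M2) = 0 by rewrite mxtrace0.
have tc : \tr (2^-1 *: (a *m b - b *m a)) = 0 by rewrite mxtraceZ br_trace mulr0.
rewrite /mor (gsame hx hy (Qspread_trace i tc t00 tc) (t_ab two0 i ta tb)).
rewrite sum_Qspread tens_q0_0 addr0 (linZ _ _ lq) !(linZ _ _ (tl _)).
rewrite -scalerDr -(linD _ _ (tr _)).
rewrite !f_gD // smulZl smulZr (TKK_tens_tens _ _ (hI i hx) (hI i hy)) q0_br // !q0K //.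
rewrite (Ioff_Ioff two0 scC b11) (inner_II_same i hx hy) addrC [E (i + 2) + _]addrC.
rewrite (linZ _ _ (tr _)) !(linZ _ _ lt) !(linZ _ _ ld) (linN _ ld) !(linZ _ _ ld).
module_eq k (TKK (H3 C)); field; done.
Qed.

End Morphism.

(** * The isomorphism *)

Section Isomorphism.
Variables (k : fieldType) (C : unital_normed_superalgebra k).
Local Notation M2 := 'M[k]_2.
Local Notation S4 := (para (Mat2 k)).
Local Notation S' := (para C).
Local Notation G := (g_superalgebra S4 S').
Local Notation T := (TKK (H3 C)).

Hypothesis two0 : (2 : k) != 0.
Hypothesis scC : symmetric_composition (para C).
Hypothesis b11 : bform (un_one C) (un_one C) = 2.

Let mor_flip := mor_sym two0 scC b11.

Lemma mor_flip0 p q (X Y : G) : X \in part G p -> Y \in part G q -> X.2 = 0 ->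
  mor X Y -> mor Y X.
Proof. by move=> hX hY X0; apply: (mor_flip hX hY); apply: g_anti0. Qed.

Lemma mor_flip_iota i p q (c c' : M2) (x y : C) :
    x \in part C p -> y \in part C q ->
  mor (gD (i + 2) c' y) (gD i c x) -> mor (gD i c x) (gD (i + 2) c' y).
Proof.
move=> hx hy; have i2 : i = i + 2 + 1 by rewrite ord3E.
apply: (mor_flip (gD_part _ _ hy) (gD_part _ _ hx)); rewrite {1 4}i2 /gD.
apply: g_anti_iota.
  exact: (@tens_in k S4 S' false q _ _ (even_mem _) hy).
exact: (@tens_in k S4 S' false p _ _ (even_mem _) hx).
Qed.

(** Bilinearity reduces the claim to pairs of generators, and
    superanticommutativity of both brackets to pairs in one order. *)
Lemma f_fun_mul (X Y : G) : mor X Y.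
Proof.
have hA j a := @gA_part k C j a.
have hB p d (hd : d \in part (tri S') p) : g_of_tri' S4 d \in part G p.
  exact: g_of_tri'_part hd.
move: X; apply: (gen_ind two0) => [|j a ta|p d hd|i p x hx|i p a x ta hx];
  first exact: mor_lin_l; move: Y;
  (apply: (gen_ind two0) => [|l b tb|q e he|l q y hy|l q b y tb hy];
   first exact: mor_lin_r).
- exact: mor_AA.
- exact: (mor_BA two0 scC b11 _ ta he).
- exact: (mor_AC two0 scC b11 _ _ ta hy).
- exact: (mor_AD two0 scC b11 _ _ ta tb hy).
- by apply: (mor_flip0 (hA _ _) (hB _ _ hd)) => //; apply: (mor_BA two0 scC b11 _ tb hd).
- exact: (mor_BB two0 scC b11 hd he).
- exact: (mor_BC two0 scC b11 _ hd hy).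
- exact: (mor_BD two0 scC b11 _ tb hd hy).
- apply: (mor_flip0 (hA _ _) (gC_part _ hx)) => //.
  exact: (mor_AC two0 scC b11 _ _ tb hx).
- apply: (mor_flip0 (hB _ _ he) (gC_part _ hx)) => //.
  exact: (mor_BC two0 scC b11 _ he hx).
- case: (ord3P i l) => ->.
  + exact: (mor_CC_same two0 scC b11 _ hx hy).
  + exact: (mor_CC_succ two0 scC b11 _ hx hy).
  rewrite !gC_gD; apply: (@mor_flip_iota i p q _ _ x y hx hy).
  by have := mor_CC_succ two0 scC b11 (i + 2) hy hx; rewrite !gC_gD !ord3E.
- case: (ord3P i l) => ->.
  + exact: (mor_CD_same two0 scC b11 _ tb hx hy).
  + exact: (mor_CD_succ two0 scC b11 _ tb hx hy).
  rewrite gC_gD; apply: (@mor_flip_iota i p q _ _ x y hx hy).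
  by have := mor_DC_succ two0 scC b11 (i + 2) tb hy hx; rewrite !gC_gD !ord3E.
- apply: (mor_flip0 (hA _ _) (gD_part _ _ hx)) => //.
  exact: (mor_AD two0 scC b11 _ _ tb ta hx).
- apply: (mor_flip0 (hB _ _ he) (gD_part _ _ hx)) => //.
  exact: (mor_BD two0 scC b11 _ ta he hx).
- case: (ord3P i l) => ->.
  + exact: (mor_DC_same two0 scC b11 _ ta hx hy).
  + exact: (mor_DC_succ two0 scC b11 _ ta hx hy).
  rewrite gC_gD; apply: (@mor_flip_iota i p q _ _ x y hx hy).
  by have := mor_CD_succ two0 scC b11 (i + 2) ta hy hx; rewrite !gC_gD !ord3E.
case: (ord3P i l) => ->.
+ exact: (mor_DD_same two0 scC b11 _ ta tb hx hy).
+ exact: (mor_DD_succ two0 scC b11 _ ta tb hx hy).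
apply: (@mor_flip_iota i p q _ _ x y hx hy).
by have := mor_DD_succ two0 scC b11 (i + 2) tb ta hy hx; rewrite !ord3E.
Qed.

(** The brackets above depend on C only through the composition identities of its
    para-Hurwitz superalgebra, so the isomorphism exists at this generality. *)
Theorem g_TKK_iso : superalgebra_iso G T.
Proof.
have fE := linfunE (@f_fun_linear k C).
exists (linfun (@f_fun k C)); split=> [|p x hx|x y].
- exists (@g_fun k C) => x; rewrite fE.
    exact: (f_funK two0 scC b11).
  exact: (g_funK two0 scC b11).
- by rewrite fE; apply: (f_fun_part two0 scC b11).
by rewrite !fE; apply: f_fun_mul.
Qed.

End Isomorphism.

(** * The symplectic plane *)

Section SymplecticPlane.
Variables (k : fieldType) (V : sympl_plane k).
Local Notation "<| u , v |>" := (@sp_form k V u v) (format "<| u ,  v |>").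
Local Notation "f ^s" := (sympl_bar f) (at level 2, format "f ^s").
Local Notation b0 := ((vbasis {:V})`_0).
Local Notation b1 := ((vbasis {:V})`_1).
Implicit Types (u v w x y : V) (f g h : 'End(V)).

Lemma spDl u v w : <|u + v, w|> = <|u, w|> + <|v, w|>.
Proof. by have [l _] := sp_bilin V; exact: (linD _ _ (l w)). Qed.
Lemma spDr u v w : <|w, u + v|> = <|w, u|> + <|w, v|>.
Proof. by have [_ r] := sp_bilin V; exact: (linD _ _ (r w)). Qed.
Lemma spZl a u w : <|a *: u, w|> = a * <|u, w|>.
Proof. by have [l _] := sp_bilin V; exact: (linZ _ _ (l w)). Qed.
Lemma spZr a u w : <|w, a *: u|> = a * <|w, u|>.
Proof. by have [_ r] := sp_bilin V; exact: (linZ _ _ (r w)). Qed.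
Lemma spNl u w : <|- u, w|> = - <|u, w|>.
Proof. by rewrite -scaleN1r spZl mulN1r. Qed.
Lemma spNr u w : <|w, - u|> = - <|w, u|>.
Proof. by rewrite -scaleN1r spZr mulN1r. Qed.

Lemma sp_nondeg0 u : (forall v, <|u, v|> = 0) -> u = 0.
Proof.
move=> u0; apply: sp_nondeg => v; have [_ r] := sp_bilin V.
by rewrite sp_skew u0 oppr0 (lin0 (r v)).
Qed.

(** An alternating trilinear expression on a plane vanishes. *)
Lemma sp_cyclic u v w :
  <|u, v|> *: w + <|v, w|> *: u + <|w, u|> *: v = 0.
Proof.
have [a [b ->]] := sp_basis u; have [c [d ->]] := sp_basis v.
have [e [g ->]] := sp_basis w.
rewrite !spDl !spDr !spZl !spZr !sp_alt [<|b1, b0|>]sp_skew.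
by move: <|b0, b1|> => n; module_eq k V; ring.
Qed.

Lemma coord_sp (i : 'I_(\dim {:V})) v :
  coord (vbasis {:V}) i v
  = (if i == 0 :> nat then <|v, b1|> else - <|v, b0|>) / <|b0, b1|>.
Proof.
have F := basis_free (vbasisP {:V}); have n0 := sp_basis_neq0 V.
have [a [b ->]] := sp_basis v.
have i2 : (i < 2)%N by rewrite -[2%N](sp_dim V).
have lt j : (j < 2)%N -> (j < \dim {:V})%N by rewrite sp_dim.
rewrite linearD !linearZ /=.
rewrite (coord_free (Ordinal (lt 0%N isT)) i F) (coord_free (Ordinal (lt 1%N isT)) i F).
rewrite !spDl !spZl !sp_alt [<|b1, b0|>]sp_skew -!val_eqE /=.
by case: (nat_of_ord i) i2 => [|[|]] //= _; field.
Qed.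

(** The dimension of the plane equals 2 only propositionally, hence matrix
    entries are presented as functions of natural numbers. *)
Lemma polar_det_dim2 n (M N : 'M[k]_n) (F G : nat -> nat -> k) : n = 2%N ->
    (forall i j, M i j = F i j) -> (forall i j, N i j = G i j) ->
  polar_det M N
  = F 0%N 0%N * G 1%N 1%N + F 1%N 1%N * G 0%N 0%N
    - F 0%N 1%N * G 1%N 0%N - F 1%N 0%N * G 0%N 1%N.
Proof.
move=> n2; subst n => FE GE.
by rewrite /polar_det !det2E !mxE !FE !GE /=; ring.
Qed.

Local Notation polar f g := (polar_det (end_mx f) (end_mx g)).

(** For fixed f and g the left side is an alternating form of (x, y), hence a
    multiple of the symplectic form; comparison on a basis gives the factor. This
    makes the polar form of the determinant available without matrices. *)
Lemma polar_sp f g x y :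
  <|f x, g y|> + <|g x, f y|> = polar f g * <|x, y|>.
Proof.
have n0 := sp_basis_neq0 V.
pose F h (i j : nat) := (if j == 0%N then <|h (vbasis {:V})`_i, b1|>
                         else - <|h (vbasis {:V})`_i, b0|>) / <|b0, b1|>.
rewrite (@polar_det_dim2 _ _ _ (F f) (F g) (sp_dim V)) => [|i j|i j]; first last.
- by rewrite mxE coord_sp.
- by rewrite mxE coord_sp.
have [a [b ->]] := sp_basis x; have [c [d ->]] := sp_basis y.
rewrite /F /= !lfD !lfZ.
have [f00 [f01 ->]] := sp_basis (f b0); have [f10 [f11 ->]] := sp_basis (f b1).
have [g00 [g01 ->]] := sp_basis (g b0); have [g10 [g11 ->]] := sp_basis (g b1).
rewrite !(spDl, spDr, spZl, spZr) !sp_alt [<|b1, b0|>]sp_skew.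
by field.
Qed.

Lemma polar_unique f g c :
  (forall x y, <|f x, g y|> + <|g x, f y|> = c * <|x, y|>) -> polar f g = c.
Proof. by move=> H; apply: (mulIf (sp_basis_neq0 V)); rewrite -polar_sp H. Qed.

Lemma sympl_barP' f u v : <|f^s u, v|> = <|u, f v|>.
Proof. by rewrite sp_skew -sympl_barP -sp_skew. Qed.

Lemma sympl_barK f : (f^s)^s = f.
Proof. by apply/lfunP => v; apply: sp_nondeg => u; rewrite -sympl_barP sympl_barP'. Qed.

Lemma sympl_bar_comp f g : (f \o g)%VF^s = (g^s \o f^s)%VF.
Proof.
apply/lfunP => v; apply: sp_nondeg => u.
by rewrite -sympl_barP !comp_lfunE /= !sympl_barP.
Qed.

Lemma sympl_bar_polar f g : (f^s \o g)%VF + (g^s \o f)%VF = polar f g *: \1%VF.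
Proof.
apply/lfunP => v; apply: sp_nondeg => u.
rewrite add_lfunE scale_lfunE !comp_lfunE /= id_lfunE spDr spZr.
by rewrite -!sympl_barP polar_sp.
Qed.

Lemma polar_bar_app f g v : f^s (g v) + g^s (f v) = polar f g *: v.
Proof.
have := congr1 (fun F : 'End(V) => F v) (sympl_bar_polar f g).
by rewrite /= add_lfunE scale_lfunE !comp_lfunE /= id_lfunE.
Qed.

(** The adjoint is the quaternion conjugation of the endomorphism algebra. *)
Lemma sympl_bar_trace f : f^s = polar f \1%VF *: \1%VF - f.
Proof.
by rewrite -sympl_bar_polar comp_lfun1r sympl_bar1 comp_lfun1l addrK.
Qed.

Lemma polar_11 : polar (\1%VF : 'End(V)) \1%VF = 2.
Proof. by apply: polar_unique => x y; rewrite !id_lfunE; ring. Qed.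

Lemma polar_sympl_bar f g : polar f^s g^s = polar f g.
Proof.
have [l r] := polar_det_bilin k (sp_dim V).
have L := @end_mx_linear k V.
rewrite !sympl_bar_trace !(linB _ _ L) !(linZ _ _ L).
rewrite !(linB _ _ (l _)) !(linB _ _ (r _)) !(linZ _ _ (l _)) !(linZ _ _ (r _)).
rewrite /GRing.scale /= polar_11 [polar_det (end_mx \1) _]polar_detC.
by ring.
Qed.

Lemma sympl_bar_polar' f g : (f \o g^s)%VF + (g \o f^s)%VF = polar f g *: \1%VF.
Proof. by rewrite -[in RHS]polar_sympl_bar -sympl_bar_polar !sympl_barK. Qed.

Lemma polar_bar_app' f g v : f (g^s v) + g (f^s v) = polar f g *: v.
Proof. by rewrite -[polar f g]polar_sympl_bar -polar_bar_app !sympl_barK. Qed.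

Lemma polar_comp f g h : polar (f \o g)%VF h = polar g (f^s \o h)%VF.
Proof.
apply: polar_unique => x y; rewrite -polar_sp !comp_lfunE /= sympl_barP.
by rewrite sympl_barP'.
Qed.

Lemma polar_cyclic f g h :
  polar (f^s \o g^s)%VF h = polar f (g^s \o h^s)%VF.
Proof.
transitivity (polar h (f^s \o g^s)%VF); first by rewrite polar_detC.
rewrite [RHS]polar_detC polar_comp sympl_barK -[in RHS]polar_sympl_bar.
by rewrite sympl_barK sympl_bar_comp.
Qed.

(** On x and y, this is the cyclic identity for u, y and the adjoint of g at v,
    paired with x. *)
Lemma polar_rank1 u v g : polar (rank1 u v) g = <|v, g u|>.
Proof.
apply: polar_unique => x y; rewrite !rank1E spZl spZr.
have := congr1 (fun z => <|x, z|>) (sp_cyclic u y (g^s v)).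
rewrite !spDr !spZr -!sympl_barP sympl_barP' [<|x, 0|>](lin0 (_ x)); last first.
  by case: (sp_bilin V).
rewrite [<|u, y|>]sp_skew [<|g y, v|>]sp_skew => E.
by apply: subr0_eq; rewrite -[RHS]oppr0 -E; ring.
Qed.

Lemma comp_rank1 g u v : (g \o rank1 u v)%VF = rank1 u (g v).
Proof. by apply/lfunP => w; rewrite comp_lfunE /= !rank1E lfZ. Qed.

Lemma rank1_comp g u v : (rank1 u v \o g)%VF = rank1 (g^s u) v.
Proof. by apply/lfunP => w; rewrite comp_lfunE /= !rank1E sympl_barP. Qed.

Lemma sympl_bar_rank1 u v : (rank1 u v)^s = - rank1 v u.
Proof.
apply/lfunP => w; apply: sp_nondeg => x.
rewrite -sympl_barP opp_lfunE !rank1E spNr spZr spZl [<|v, w|>]sp_skew.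
by ring.
Qed.

(** The cyclic identity again, applied to a third vector. *)
Lemma rank1_alt u w : rank1 w u - rank1 u w = <|u, w|> *: \1%VF.
Proof.
apply/lfunP => y; rewrite !(add_lfunE, opp_lfunE, scale_lfunE, rank1E) id_lfunE.
apply: subr0_eq; rewrite -(sp_cyclic u y w).
rewrite [<|w, u|>]sp_skew [<|u, y|>]sp_skew.
by module_eq k V; ring.
Qed.

Lemma rank1Nl u v : rank1 (- u) v = - rank1 u v.
Proof. by have [l _] := @rank1_bilin k V; exact: (linN _ (l _)). Qed.
Lemma rank1Nr u v : rank1 u (- v) = - rank1 u v.
Proof. by have [_ r] := @rank1_bilin k V; exact: (linN _ (r _)). Qed.

End SymplecticPlane.

(** * The superalgebras B(1,2) and B(4,2) in characteristic 3 *)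

Section Char3.
Variables (k : fieldType) (char3 : 3%N \in [pchar k]) (V : sympl_plane k).
Local Notation "<| u , v |>" := (@sp_form k V u v) (format "<| u ,  v |>").
Local Notation "f ^s" := (sympl_bar f) (at level 2, format "f ^s").
Local Notation polar f g := (polar_det (end_mx f) (end_mx g)).

Lemma char3_two : (2 : k) = -1.
Proof.
have /eqP : (3 : k) = 0 by exact: (pcharf0 char3).
by rewrite mulrSr addr_eq0 => /eqP.
Qed.

Lemma char3_two0 : (2 : k) != 0.
Proof. by rewrite char3_two oppr_eq0 oner_neq0. Qed.

Lemma char3_eq (x y t : k) : x - y = 3 * t -> x = y.
Proof. by rewrite (pcharf0 char3) mul0r; apply: subr0_eq. Qed.

Lemma B12_bform (x y : B12 V) : bform x y = 2 * (x.1 * y.1) + <|x.2, y.2|>.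
Proof. by []. Qed.

Lemma B12_b11 : bform (un_one (B12 V)) (un_one (B12 V)) = 2.
Proof. by rewrite B12_bform /= sp_alt addr0 !mulr1. Qed.

Lemma B12_sbar (x : B12 V) : sbar x = (x.1, - x.2).
Proof.
have [_ r] := sp_bilin V; rewrite /sbar B12_bform /= (lin0 (r _)) addr0 mulr1.
case: x => a u; congr (_, _); last by rewrite /= scaler0 add0r.
by change (2 * a * 1 - a = a); ring.
Qed.

Lemma B12_para (x y : para (B12 V)) :
  smul x y = (x.1 * y.1 + <|x.2, y.2|>, - (x.1 *: y.2) - y.1 *: x.2).
Proof.
have -> : smul x y = @smul k (B12 V) (sbar x) (sbar y) by [].
rewrite !B12_sbar; congr (_, _); rewrite /= ?spNl ?spNr ?opprK //.
by rewrite !scalerN.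
Qed.

Lemma vect_char3 (U : lmodType k) (x y t : U) : x - y = 3 *: t -> x = y.
Proof. by rewrite (pcharf0 char3) scale0r; apply: subr0_eq. Qed.

Lemma pair_eq (U W : Type) (x y : U * W) : x.1 = y.1 -> x.2 = y.2 -> x = y.
Proof. by case: x y => a b [c d] /= -> ->. Qed.

Lemma scalek (a : k) (b : k^o) : a *: b = a * b.
Proof. by []. Qed.

(** For three odd elements the composition identities are the cyclic identity in
    the plane. The discrepancy in the associativity of the norm, and in the
    composition identities with the even element in the middle, is a multiple
    of 3. *)
Lemma B12_symmetric : symmetric_composition (para (B12 V)).
Proof.
have [l r] := sp_bilin V.
have sp0l u : <|0, u|> = 0 by rewrite (lin0 (l u)).
have sp0r u : <|u, 0|> = 0 by rewrite (lin0 (r u)).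
have b_para (x y : para (B12 V)) : bform x y = 2 * (x.1 * y.1) + <|x.2, y.2|> by [].
split.
- move=> x y z; rewrite !b_para !B12_para /= !(spDl, spDr, spNl, spNr, spZl, spZr).
  apply: (@char3_eq _ _ (z.1 * <|x.2, y.2|> - x.1 * <|y.2, z.2|>)).
  by ring.
- move=> p q t [a u] [b v] [c w] /mem_pair_part hx /mem_pair_part hy /mem_pair_part hz.
  rewrite !b_para !B12_para; apply: pair_eq => /=.
    rewrite !scalek.
    case: p q t hx hy hz => [] [] [] /= -> -> ->; rewrite /sgn /= ?expr1 ?expr0
      ?(spNl, spNr, spDl, spDr, spZl, spZr, sp0l, sp0r); try by ring.
    + by rewrite [<|v, u|>]sp_skew; ring.
    + by apply: (@char3_eq _ _ (- (b * <|u, w|>))); rewrite [<|w, u|>]sp_skew; ring.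
    by rewrite [<|w, v|>]sp_skew; ring.
  case: p q t hx hy hz => [] [] [] /= -> -> ->; rewrite /sgn /= ?expr1 ?expr0
    ?(spNl, spNr, spDl, spDr, spZl, spZr, sp0l, sp0r); try by module_eq k V; ring.
  apply: subr0_eq; rewrite -[RHS]oppr0 -(sp_cyclic u v w) [<|w, v|>]sp_skew.
  by rewrite [<|w, u|>]sp_skew; module_eq k V; ring.
- move=> p q t [a u] [b v] [c w] /mem_pair_part hx /mem_pair_part hy /mem_pair_part hz.
  rewrite !b_para !B12_para; apply: pair_eq => /=.
    rewrite !scalek.
    case: p q t hx hy hz => [] [] [] /= -> -> ->; rewrite /sgn /= ?expr1 ?expr0
      ?(spNl, spNr, spDl, spDr, spZl, spZr, sp0l, sp0r); try by ring.
    + by rewrite [<|v, u|>]sp_skew; ring.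
    + by apply: (@char3_eq _ _ (- (b * <|u, w|>))); rewrite [<|w, u|>]sp_skew; ring.
    by rewrite [<|w, v|>]sp_skew; ring.
  case: p q t hx hy hz => [] [] [] /= -> -> ->; rewrite /sgn /= ?expr1 ?expr0
    ?(spNl, spNr, spDl, spDr, spZl, spZr, sp0l, sp0r); try by module_eq k V; ring.
  apply: subr0_eq; rewrite -[RHS]oppr0 -(sp_cyclic u v w) [<|v, u|>]sp_skew.
  by rewrite [<|w, u|>]sp_skew; module_eq k V; ring.
case=> a u x0; have := x0 (1, 0); rewrite b_para /= sp0r addr0 mulr1 => /eqP.
rewrite mulf_eq0 (negPf char3_two0) /= => /eqP ->; congr (_, _).
apply: sp_nondeg0 => v; have := x0 (0, v).
by rewrite b_para /= mulr0 mulr0 add0r.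
Qed.

Lemma B42_bform (x y : B42 V) : bform x y = polar x.1 y.1 + <|x.2, y.2|>.
Proof. by []. Qed.

Lemma B42_b11 : bform (un_one (B42 V)) (un_one (B42 V)) = 2.
Proof. by rewrite B42_bform /= sp_alt addr0 polar_11. Qed.

Lemma B42_sbar (x : B42 V) : sbar x = (x.1^s, - x.2).
Proof.
have [_ r] := sp_bilin V; rewrite /sbar B42_bform /= (lin0 (r _)) addr0.
by rewrite sympl_bar_trace; case: x => f u; congr (_, _); rewrite /= scaler0 add0r.
Qed.

Lemma B42_para (x y : para (B42 V)) :
  smul x y = ((x.1^s \o y.1^s)%VF + rank1 x.2 y.2, - x.1 y.2 - y.1^s x.2).
Proof.
have -> : smul x y = @smul k (B42 V) (sbar x) (sbar y) by [].
rewrite !B42_sbar; congr (_, _); first by rewrite /= rank1Nl rank1Nr opprK.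
by rewrite /= sympl_barK !lfN.
Qed.

(** Each composition identity splits by parities. With at most one odd element it
    is a quaternion identity for endomorphisms, applied to a vector if needed;
    with two it is an identity for maps of rank 1; with three odd elements the
    two sides are 2 <u, w> v and - <u, w> v, which agree in characteristic 3. *)
Lemma B42_symmetric : symmetric_composition (para (B42 V)).
Proof.
have [l r] := sp_bilin V; have [rl rr] := @rank1_bilin k V.
have sp0l u : <|0, u|> = 0 by rewrite (lin0 (l u)).
have sp0r u : <|u, 0|> = 0 by rewrite (lin0 (r u)).
have r0l (u : V) : rank1 0 u = 0 by rewrite (lin0 (rl u)).
have r0r (u : V) : rank1 u 0 = 0 by rewrite (lin0 (rr u)).
have s0 : (0 : 'End(V))^s = 0 by rewrite (lin0 (@sympl_bar_linear k V)).
have b_para (x y : para (B42 V)) : bform x y = polar x.1 y.1 + <|x.2, y.2|> by [].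
have [pl pr] := polar_det_bilin k (sp_dim V).
have simp := (s0, sp0l, sp0r, r0l, r0r, @zero_lfunE, @lf0, polar_end0l, polar_end0r,
   @comp_lfun0l, @comp_lfun0r, @addr0, @add0r, @oppr0, @scaler0, @scale0r, @mulr0).
split.
- move=> [f u] [g v] [h w]; rewrite !b_para !B42_para /=.
  rewrite !(linD _ _ (@end_mx_linear k V)) (linD _ _ (pl _)) (linD _ _ (pr _)).
  rewrite polar_cyclic polar_rank1 [X in _ = _ + X + _]polar_detC polar_rank1.
  rewrite !(spDl, spDr, spNl, spNr) !sympl_barP' -!sympl_barP.
  rewrite [<|w, f v|>]sp_skew [<|h u, v|>]sp_skew.
  by ring.
- move=> p q t [f u] [g v] [h w] /mem_pair_part hx /mem_pair_part hy /mem_pair_part hz.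
  rewrite !b_para !B42_para; apply: pair_eq => /=.
    case: p q t hx hy hz => [] [] [] /= -> -> ->;
    rewrite /sgn /= ?expr1 ?expr0 ?scale1r ?scaleN1r ?mul1r ?mulN1r !simp //.
    + by rewrite sympl_bar_rank1 comp_lfunNl rank1_comp sympl_barK rank1Nl subrr.
    + rewrite !rank1Nl opprK addrC -!rank1_comp -comp_lfunNl -comp_lfunDl rank1_alt.
      by rewrite -comp_lfunZl comp_lfun1l.
    + by rewrite sympl_bar_rank1 comp_lfunNl rank1_comp sympl_barK rank1Nl opprK addNr.
    rewrite !sympl_bar_comp !sympl_barK -!comp_lfunA -comp_lfunDr.
    by rewrite sympl_bar_polar' -comp_lfunZr comp_lfun1r.
  case: p q t hx hy hz => [] [] [] /= -> -> ->;
    rewrite /sgn /= ?expr1 ?expr0 ?scale1r ?scaleN1r ?mul1r ?mulN1r !simp //.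
  + rewrite !rank1E opprK scaleNr -[RHS]opprK opprK [<|w, u|>]sp_skew scaleNr opprK.
    by apply: (vect_char3 (t := <|u, w|> *: v)); module_eq k V; ring.
  + by rewrite comp_lfunE /= lfN opprK subrr.
  + by rewrite !lfN !opprK addrC polar_bar_app polar_detC.
  by rewrite comp_lfunE /= lfN opprK addNr.
- move=> p q t [f u] [g v] [h w] /mem_pair_part hx /mem_pair_part hy /mem_pair_part hz.
  rewrite !b_para !B42_para; apply: pair_eq => /=.
    case: p q t hx hy hz => [] [] [] /= -> -> ->;
    rewrite /sgn /= ?expr1 ?expr0 ?scale1r ?scaleN1r ?mul1r ?mulN1r !simp //.
    + by rewrite sympl_bar_rank1 comp_lfunNr comp_rank1 rank1Nr opprK addNr.
    + rewrite !rank1Nr opprK addrC -!comp_rank1 -comp_lfunNr -comp_lfunDr rank1_alt.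
      by rewrite -comp_lfunZr comp_lfun1r.
    + by rewrite sympl_bar_rank1 comp_lfunNr comp_rank1 rank1Nr opprK addNr.
    rewrite !sympl_bar_comp !sympl_barK !comp_lfunA -comp_lfunDl.
    by rewrite sympl_bar_polar -comp_lfunZl comp_lfun1l.
  case: p q t hx hy hz => [] [] [] /= -> -> ->;
    rewrite /sgn /= ?expr1 ?expr0 ?scale1r ?scaleN1r ?mul1r ?mulN1r !simp //.
  + rewrite !sympl_bar_rank1 !opp_lfunE !rank1E !opprK [<|w, u|>]sp_skew.
    by apply: (vect_char3 (t := <|u, w|> *: v)); module_eq k V; ring.
  + by rewrite sympl_bar_comp !sympl_barK comp_lfunE /= lfN opprK addNr.
  + by rewrite !lfN !opprK polar_bar_app'.
  by rewrite sympl_bar_comp !sympl_barK comp_lfunE /= lfN opprK subrr.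
case=> f u x0; have u0 : u = 0.
  apply: sp_nondeg0 => v; have := x0 (0, v).
  by rewrite b_para /= polar_end0r add0r.
rewrite u0; congr (_, _); apply/lfunP => v; rewrite zero_lfunE; apply: sp_nondeg0 => w.
have := x0 (rank1 v w, 0).
by rewrite b_para /= sp0r addr0 polar_detC polar_rank1 sp_skew => /eqP;
  rewrite oppr_eq0 => /eqP.
Qed.

End Char3.

Theorem corollary3p10 (k : fieldType) (char3 : 3%N \in [pchar k]%R)
    (V : sympl_plane k) :
  superalgebra_iso (g_superalgebra (para (Mat2 k)) (para (B12 V)))
                   (TKK (H3 (B12 V)))
  /\
  superalgebra_iso (g_superalgebra (para (Mat2 k)) (para (B42 V)))
                   (TKK (H3 (B42 V))).
Proof.
have two0 := char3_two0 char3.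
split; apply: (g_TKK_iso two0).
- exact: B12_symmetric.
- exact: B12_b11.
- exact: B42_symmetric.
exact: B42_b11.
Qed.
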